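(* Let $\Gamma=\langle h,p\rangle$ be a Schottky group of isometries of the Poincaré disc $\mathbb{D}$ generated by a hyperbolic isometry $h$ and a parabolic isometry $p$. The Hausdorff dimension of the set $\Lambda_\infty$ of limit points diverging on average is equal to the critical exponent of the parabolic subgroup $\langle p\rangle$ of $\Gamma$. Precisely, $$\dim_H(\Lambda_\infty)=\frac12.$$
   Context: Setting. $\mathbb{D}$ is the Poincaré disc model of the hyperbolic plane, with boundary at infinity $\partial\mathbb{D}=\mathbb{S}^1$ and hyperbolic distance $d$. For an orientation-preserving isometry $g$ of $\mathbb{D}$ with $g(0)\ne 0$, let $C(g)$ be the perpendicular bisector of the hyperbolic segment $[0,g(0)]$ and $D(g)$ the closed half-plane of $\mathbb{D}$ bounded by $C(g)$ and containing $g(0)$. The group $\Gamma=\langle h,p\rangle$ is a rank two Schottky group: $h$ is hyperbolic with $C(h)\cap C(h^{-1})=\emptyset$ (also at infinity), $p$ is parabolic with fixed point $p^+\in\mathbb{S}^1$ (so $C(p)$ and $C(p^{-1})$ meet only at $p^+$ at infinity), and $\overline{D(h)\cup D(h^{-1})}\cap\overline{D(p)\cup D(p^{-1})}=\emptyset$ (closures in $\mathbb{D}\cup\mathbb{S}^1$). The region $\Delta=\bigcap_{g\in\{h^{\pm1},p^{\pm1}\}}(\mathbb{D}\setminus \mathring{D}(g))$ is the Dirichlet domain of $\Gamma$ centered at $0$; $\Gamma$ is free on $h,p$ and discrete. Let $\Sigma=\Gamma\backslash\mathbb{D}$ (a hyperbolic pair of pants with one cusp and two funnels). Diverging on average set.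 The limit set is $\Lambda=\overline{\Gamma z}\cap\partial\mathbb{D}$ (for any $z\in\mathbb{D}$). A limit point $\xi\in\Lambda$ is diverging on average if for every geodesic ray $\sigma:[0,\infty)\to\Sigma$ (parametrized by hyperbolic arc length) having a lift to $\mathbb{D}$ with endpoint $\xi$, and for every compact set $W\subset\Sigma$, $\lim_{T\to+\infty}\frac1T\int_0^T\chi_W(\sigma(t))\,dt=0$, where $\chi_W$ is the indicator function of $W$. $\Lambda_\infty$ denotes the set of such points. Hausdorff dimension and critical exponent. $\dim_H$ is the Hausdorff dimension of subsets of $\mathbb{S}^1$ with respect to the visual distance $d_0(\xi,\eta)=e^{-\langle\xi,\eta\rangle_0}$ for $\xi\ne\eta$ and $d_0(\xi,\xi)=0$, where $\langle\xi,\eta\rangle_0=\frac12(\beta_\xi(0,z)+\beta_\eta(0,z))$ for any $z$ on the geodesic $(\xi,\eta)$, and $\beta_\xi(z,z')=\lim_{t\to+\infty}(d(z,\xi_t)-d(z',\xi_t))$ with $t\mapsto\xi_t$ a geodesic ray ending at $\xi$. The critical exponent of a subgroup $G\subset\Gamma$ is $\inf\{s>0:\sum_{g\in G}e^{-s\,d(0,g(0))}<\infty\}$. *)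

(* Defs.v *)
From HB Require Import structures.
From mathcomp Require Import all_boot all_order all_algebra.
From mathcomp Require Import complex.
From mathcomp Require Import all_classical all_reals all_analysis.

Set Implicit Arguments.
Unset Strict Implicit.
Unset Printing Implicit Defensive.
Import Order.TTheory GRing.Theory Num.Theory.
Import numFieldNormedType.Exports.
Local Open Scope classical_set_scope.
Local Open Scope ring_scope.
Local Open Scope complex_scope.
Local Open Scope quotient_scope.

(* The usual topology of the plane, not inferred on [complex R] by default. *)
HB.instance Definition _ (R : realType) :=
  NormedModule.copy R[i] R[i]^o.

Section HyperbolicPlane.
Variable R : realType.

(* `|z| on R[i] is complex-valued; [normc] is the real modulus. *)
Local Notation normc := (@ComplexField.Normc.normc R).

Definition unit_disc : set R[i] := [set z | normc z < 1].
Definition unit_circle : set R[i] := [set z | normc z = 1].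

Lemma unit_disc0 : (0 : R[i]) \in unit_disc.
Proof. by rewrite inE /unit_disc /= expr0n addr0 sqrtr0. Qed.

Local Notation disc := (set_type unit_disc).
Local Notation circle := (set_type unit_circle).

Definition disc0 : disc := SigSub unit_disc0.

(* The curvature -1 distance, 2 artanh (|z - w| / |1 - z^* w|). *)
Definition hdist (z w : disc) : R :=
  let num := normc (\val z - \val w) in
  let den := normc (1 - (\val z)^* * \val w) in
  ln ((den + num) / (den - num)).

(* The action of PSU(1,1). *)
Definition orientation_preserving_isometry (g : disc -> disc) : Prop :=
  exists a b : R[i], normc a ^+ 2 - normc b ^+ 2 = 1 /\
    forall z, \val (g z) = (a * \val z + b) / (b^* * \val z + a^*).

(* The inverse when [g] is bijective, as every isometry is. *)
Definition disc_inv (g : disc -> disc) : disc -> disc :=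
  fun z => xget disc0 [set w | g w = z].

(* Points at infinity fixed by the continuous extension of [g]. *)
Definition fixed_at_infinity (g : disc -> disc) : set circle :=
  [set xi | forall u : nat -> disc,
    \val (u n) @[n --> \oo] --> \val xi ->
    \val (g (u n)) @[n --> \oo] --> \val xi].

Definition hyperbolic (g : disc -> disc) : Prop :=
  [/\ orientation_preserving_isometry g, forall z, g z <> z &
      exists xi eta, xi <> eta /\ fixed_at_infinity g = [set xi; eta]].

Definition parabolic (g : disc -> disc) : Prop :=
  [/\ orientation_preserving_isometry g, forall z, g z <> z &
      exists xi, fixed_at_infinity g = [set xi]].

Definition bisector (g : disc -> disc) : set disc :=
  [set z | hdist z disc0 = hdist z (g disc0)].

Definition half_plane (g : disc -> disc) : set disc :=
  [set z | hdist z (g disc0) <= hdist z disc0].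

(* The closure in the closed disc, which is closed in the plane. *)
Definition closure_at_infinity (A : set disc) : set R[i] :=
  closure [set \val z | z in A].

Definition schottky (h p : disc -> disc) : Prop :=
  [/\ hyperbolic h, parabolic p,
      closure_at_infinity (bisector h) `&`
        closure_at_infinity (bisector (disc_inv h)) = set0 &
      closure_at_infinity (half_plane h `|` half_plane (disc_inv h)) `&`
        closure_at_infinity (half_plane p `|` half_plane (disc_inv p)) = set0].

Inductive generated (S : set (disc -> disc)) : set (disc -> disc) :=
| generated_id : generated S id
| generated_mem g : S g -> generated S g
| generated_inv g : generated S g -> generated S (disc_inv g)
| generated_comp f g : generated S f -> generated S g -> generated S (f \o g).

Definition critical_exponent (G : set (disc -> disc)) : \bar R :=
  ereal_inf [set s%:E | s in
    [set s : R | 0 < s /\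
      (\esum_(g in G) (expR (- (s * hdist disc0 (g disc0))))%:E < +oo)%E]].

Definition orbit (G : set (disc -> disc)) (z : disc) : set disc :=
  [set g z | g in G].

Definition same_orbit (G : set (disc -> disc)) (z w : disc) : bool :=
  `[< orbit G z = orbit G w >].

Lemma same_orbit_equiv (G : set (disc -> disc)) :
  equiv_class_of (same_orbit G).
Proof.
split=> [z|z w|y x z].
- exact/asboolP.
- by apply/asboolP/asboolP.
- by move=> /asboolP xy /asboolP yz; apply/asboolP; rewrite xy.
Qed.

Canonical same_orbit_equiv_rel (G : set (disc -> disc)) :=
  EquivRelPack (same_orbit_equiv G).

Definition quotient_surface (G : set (disc -> disc)) :=
  quotient_topology {eq_quot same_orbit G}.

Definition limit_set (G : set (disc -> disc)) : set circle :=
  [set xi | closure_at_infinity (orbit G disc0) (\val xi)].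

Definition geodesic_ray (c : R -> disc) : Prop :=
  forall s t : R, 0 <= s -> 0 <= t -> hdist (c s) (c t) = `|s - t|.

Definition geodesic_line (c : R -> disc) : Prop :=
  forall s t : R, hdist (c s) (c t) = `|s - t|.

Definition ray_to (xi : circle) (c : R -> disc) : Prop :=
  geodesic_ray c /\ \val (c t) @[t --> +oo] --> \val xi.

Definition geodesic_between (xi eta : circle) : set disc :=
  [set z | exists c : R -> disc,
    [/\ geodesic_line c, \val (c t) @[t --> -oo] --> \val xi,
        \val (c t) @[t --> +oo] --> \val eta & exists t, c t = z]].

(* The limit does not depend on the ray ending at [xi], nor the Gromov product
   on the point of the geodesic, so that both are chosen arbitrarily. *)
Definition busemann (xi : circle) (z z' : disc) : R :=
  let c := xget (fun=> disc0) [set c | ray_to xi c] in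
  lim (hdist z (c t) - hdist z' (c t) @[t --> +oo]).

Definition gromov_product (xi eta : circle) : R :=
  let z := xget disc0 (geodesic_between xi eta) in
  2^-1 * (busemann xi disc0 z + busemann eta disc0 z).

Definition visual_dist (xi eta : circle) : R :=
  if xi == eta then 0 else expR (- gromov_product xi eta).

Definition diverging_on_average (G : set (disc -> disc)) : set circle :=
  [set xi | limit_set G xi /\
    forall sigma : R -> quotient_surface G,
      (exists c, ray_to xi c /\
         forall t : R, 0 <= t -> sigma t = \pi_(quotient_surface G) (c t)) ->
      forall W : set (quotient_surface G), compact W ->
        T^-1 * (\int[lebesgue_measure]_(t in `[0, T]) \1_W (sigma t))
          @[T --> +oo] --> (0 : R)].

End HyperbolicPlane.

Section Hausdorff.
Context {R : realType} {X : Type}.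
Variable dist : X -> X -> R.
Local Open Scope ereal_scope.

(* The diameter of set0 is -oo, whose positive powers are 0. *)
Definition diameter (U : set X) : \bar R :=
  ereal_sup [set (dist u.1 u.2)%:E | u in U `*` U].

Definition hausdorff_content (s delta : R) (A : set X) : \bar R :=
  ereal_inf [set \sum_(0 <= i <oo) (poweR (diameter (U i)) s) | U in
    [set U : nat -> set X | A `<=` \bigcup_i U i /\
       forall i, diameter (U i) <= delta%:E]].

Definition hausdorff_measure (s : R) (A : set X) : \bar R :=
  ereal_sup [set hausdorff_content s delta A | delta in
    [set delta : R | (0 < delta)%R]].

Definition hausdorff_dim (A : set X) : \bar R :=
  ereal_inf [set s%:E | s in
    [set s : R | (0 < s)%R /\ hausdorff_measure s A = 0]].

End Hausdorff.

Arguments unit_disc : clear implicits.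
Arguments unit_circle : clear implicits.
Notation disc R := (set_type (unit_disc R)).
Notation circle R := (set_type (unit_circle R)).

(* Main.v *)
Require Import Defs.
From mathcomp Require Import all_boot all_order all_algebra.
From mathcomp Require Import complex.
From mathcomp Require Import all_classical all_reals all_analysis.
From mathcomp Require Import ring lra.

(** A ray towards a limit point alternates between the thick part of the surface
    and excursions into the cusp, and an excursion which winds [n] times lasts
    about [2 * ln |n|]. The endpoint diverges on average when the mean length of
    the excursions tends to infinity. Both bounds on the dimension are obtained
    by coding limit points by these winding numbers.

    Isometries are treated as matrices of SU(1,1), through the exact distortion
    formula [act_dist]: distances are divided by [den m z * den m w], where
    [den] satisfies a cocycle relation. This matches the visual distance, which
    is half the chordal one (visual_distE).

    Coding. In a suitable coordinate [p ^ n] is the translation by [n]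
    (kap_par_inv), and the Schottky condition yields a quantitative ping-pong
    (schottky_pingpong). Hence a limit point is either in the orbit of the
    parabolic fixed point, which is countable, or it is coded by an infinite
    word in the letters [p ^ n * h] and [p ^ n * h^-1] (limit_coding). On the
    tails, the letter [p ^ n * h] contracts by [(1 + |n|) ^ 2] up to constants
    (block_den_ge, block_den_le). The ray ending at the point is near the orbit
    of the origin at the times [code_time k], the logarithms of the contractions
    of the prefixes (ray_near_orbit), and only around them (excursion).

    Upper bound (diverging_dim_le). If the point diverges on average, then for
    every [M] the product of the weights [1 + |n|] of its first [k] letters is
    at least [expR (M * k)] for [k] large (diverging_heavy). For the exponent
    [1 / 2 + b], the sum over one letter of the diameters to this power is a
    convergent series times a constant, of unknown size. But a part of the
    exponent can be traded for a factor [expR (- b * M)] per letter, which makes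
    the sum over all letters at most [1 / 2]; the cylinders of long heavy words
    are then covers of arbitrarily small measure.

    Lower bound (diverging_dim_ge). Let the [i]-th letter be any [p ^ n * h] with
    [2 ^ i <= n < 2 ^ i.+1]. The excursions grow, so that these points diverge on
    average (diverging_of_growth). They are parametrised by [0, 1) in the mixed
    radix system of bases [2 ^ i], and by [point_dist_ge] the parameter is a
    Hoelder function of the point, of any exponent smaller than [1 / 2]: the
    constants contribute an exponential in the length of the common prefix, the
    weights an exponential of a quadratic function of it.

    Finally the distance from the origin to its image by [p ^ n] is
    [2 * ln |n|] up to a constant (par_dist_ge, par_dist_le), and the Poincare
    series of the parabolic subgroup behaves as the series of the
    [n ^ (- 2 * s)]. *)

Set Implicit Arguments.
Unset Strict Implicit.
Unset Printing Implicit Defensive.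
Import Order.TTheory GRing.Theory Num.Theory.
Import numFieldNormedType.Exports.
Local Open Scope classical_set_scope.
Local Open Scope ring_scope.
Local Open Scope complex_scope.

Local Notation "z ^*" := (conjc z) : ring_scope.

(** * The modulus and the topology of the complex plane *)

Local Notation normc := ComplexField.Normc.normc.

Section Modulus.
Variable R : realType.
Implicit Types (z w : R[i]) (x : R).

Lemma normc_ge0 z : 0 <= normc z.
Proof. by case: z => a b; exact: sqrtr_ge0. Qed.

Lemma normcE z : `|z| = (normc z)%:C.
Proof. by []. Qed.

Lemma sqr_normcE z : normc z ^+ 2 = complex.Re z ^+ 2 + complex.Im z ^+ 2.
Proof. by case: z => a b /=; rewrite sqr_sqrtr // addr_ge0 // sqr_ge0. Qed.

Lemma sqr_normcJ z : (normc z ^+ 2)%:C = z * z^*.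
Proof. by rewrite rmorphXn /= -normcE sqr_normc. Qed.

Lemma normc_eq0 z : (normc z == 0) = (z == 0).
Proof.
apply/eqP/eqP => [/ComplexField.Normc.eq0_normc //|->].
exact: ComplexField.Normc.normc0.
Qed.

Lemma normc_gt0 z : (0 < normc z) = (z != 0).
Proof. by rewrite lt_neqAle normc_ge0 andbT eq_sym normc_eq0. Qed.

Lemma normcM z w : normc (z * w) = normc z * normc w.
Proof. exact: ComplexField.Normc.normcM. Qed.

Lemma normcV z : normc z^-1 = (normc z)^-1.
Proof. exact: ComplexField.Normc.normcV. Qed.

Lemma normcf_div z w : normc (z / w) = normc z / normc w.
Proof. by rewrite normcM normcV. Qed.

Lemma normcN z : normc (- z) = normc z.
Proof. by case: z => a b /=; rewrite !sqrrN. Qed.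

Lemma normc_conj z : normc z^* = normc z.
Proof. by case: z => a b /=; rewrite sqrrN. Qed.

Lemma normc_real x : normc x%:C = `|x|.
Proof. by rewrite /= expr0n /= addr0 sqrtr_sqr. Qed.

Lemma normc0 : normc (0 : R[i]) = 0.
Proof. exact: ComplexField.Normc.normc0. Qed.

Lemma normc1 : normc (1 : R[i]) = 1.
Proof. exact: ComplexField.Normc.normc1. Qed.

Lemma ler_normcD z w : normc (z + w) <= normc z + normc w.
Proof. by have := ler_normD z w; rewrite !normcE -rmorphD /= lecR. Qed.

Lemma normcB z w : normc (z - w) = normc (w - z).
Proof. by rewrite -normcN opprB. Qed.

Lemma ler_normcB z w : normc (z - w) <= normc z + normc w.
Proof. by have := ler_normcD z (- w); rewrite normcN. Qed.

Lemma lerB_normc z w : normc z - normc w <= normc (z - w).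
Proof. by rewrite lerBlDr; have := ler_normcD (z - w) w; rewrite subrK. Qed.

Lemma lerB_normcD z w : normc z - normc w <= normc (z + w).
Proof. by have := lerB_normc z (- w); rewrite normcN opprK. Qed.

Lemma ler_normc_dist z1 z2 z3 :
  normc (z1 - z2) <= normc (z1 - z3) + normc (z3 - z2).
Proof. by have := ler_normcD (z1 - z3) (z3 - z2); rewrite addrA subrK. Qed.

Lemma normc_Re z : `|complex.Re z| <= normc z.
Proof. by have := normc_ge_Re z; rewrite normcE lecR. Qed.

Lemma normc_Im z : `|complex.Im z| <= normc z.
Proof.
rewrite -[leRHS]ger0_norm ?normc_ge0 // -[leLHS]normr_id.
rewrite -ler_sqr ?nnegrE ?normr_ge0 // !real_normK ?num_real //.
by rewrite sqr_normcE lerDr sqr_ge0.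
Qed.

Lemma normc_le_ReIm z : normc z <= `|complex.Re z| + `|complex.Im z|.
Proof.
rewrite -ler_sqr ?nnegrE ?normc_ge0 ?addr_ge0 //.
rewrite sqr_normcE sqrrD !real_normK ?num_real // lerD2r lerDl.
by rewrite mulrn_wge0 // mulr_ge0.
Qed.

(** The two quantities compared here enter the hyperbolic distance. *)
Lemma pseudo_hyperbolic z w :
  normc (1 - z^* * w) ^+ 2 - normc (z - w) ^+ 2 =
  (1 - normc z ^+ 2) * (1 - normc w ^+ 2).
Proof. by rewrite !sqr_normcE; case: z => a b; case: w => c d /=; ring. Qed.

Lemma normc_dist_le_pseudo z w : normc z <= 1 -> normc w <= 1 ->
  normc (z - w) <= normc (1 - z^* * w).
Proof.
move=> z1 w1; rewrite -ler_sqr ?nnegrE ?normc_ge0 // -subr_ge0.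
by rewrite pseudo_hyperbolic mulr_ge0 // subr_ge0 expr_le1 ?normc_ge0.
Qed.

Lemma normc_dist_circle z w : normc w = 1 ->
  normc (1 - z^* * w) = normc (z - w).
Proof.
move=> w1; apply/eqP; rewrite -(@eqrXn2 _ 2) ?normc_ge0 // -subr_eq0.
by rewrite pseudo_hyperbolic w1 expr1n subrr mulr0.
Qed.

End Modulus.

Section PlaneTopology.
Variable R : realType.
Implicit Types (z w : R[i]).

(** The norm of [R[i]] takes its values in [R[i]]; convergence, neighbourhoods
    and closures are restated here with the real modulus. *)
Lemma cvg_normcP (T : Type) (F : set_system T) (FF : Filter F)
    (f : T -> R[i]) (z : R[i]) :
  f x @[x --> F] --> z <->
  forall e : R, 0 < e -> \forall x \near F, normc (z - f x) < e.
Proof.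
split=> [/cvgrPdist_lt h e e0|h].
  have e0' : 0 < e%:C by rewrite ltcR.
  have := h _ e0'; apply: filterS => x.
  by rewrite normcE ltcR.
apply/cvgrPdist_lt => e; rewrite ltcE => /andP[/eqP ei er].
have := h _ er; apply: filterS => x xe.
by rewrite normcE ltcE /= ei eqxx.
Qed.

Lemma nbhs_normcP z (P : set R[i]) :
  nbhs z P <-> exists2 e : R, 0 < e & forall w, normc (z - w) < e -> P w.
Proof.
split.
  move=> /nbhs_ballP[e /= e0 eP].
  move: e0; rewrite ltcE => /andP[/eqP ei er].
  exists (complex.Re e) => // w zw; apply: eP.
  by rewrite -ball_normE /ball_ /= normcE ltcE /= ei eqxx.
move=> [e e0 eP]; apply/nbhs_ballP; exists e%:C => /=; first by rewrite ltcR.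
move=> w; rewrite -ball_normE /ball_ /= normcE ltcR; exact: eP.
Qed.

Lemma closure_normcP (A : set R[i]) z :
  closure A z <-> forall e : R, 0 < e -> exists2 w, A w & normc (z - w) < e.
Proof.
split=> [cl e e0|h B /nbhs_normcP[e e0 eB]].
  have /cl[w [Aw ew]] : nbhs z [set w | normc (z - w) < e].
    by apply/nbhs_normcP; exists e.
  by exists w.
by have [w Aw zw] := h _ e0; exists w; split => //; apply: eB.
Qed.

Lemma cvg_normc (T : Type) (F : set_system T) (FF : Filter F)
    (f : T -> R[i]) (z : R[i]) :
  f x @[x --> F] --> z -> normc (f x) @[x --> F] --> normc z.
Proof.
move=> /cvg_normcP h; apply/cvgrPdist_lt => e e0.
have := h _ e0; apply: filterS => x; apply: le_lt_trans.
rewrite ler_norml lerB_normc andbT lerNl opprB normcB.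
exact: lerB_normc.
Qed.

End PlaneTopology.

(** * The group SU(1,1) *)

Section Conjugation.
Variable R : realType.
Implicit Types (z w : R[i]).

Lemma conjcD z w : (z + w)^* = z^* + w^*.
Proof. exact: rmorphD. Qed.

Lemma conjcN z : (- z)^* = - z^*.
Proof. exact: rmorphN. Qed.

Lemma conjcM z w : (z * w)^* = z^* * w^*.
Proof. exact: rmorphM. Qed.

Lemma conjcV z : (z^-1)^* = (z^*)^-1.
Proof. exact: fmorphV. Qed.

Definition conjcE := (conjcD, conjcN, conjcM, conjcV, @conjcK R).

End Conjugation.

Section SU11.
Variable R : realType.
Implicit Types (z w : R[i]).

(** The matrix with rows [(a, b)] and the conjugates of [(b, a)]. *)
Record su11 := SU11 {
  su_a : R[i];
  su_b : R[i];
  su_det : su_a * su_a^* = 1 + su_b * su_b^* }.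

Implicit Types m n : su11.

Definition su_den m z := (su_b m)^* * z + (su_a m)^*.
Definition act m z := (su_a m * z + su_b m) / su_den m z.
(** On the closed disc, the modulus of the derivative of [m] at [z] is the
    inverse square of this quantity. *)
Definition den m z : R := normc (su_den m z).

Lemma su_detE m : normc (su_a m) ^+ 2 = 1 + normc (su_b m) ^+ 2.
Proof.
apply: complexI; rewrite sqr_normcJ su_det -sqr_normcJ rmorphD rmorph1 //.
Qed.

Lemma su_b_lt_a m : normc (su_b m) < normc (su_a m).
Proof.
by rewrite -ltr_sqr ?nnegrE ?normc_ge0 // su_detE ltrDr.
Qed.

Lemma su_a_ge1 m : 1 <= normc (su_a m).
Proof.
by rewrite -[1]ger0_norm // -(ger0_norm (normc_ge0 (su_a m))) -ler_sqr
  ?nnegrE // !real_normK ?num_real // expr1n su_detE lerDl sqr_ge0.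
Qed.

Lemma su_a_gt0 m : 0 < normc (su_a m).
Proof. exact: lt_le_trans ltr01 (su_a_ge1 m). Qed.

Lemma su_a_neq0 m : su_a m != 0.
Proof. by rewrite -normc_gt0 su_a_gt0. Qed.

Lemma su_a_conj_neq0 m : (su_a m)^* != 0.
Proof. by rewrite conjc_eq0 su_a_neq0. Qed.

(** As [|b| < |a|], the pole of the Moebius map lies outside the closed
    disc. *)
Lemma den_gt0 m z : normc z <= 1 -> 0 < den m z.
Proof.
move=> z1; apply: lt_le_trans (_ : 0 < normc (su_a m) - normc (su_b m)) _.
  by rewrite subr_gt0 su_b_lt_a.
rewrite /den /su_den [_ * z + _]addrC; apply: le_trans (lerB_normcD _ _).
by rewrite !normc_conj normcM normc_conj lerB // ler_piMr // normc_ge0.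
Qed.

Lemma den_ge0 m z : 0 <= den m z.
Proof. exact: normc_ge0. Qed.

Lemma su_den_neq0 m z : normc z <= 1 -> su_den m z != 0.
Proof. by move=> z1; rewrite -normc_gt0; exact: den_gt0. Qed.

Lemma den_neq0 m z : normc z <= 1 -> den m z != 0.
Proof. by move=> z1; rewrite gt_eqF // den_gt0. Qed.

Lemma den_le m z : normc z <= 1 -> den m z <= 2 * normc (su_a m).
Proof.
move=> z1; rewrite (le_trans (ler_normcD _ _)) // normcM !normc_conj.
rewrite mulr2n mulrDl mul1r lerD2r (le_trans _ (ltW (su_b_lt_a m))) //.
by rewrite ler_piMr // normc_ge0.
Qed.

Lemma den0 m : den m 0 = normc (su_a m).
Proof. by rewrite /den /su_den mulr0 add0r normc_conj. Qed.

(** Moebius maps distort distances by the geometric mean of the derivatives at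
    the two points, exactly. *)
Lemma act_dist m z w : normc z <= 1 -> normc w <= 1 ->
  normc (act m z - act m w) = normc (z - w) / (den m z * den m w).
Proof.
move=> z1 w1; have := su_den_neq0 m z1; have := su_den_neq0 m w1.
rewrite /act /den -normcM -normcf_div /su_den => h1 h2; congr (normc _).
by field: (su_det m); rewrite h1 h2.
Qed.

Lemma su_den_conj m z : (su_den m z)^* = su_b m * z^* + su_a m.
Proof.
rewrite /su_den; move: (su_a m) (su_b m) z => [a1 a2] [b1 b2] [x y].
by apply/eqP; rewrite eq_complex /=; apply/andP; split; apply/eqP; ring.
Qed.

Lemma act_conj m z :
  (act m z)^* = ((su_a m)^* * z^* + (su_b m)^*) / (su_b m * z^* + su_a m).
Proof. by rewrite -su_den_conj /act rmorphM fmorphV rmorphD rmorphM. Qed.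

(** The same factor as in [act_dist]: quotients of the two quantities, hence
    the hyperbolic distance, are invariant. *)
Lemma act_pseudo m z w : normc z <= 1 -> normc w <= 1 ->
  normc (1 - (act m z)^* * act m w) =
  normc (1 - z^* * w) / (den m z * den m w).
Proof.
move=> z1 w1; have := su_den_neq0 m z1; have := su_den_neq0 m w1.
move=> h1; rewrite -conjc_eq0 /den.
rewrite -[normc (su_den m z)]normc_conj -normcM -normcf_div.
rewrite act_conj su_den_conj /act => h2; congr (normc _).
move: h1; rewrite /su_den => h1.
by field: (su_det m); rewrite h1 h2.
Qed.

(** The depth [1 - |z| ^ 2] is scaled by the derivative, as the hyperbolic
    metric is invariant. *)
Lemma act_normB m z : normc z <= 1 ->
  1 - normc (act m z) ^+ 2 = (1 - normc z ^+ 2) / den m z ^+ 2.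
Proof.
move=> z1; have d0 := den_neq0 m z1.
have e : den m z ^+ 2 - normc (su_a m * z + su_b m) ^+ 2 = 1 - normc z ^+ 2.
  have -> : den m z ^+ 2 - normc (su_a m * z + su_b m) ^+ 2 =
    (normc (su_a m) ^+ 2 - normc (su_b m) ^+ 2) * (1 - normc z ^+ 2).
    rewrite /den /su_den !sqr_normcE; case: z z1 {d0} => x y _.
    by case: (su_a m) => a1 a2; case: (su_b m) => b1 b2 /=; ring.
  by rewrite su_detE addrK mul1r.
rewrite /act normcf_div -/(den m z) -e expr_div_n mulrBl divff // expf_eq0 //.
Qed.

Lemma act_circle m z : normc z = 1 -> normc (act m z) = 1.
Proof.
move=> z1; have z1' : normc z <= 1 by rewrite z1.
have := act_normB m z1'; rewrite z1 expr1n subrr mul0r.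
move/eqP; rewrite subr_eq0 eq_sym => /eqP h.
by apply/eqP; rewrite -(@eqrXn2 _ 2) ?normc_ge0 // expr1n h.
Qed.

Lemma act_lt1 m z : normc z < 1 -> normc (act m z) < 1.
Proof.
move=> z1; rewrite -(@expr_lt1 _ 2) ?normc_ge0 // -subr_gt0 act_normB ?ltW //.
by rewrite divr_gt0 // ?exprn_gt0 ?den_gt0 ?ltW // subr_gt0 expr_lt1 ?normc_ge0.
Qed.

Lemma act_le1 m z : normc z <= 1 -> normc (act m z) <= 1.
Proof.
rewrite le_eqVlt => /orP[/eqP/(act_circle m)->//|/(act_lt1 m)/ltW//].
Qed.

Program Definition su_one := @SU11 1 0 _.
Next Obligation. by rewrite conjc1 mul0r addr0 mulr1. Qed.

Program Definition su_inv m := @SU11 (su_a m)^* (- su_b m) _.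
Next Obligation.
by move=> m; rewrite conjcK mulrC su_det rmorphN /= mulrNN.
Qed.

Program Definition su_mul m n := @SU11
  (su_a m * su_a n + su_b m * (su_b n)^*)
  (su_a m * su_b n + su_b m * (su_a n)^*) _.
Next Obligation.
move=> m n; rewrite !conjcE.
by ring: (su_det m) (su_det n).
Qed.

Lemma su_ext m n : su_a m = su_a n -> su_b m = su_b n -> m = n.
Proof.
case: m n => [a b e] [c d f] /= ac bd; subst; congr SU11.
exact: Prop_irrelevance.
Qed.

Lemma su_den_one z : su_den su_one z = 1.
Proof. by rewrite /su_den -[su_a _]/1 -[su_b _]/0 conjc1 conjc0 mul0r add0r. Qed.

Lemma act_one z : act su_one z = z.
Proof.
by rewrite /act su_den_one -[su_a _]/1 -[su_b _]/0 mul1r addr0 divr1.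
Qed.

Lemma den_one z : den su_one z = 1.
Proof. by rewrite /den su_den_one normc1. Qed.

(** The cocycle relation, which is the chain rule for the derivative. *)
Lemma su_den_mul m n z : normc z <= 1 ->
  su_den (su_mul m n) z = su_den m (act n z) * su_den n z.
Proof.
move=> z1; have := su_den_neq0 n z1; rewrite /act /su_den /=.
rewrite !conjcE => h.
by field.
Qed.

Lemma den_mul m n z : normc z <= 1 ->
  den (su_mul m n) z = den m (act n z) * den n z.
Proof. by move=> z1; rewrite /den su_den_mul // normcM. Qed.

Lemma act_mul m n z : normc z <= 1 -> act (su_mul m n) z = act m (act n z).
Proof.
move=> z1; have h1 := su_den_neq0 n z1.
rewrite {1}/act su_den_mul // [su_den m _ * _]mulrC invfM mulrA [in RHS]/act; congr (_ / _).
move: h1; rewrite /act /su_den /= => h1.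
by field.
Qed.

Lemma act_invK m z : normc z <= 1 -> act (su_inv m) (act m z) = z.
Proof.
move=> z1; rewrite -act_mul // -[RHS]act_one; congr act.
by apply: su_ext => /=; rewrite ?conjcE; ring: (su_det m).
Qed.

Lemma act_Kinv m z : normc z <= 1 -> act m (act (su_inv m) z) = z.
Proof.
move=> z1; rewrite -act_mul // -[RHS]act_one; congr act.
by apply: su_ext => /=; rewrite ?conjcE; ring: (su_det m).
Qed.

Lemma den_inv m z : normc z <= 1 -> den (su_inv m) (act m z) = (den m z)^-1.
Proof.
move=> z1; have d0 := den_neq0 m z1; apply: (mulIf d0).
rewrite -den_mul // mulVf // -[RHS](den_one z); congr den.
by apply: su_ext => /=; rewrite ?conjcE; ring: (su_det m).
Qed.

Lemma su_inv_mul m n : su_inv (su_mul m n) = su_mul (su_inv n) (su_inv m).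
Proof. by apply: su_ext => /=; rewrite ?conjcE; ring. Qed.

Lemma act0 m : act m 0 = su_b m / (su_a m)^*.
Proof. by rewrite /act /su_den !mulr0 !add0r. Qed.

Lemma act_inv0 m : act (su_inv m) 0 = - (su_b m / su_a m).
Proof. by rewrite act0 /= conjcK mulNr. Qed.

(** When [|a|] is large, the derivative is small except next to the preimage
    of the origin. *)
Lemma den_preimage0 m z : normc z <= 1 ->
  den m z = normc (su_a m) * normc (1 - (act (su_inv m) 0)^* * z).
Proof.
move=> z1; rewrite act_inv0 -[normc (su_a m)]normc_conj -normcM /den /su_den.
have h := su_a_conj_neq0 m; rewrite !conjcE.
by congr normc; field.
Qed.

Lemma den_ge_preimage0 m z e : normc z <= 1 ->
  e <= normc (z - act (su_inv m) 0) -> normc (su_a m) * e <= den m z.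
Proof.
move=> z1 ze; rewrite den_preimage0 // ler_wpM2l ?normc_ge0 //.
apply: le_trans ze _; rewrite normcB; apply: normc_dist_le_pseudo => //.
by rewrite ltW // act_lt1 // normc0.
Qed.

End SU11.

(** * Isometries of the disc as matrices *)

Section DiscIsometries.
Variable R : realType.
Implicit Types (z w : R[i]) (m : su11 R) (g f : disc R -> disc R).

Lemma disc_lt1 (x : disc R) : normc (\val x) < 1.
Proof. by have := valP x; rewrite inE. Qed.

Lemma disc_le1 (x : disc R) : normc (\val x) <= 1.
Proof. exact: ltW (disc_lt1 x). Qed.

Lemma circle_eq1 (xi : circle R) : normc (\val xi) = 1.
Proof. by have := valP xi; rewrite inE. Qed.

Lemma circle_le1 (xi : circle R) : normc (\val xi) <= 1.
Proof. by rewrite circle_eq1. Qed.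

Lemma disc_sqr_lt1 (x : disc R) : 0 < 1 - normc (\val x) ^+ 2.
Proof. by rewrite subr_gt0 expr_lt1 ?normc_ge0 ?disc_lt1. Qed.

Lemma to_disc z : normc z < 1 -> {x : disc R | \val x = z}.
Proof.
move=> z1; have h : z \in unit_disc R by rewrite inE.
by exists (SigSub h).
Qed.

Lemma to_circle z : normc z = 1 -> {x : circle R | \val x = z}.
Proof.
move=> z1; have h : z \in unit_circle R by rewrite inE.
by exists (SigSub h).
Qed.

Lemma val_disc0 : \val (disc0 R) = 0.
Proof. by []. Qed.

Definition realizes m g := forall x, \val (g x) = act m (\val x).

Lemma isometry_realized g :
  orientation_preserving_isometry g -> exists m, realizes m g.
Proof.
move=> [a [b [ab gE]]].
have abC : a * a^* = 1 + b * b^*.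
  rewrite -!sqr_normcJ; have -> : normc a ^+ 2 = 1 + normc b ^+ 2 by lra.
  by rewrite rmorphD rmorph1.
by exists (SU11 abC) => x; rewrite gE.
Qed.

Lemma realizes_id : realizes (su_one R) id.
Proof. by move=> x; rewrite act_one. Qed.

Lemma realizes_comp m (n : su11 R) f g :
  realizes m f -> realizes n g -> realizes (su_mul m n) (f \o g).
Proof. by move=> mf ng x; rewrite act_mul ?disc_le1 // mf ng. Qed.

Lemma realizes_inv m g : realizes m g -> realizes (su_inv m) (disc_inv g).
Proof.
move=> mg x; have x1 := disc_lt1 x.
have [y yE] := to_disc (act_lt1 (su_inv m) x1).
have gy : g y = x by apply: val_inj; rewrite mg yE act_Kinv // ltW.
have : g (disc_inv g x) = x.
  exact: (@xgetPex _ (disc0 R) [set w | g w = x] (ex_intro _ y gy)).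
by move=> {2}<-; rewrite mg act_invK // disc_le1.
Qed.

Lemma realizes_ext m f g : realizes m f -> realizes m g -> f = g.
Proof. by move=> mf mg; apply/funext => x; apply: val_inj; rewrite mf mg. Qed.

Lemma disc_invK m g : realizes m g -> cancel g (disc_inv g).
Proof.
move=> mg x; apply: val_inj.
by rewrite (realizes_inv mg) mg act_invK // disc_le1.
Qed.

Lemma act_continuous m z (T : Type) (F : set_system T) (FF : Filter F)
    (u : T -> R[i]) : normc z <= 1 -> (forall t, normc (u t) <= 1) ->
  u t @[t --> F] --> z -> act m (u t) @[t --> F] --> act m z.
Proof.
move=> z1 u1 /cvg_normcP uz; apply/cvg_normcP => e e0.
pose d := normc (su_a m) - normc (su_b m).
have d0 : 0 < d by rewrite subr_gt0 su_b_lt_a.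
have dd w : normc w <= 1 -> d <= den m w.
  move=> w1; rewrite /den /su_den [_ * w + _]addrC.
  apply: le_trans (lerB_normcD _ _).
  by rewrite !normc_conj normcM normc_conj lerB // ler_piMr // normc_ge0.
have := uz (e * (d * d)) (mulr_gt0 e0 (mulr_gt0 d0 d0)).
apply: filterS => t zt; rewrite act_dist // ltr_pdivrMr; last first.
  by rewrite mulr_gt0 ?den_gt0.
apply: lt_le_trans zt _; rewrite ler_wpM2l ?(ltW e0) //.
by rewrite ler_pM ?dd // ltW.
Qed.

(** Every boundary point is approached along its radius. *)
Lemma radial_approach (xi : circle R) :
  exists u : nat -> disc R, \val (u n) @[n --> \oo] --> \val xi.
Proof.
have h (n : nat) : normc ((1 - harmonic n)%:C * \val xi : R[i]) < 1.
  rewrite normcM circle_eq1 mulr1 normc_real /harmonic /=.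
  have h1 : 0 < n.+1%:R^-1 :> R by rewrite invr_gt0.
  have h2 : n.+1%:R^-1 <= 1 :> R by rewrite invf_le1 // ler1n.
  by move: (n.+1%:R^-1) h1 h2 => x h1 h2; rewrite ger0_norm; lra.
exists (fun n => sval (to_disc (h n))); apply/cvg_normcP => e e0.
have /cvgrPdist_lt/(_ _ e0) := @cvg_harmonic R.
apply: filterS => n; case: (to_disc (h n)) => x /= -> hn.
have -> : \val xi - (1 - harmonic n)%:C * \val xi =
   (harmonic n)%:C * \val xi by rewrite rmorphB rmorph1; ring.
by rewrite normcM circle_eq1 mulr1 normc_real -normrN -sub0r.
Qed.

Lemma fixed_at_infinityE m g (xi : circle R) : realizes m g ->
  fixed_at_infinity g xi <-> act m (\val xi) = \val xi.
Proof.
move=> mg.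
have gu (u : nat -> disc R) : \val (u n) @[n --> \oo] --> \val xi ->
    \val (g (u n)) @[n --> \oo] --> act m (\val xi).
  move=> ux; under eq_cvg do rewrite mg.
  by apply: act_continuous => // [|t]; rewrite ?circle_le1 ?disc_le1.
split=> [fx|fx u ux]; last by have := gu u ux; rewrite fx.
have [u ux] := radial_approach xi.
exact: (cvg_unique (@norm_hausdorff _ _) (gu u ux) (fx u ux)).
Qed.

(** ** Parabolic and hyperbolic isometries *)

Local Notation tr2 m := (complex.Re (su_a m)).

(** Up to the translation that centres it, the fixed point equation is a
    square root extraction. *)
Lemma fixed_pointE m xi : normc xi = 1 -> su_b m != 0 ->
  act m xi = xi <->
  ((su_b m)^* * xi - (0 +i* complex.Im (su_a m))) ^+ 2 = (tr2 m ^+ 2 - 1)%:C.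
Proof.
move=> x1 b0; have x1' : normc xi <= 1 by rewrite x1.
have d0 := su_den_neq0 m x1'.
have b0' : (su_b m)^* != 0 by rewrite conjc_eq0.
have e : (su_b m)^* * (xi * su_den m xi - (su_a m * xi + su_b m)) =
  ((su_b m)^* * xi - (0 +i* complex.Im (su_a m))) ^+ 2 - (tr2 m ^+ 2 - 1)%:C.
  have := su_det m; rewrite /su_den.
  move: (su_a m) (su_b m) xi {x1 b0 x1' d0 b0'} => [a1 a2] [b1 b2] [x y].
  move=> /eqP; rewrite eq_complex /= => /andP[/eqP h _].
  apply/eqP; rewrite eq_complex /=; apply/andP; split; apply/eqP.
    have -> : a1 ^+ 2 = 1 + b1 ^+ 2 + b2 ^+ 2 - a2 ^+ 2 by lra.
    ring.
  ring.
have -> : act m xi = xi <-> xi * su_den m xi - (su_a m * xi + su_b m) = 0.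
  rewrite /act; split=> [/(congr1 (fun t => t * su_den m xi))|/eqP].
    by rewrite divfK // => ->; rewrite subrr.
  by rewrite subr_eq0 => /eqP <-; rewrite mulfK.
split=> h; first by apply/eqP; rewrite -subr_eq0 -e h mulr0.
apply: (mulfI b0'); rewrite e h subrr mulr0 //.
Qed.

Lemma isometry_b_neq0 m g : realizes m g -> (forall x, g x <> x) ->
  su_b m != 0.
Proof.
move=> mg gx; apply/eqP => b0; apply: (gx (disc0 R)); apply: val_inj.
by rewrite mg val_disc0 act0 b0 mul0r.
Qed.

(** An elliptic matrix would move every boundary point. *)
Lemma fixed_at_infinity_tr2 m g xi : realizes m g -> (forall x, g x <> x) ->
  fixed_at_infinity g xi -> 1 <= tr2 m ^+ 2.
Proof.
move=> mg gx /(fixed_at_infinityE _ mg) fx.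
have b0 := isometry_b_neq0 mg gx.
have x1 := circle_eq1 xi.
move: fx => /(fixed_pointE x1 b0).
set k := _ - _ => fx; rewrite leNgt; apply/negP => t1.
have bE : normc (k + (0 +i* complex.Im (su_a m))) ^+ 2 = normc (su_b m) ^+ 2.
  by rewrite subrK normcM normc_conj x1 mulr1.
have bpos : 0 < normc (su_b m) ^+ 2 by rewrite exprn_gt0 // normc_gt0.
have aE := su_detE m; rewrite sqr_normcE in aE.
rewrite sqr_normcE in bE.
move: k fx bE => [k1 k2]; rewrite expr2 => /eqP; rewrite eq_complex /= addr0.
move: (tr2 m) (complex.Im _) (normc _ ^+ 2) t1 bpos aE => t u b t1 bpos aE.
move=> /andP[/eqP e1 /eqP e2] bE.
have k12 : k1 * k2 = 0 by lra.
move/eqP: k12; rewrite mulf_eq0 => /orP[/eqP k10|/eqP k20].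
  have k2u : k2 * (k2 + u) = 0 by rewrite k10 in e1 bE; nra.
  move/eqP: k2u; rewrite mulf_eq0 => /orP[/eqP k20|/eqP k2u].
    by rewrite k10 k20 in e1; lra.
  by rewrite k10 k2u in bE; lra.
by rewrite k20 in e1; nra.
Qed.

Lemma fixed_point_of_root m (s : R) : s ^+ 2 = tr2 m ^+ 2 - 1 ->
  su_b m != 0 ->
  exists2 xi : circle R, act m (\val xi) = \val xi &
    (su_b m)^* * \val xi = s +i* complex.Im (su_a m).
Proof.
move=> sE b0; have b0' : (su_b m)^* != 0 by rewrite conjc_eq0.
pose x := (s +i* complex.Im (su_a m)) / (su_b m)^*.
have x1 : normc x = 1.
  rewrite normcf_div normc_conj; apply/eqP.
  have bpos : normc (su_b m) != 0 by rewrite normc_eq0.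
  rewrite -(inj_eq (mulIf bpos)) mul1r divfK //.
  rewrite -(@eqrXn2 _ 2) ?normc_ge0 // sqr_normcE /= sE.
  by have := su_detE m; rewrite sqr_normcE => h; apply/eqP; lra.
have xE : (su_b m)^* * x = s +i* complex.Im (su_a m).
  by rewrite /x mulrC divfK.
have [xi xiE] := to_circle x1; exists xi; rewrite xiE //.
apply/(fixed_pointE x1 b0); rewrite xE.
have -> : (s +i* complex.Im (su_a m)) - (0 +i* complex.Im (su_a m)) = s%:C.
  by apply/eqP; rewrite eq_complex /= subr0 subrr !eqxx.
by rewrite -rmorphXn /= sE.
Qed.

(** A vanishing square root would leave a single fixed point at infinity. *)
Lemma hyperbolic_tr2 m h : hyperbolic h -> realizes m h -> 1 < tr2 m ^+ 2.
Proof.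
move=> [_ hx [xi [eta [xe fE]]]] mh.
have fxi : fixed_at_infinity h xi by rewrite fE; left.
have feta : fixed_at_infinity h eta by rewrite fE; right.
have b0 := isometry_b_neq0 mh hx.
rewrite lt_neqAle (fixed_at_infinity_tr2 mh hx fxi) andbT.
apply/eqP => t1; apply: xe; apply: val_inj.
have b0' : (su_b m)^* != 0 by rewrite conjc_eq0.
have root zeta : fixed_at_infinity h zeta ->
    (su_b m)^* * \val zeta = (0 +i* complex.Im (su_a m)).
  move=> /(fixed_at_infinityE _ mh)/(fixed_pointE (circle_eq1 zeta) b0).
  rewrite -t1 subrr => /eqP; rewrite expf_eq0 /= subr_eq0 => /eqP //.
by apply: (mulfI b0'); rewrite !root.
Qed.

(** Two distinct square roots would give two fixed points at infinity. *)
Lemma parabolic_tr2 m p : parabolic p -> realizes m p -> tr2 m ^+ 2 = 1.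
Proof.
move=> [_ px [xi fE]] mp.
have fxi : fixed_at_infinity p xi by rewrite fE.
have b0 := isometry_b_neq0 mp px.
have := fixed_at_infinity_tr2 mp px fxi; rewrite le_eqVlt => /orP[/eqP //|t1].
pose s := Num.sqrt (tr2 m ^+ 2 - 1).
have s0 : 0 < s by rewrite sqrtr_gt0 subr_gt0.
have sE : s ^+ 2 = tr2 m ^+ 2 - 1 by rewrite sqr_sqrtr // subr_ge0 ltW.
have [x1 fx1 e1] := fixed_point_of_root sE b0.
have sE' : (- s) ^+ 2 = tr2 m ^+ 2 - 1 by rewrite sqrrN.
have [x2 fx2 e2] := fixed_point_of_root sE' b0.
have inf x : act m (\val x) = \val x -> x = xi.
  by move=> /(fixed_at_infinityE _ mp); rewrite fE.
move: e2; rewrite (inf _ fx2) -(inf _ fx1) e1 => /eqP.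
by rewrite eq_complex /= => /andP[/eqP h _]; lra.
Qed.

End DiscIsometries.

(** * Hyperbolic distance and isometric discs *)

Section HyperbolicDistance.
Variable R : realType.
Implicit Types (m : su11 R) (g : disc R -> disc R) (x y : disc R).

Let num x y := normc (\val x - \val y).
Let den2 x y := normc (1 - (\val x)^* * \val y).

Lemma num_lt_den x y :
  normc (\val x - \val y) < normc (1 - (\val x)^* * \val y).
Proof.
rewrite -ltr_sqr ?nnegrE ?normc_ge0 // -subr_gt0 pseudo_hyperbolic.
by rewrite mulr_gt0 // disc_sqr_lt1.
Qed.

Lemma hdistE x y : hdist x y = ln ((den2 x y + num x y) / (den2 x y - num x y)).
Proof. by []. Qed.

Lemma hdist_logE x y : hdist x y = 2 * ln (den2 x y + num x y)
  - ln (1 - normc (\val x) ^+ 2) - ln (1 - normc (\val y) ^+ 2).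
Proof.
have x1 := disc_sqr_lt1 x; have y1 := disc_sqr_lt1 y.
have lt := num_lt_den x y; have n0 : 0 <= num x y by exact: normc_ge0.
have s0 : 0 < den2 x y + num x y by rewrite /den2 /num in n0 *; lra.
have d0 : 0 < den2 x y - num x y by rewrite subr_gt0.
have prodE : (den2 x y + num x y) * (den2 x y - num x y) =
    (1 - normc (\val x) ^+ 2) * (1 - normc (\val y) ^+ 2).
  by rewrite -pseudo_hyperbolic -/(den2 x y) -/(num x y); ring.
have := congr1 (@ln R) prodE; rewrite !lnM // => e.
rewrite hdistE ln_div //; lra.
Qed.

Lemma hdist_realizes m g x y : realizes m g -> hdist (g x) (g y) = hdist x y.
Proof.
move=> mg; rewrite !hdistE /num /den2 !mg act_dist ?disc_le1 //.
rewrite act_pseudo ?disc_le1 // -mulrDl -mulrBl.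
have : den m (\val x) * den m (\val y) != 0.
  by rewrite mulf_neq0 // den_neq0 ?disc_le1.
move: (den m _ * _) => d d0.
by rewrite invfM invrK mulrACA [_^-1 * _]mulVf // mulr1.
Qed.

Lemma hdistC x y : hdist x y = hdist y x.
Proof.
rewrite !hdistE /num /den2 normcB.
have -> : normc (1 - (\val x)^* * \val y) = normc (1 - (\val y)^* * \val x).
  rewrite -normc_conj conjcD conjcN conjcM conjcK conjc1 mulrC //.
by [].
Qed.

Lemma hdist0E x : hdist x (disc0 R) =
  ln ((1 + normc (\val x)) / (1 - normc (\val x))).
Proof. by rewrite hdistE /num /den2 val_disc0 mulr0 !subr0 normc1. Qed.

Lemma ler_hdist0 x y : (hdist x (disc0 R) <= hdist y (disc0 R)) =
  (normc (\val x) <= normc (\val y)).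
Proof.
have x1 := disc_lt1 x; have y1 := disc_lt1 y.
have x0 := normc_ge0 (\val x); have y0 := normc_ge0 (\val y).
rewrite !hdist0E ler_ln ?posrE; last 2 first.
- by rewrite divr_gt0 //; lra.
- by rewrite divr_gt0 //; lra.
rewrite ler_pdivrMr; last lra.
rewrite mulrAC ler_pdivlMr; last lra.
by apply/idP/idP => h; nra.
Qed.

(** A half-plane is cut out by the disc where the inverse expands. *)
Lemma half_planeP m g x : realizes m g ->
  den (su_inv m) (\val x) <= 1 -> half_plane g x.
Proof.
move=> mg dx; rewrite /half_plane /=.
have mi := realizes_inv mg.
rewrite -(hdist_realizes _ _ mi) (disc_invK mg) ler_hdist0 mi.
rewrite -ler_sqr ?nnegrE ?normc_ge0 // -lerN2 -(lerD2l 1).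
rewrite act_normB ?disc_le1 // ler_pdivlMr ?exprn_gt0 ?den_gt0 ?disc_le1 //.
by rewrite ler_piMr ?expr_le1 ?den_ge0 // ltW // disc_sqr_lt1.
Qed.

(** The isometric disc of the inverse lies in the closure of the half-plane,
    points at infinity included; this makes the Schottky condition one on
    matrices. *)
Lemma half_plane_closure m g z : realizes m g -> normc z <= 1 ->
  den (su_inv m) z <= 1 -> closure_at_infinity (half_plane g) z.
Proof.
move=> mg z1 dz; apply/closure_normcP => e e0.
(* [g 0] lies in the half-plane, which is convex for straight segments *)
pose w := act m 0; have w1 : normc w < 1 by rewrite act_lt1 // normc0.
have dw : den (su_inv m) w <= 1.
  by rewrite den_inv ?normc0 // den0 invf_le1 ?su_a_gt0 // su_a_ge1.
pose t := Num.min (2^-1) (e / 4).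
have t0 : 0 < t by rewrite lt_min; apply/andP; split; lra.
have t1 : t <= 2^-1 by rewrite ge_min lexx.
have te : t <= e / 4 by rewrite ge_min lexx orbT.
pose y := (1 - t)%:C * z + t%:C * w.
have convex (f : R[i] -> R[i]) : f y = (1 - t)%:C * f z + t%:C * f w ->
    normc (f y) <= (1 - t) * normc (f z) + t * normc (f w).
  move=> ->; rewrite (le_trans (ler_normcD _ _)) // !normcM !normc_real.
  by rewrite !ger0_norm //; lra.
have y1 : normc y < 1.
  have := convex id erefl; have := normc_ge0 w; have := normc_ge0 z; nra.
have [x xE] := to_disc y1; exists y; last first.
  have -> : z - y = t%:C * (z - w) by rewrite /y rmorphB rmorph1; ring.
  rewrite normcM normc_real ger0_norm; last lra.
  by have := ler_normcB z w; have := normc_ge0 (z - w); nra.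
exists x => //; apply: half_planeP mg _; rewrite xE.
have := convex (su_den (su_inv m)); rewrite -![normc (su_den _ _)]/(den _ _).
move=> h; apply: le_trans (h _) _; last by nra.
by rewrite /su_den /y rmorphB rmorph1; ring.
Qed.

End HyperbolicDistance.

(** ** Isometric discs *)

Section Separation.
Variable R : realType.
Implicit Types (m n : su11 R) (z c : R[i]).

(** The pole of [m], around which its isometric disc [den m <= 1] is drawn. *)
Definition centre m : R[i] := - ((su_a m)^* / (su_b m)^*).

Lemma den_centre m z : su_b m != 0 ->
  den m z = normc (su_b m) * normc (z - centre m).
Proof.
move=> b0; have b0' : (su_b m)^* != 0 by rewrite conjc_eq0.
rewrite -[normc (su_b m)]normc_conj -normcM; congr normc.
by rewrite /su_den /centre; field.
Qed.

(** The isometric circle is orthogonal to the unit circle. *)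
Lemma centre_norm m : su_b m != 0 ->
  normc (centre m) ^+ 2 = 1 + (normc (su_b m))^-1 ^+ 2.
Proof.
move=> b0; rewrite normcN normcf_div !normc_conj expr_div_n su_detE.
have : normc (su_b m) != 0 by rewrite normc_eq0.
by move=> b0'; field.
Qed.

Lemma den_le1_centre m z : su_b m != 0 ->
  (den m z <= 1) = (normc (z - centre m) <= (normc (su_b m))^-1).
Proof.
move=> b0; rewrite den_centre // mulrC -ler_pdivlMr ?normc_gt0 //.
by rewrite div1r.
Qed.

(** A disc orthogonal to the unit circle is stable under inversion in it, so
    that two of them meet in the closed unit disc as soon as they meet. *)
Lemma orthogonal_disc_inversion c (r : R) z : 0 <= r ->
  normc c ^+ 2 = 1 + r ^+ 2 -> 1 <= normc z ->
  normc (z - c) <= r -> normc ((normc z ^- 2)%:C * z - c) <= r.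
Proof.
move=> r0 cE z1; rewrite -!(@ler_sqr _ (normc (_ - c)) r) ?nnegrE ?normc_ge0 //.
have z0 : 1 <= normc z ^+ 2 by rewrite expr_ge1 // normc_ge0.
rewrite sqr_normcE in cE.
set t := normc z ^- 2; have t0 : 0 <= t by rewrite invr_ge0 sqr_ge0.
have tz : t * normc z ^+ 2 = 1 by rewrite mulVf // gt_eqF //; lra.
clearbody t; rewrite !sqr_normcE in tz *.
case: c cE z {z1 z0} tz => c1 c2 /= cE [x y] /= tz h.
have -> : (t * x - 0 * y - c1) ^+ 2 + (t * y + 0 * x - c2) ^+ 2 =
  t * (t * (x ^+ 2 + y ^+ 2)) + (c1 ^+ 2 + c2 ^+ 2) -
  t * (2 * (x * c1 + y * c2)) by ring.
have h2 : 2 * (x * c1 + y * c2) >= x ^+ 2 + y ^+ 2 + 1 by lra.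
rewrite tz cE mulr1; have := ler_wpM2l t0 h2; rewrite mulrDr tz mulr1; lra.
Qed.

(** If the discs met, they would share a point of the segment between their
    centres; this point, or its inverse with respect to the unit circle, would
    be a common point in the closed unit disc. *)
Lemma isometric_discs_apart m n : su_b m != 0 -> su_b n != 0 ->
  (forall z, normc z <= 1 -> den m z <= 1 -> den n z <= 1 -> False) ->
  (normc (su_b m))^-1 + (normc (su_b n))^-1 < normc (centre m - centre n).
Proof.
move=> bm bn dis; rewrite ltNge; apply/negP => le.
set r1 := (normc (su_b m))^-1 in le *; set r2 := (normc (su_b n))^-1 in le *.
have r10 : 0 < r1 by rewrite invr_gt0 normc_gt0.
have r20 : 0 < r2 by rewrite invr_gt0 normc_gt0.
pose s := r1 / (r1 + r2); have s0 : 0 <= s by rewrite divr_ge0; lra.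
have s1 : s <= 1 by rewrite ler_pdivrMr; lra.
have s1E : (r1 + r2) * s = r1 by rewrite mulrC divfK // gt_eqF; lra.
pose z := (1 - s)%:C * centre m + s%:C * centre n.
have zm : normc (z - centre m) <= r1.
  have -> : z - centre m = s%:C * (centre n - centre m).
    by rewrite /z rmorphB rmorph1; ring.
  by rewrite normcM normc_real ger0_norm // normcB; nra.
have zn : normc (z - centre n) <= r2.
  have -> : z - centre n = (1 - s)%:C * (centre m - centre n).
    by rewrite /z rmorphB rmorph1; ring.
  rewrite normcM normc_real ger0_norm; last lra.
  by nra.
have [z1|z1] := leP (normc z) 1.
  by apply: (dis z) => //; rewrite den_le1_centre.
have z1' := ltW z1.
have z0 : 0 < normc z by lra.
apply: (dis ((normc z ^- 2)%:C * z)).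
- rewrite normcM normc_real ger0_norm ?invr_ge0 ?sqr_ge0 // mulrC.
  by rewrite ler_pdivrMr ?exprn_gt0 // mul1r expr2; nra.
- rewrite den_le1_centre //.
  by apply: orthogonal_disc_inversion; rewrite ?centre_norm // ltW.
- rewrite den_le1_centre //.
  by apply: orthogonal_disc_inversion; rewrite ?centre_norm // ltW.
Qed.

(** Disjoint closed discs are at a positive distance, and [den n] is
    proportional to the distance from the centre of the disc of [n]. *)
Lemma isometric_discs_gap m n : su_b m != 0 -> su_b n != 0 ->
  (forall z, normc z <= 1 -> den m z <= 1 -> den n z <= 1 -> False) ->
  exists2 mu : R, 1 < mu & forall z, den m z <= 1 -> mu <= den n z.
Proof.
move=> bm bn /(isometric_discs_apart bm bn) apart.
set r1 := (normc (su_b m))^-1 in apart; set r2 := (normc (su_b n))^-1 in apart.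
have b0 : 0 < normc (su_b n) by rewrite normc_gt0.
have br : normc (su_b n) * r2 = 1 by rewrite mulfV // gt_eqF.
exists (normc (su_b n) * (normc (centre m - centre n) - r1)).
  by rewrite -br ltr_pM2l //; lra.
move=> z; rewrite den_le1_centre // -/r1 => zm.
rewrite den_centre // ler_wpM2l ?(ltW b0) //.
have := ler_normc_dist (centre m) (centre n) z; rewrite [normc (_ - z)]normcB.
lra.
Qed.

End Separation.

(** * Parabolic matrices *)

Section Parabolic.
Variable R : realType.

(** Up to sign, a parabolic matrix has diagonal entries [1 +i* tau] and
    [1 -i* tau]. *)
Record parabolic_form := ParabolicForm {
  tau : R;
  pb : R[i];
  tau_neq0 : tau != 0;
  pb_norm : normc pb ^+ 2 = tau ^+ 2 }.

Variable q : parabolic_form.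
Implicit Types (z : R[i]) (n k : int).

Program Definition par n :=
  @SU11 R (1 +i* (n%:~R * tau q)) ((n%:~R)%:C * pb q) _.
Next Obligation.
move=> n; rewrite conjcM conjc_real.
rewrite mulrACA -[pb q * _]sqr_normcJ pb_norm; apply/eqP.
by rewrite eq_complex /=; apply/andP; split; apply/eqP; ring.
Qed.

(** The fixed point of the parabolic group sits at the origin of this
    coordinate, whose inverse maps the disc to a half-plane where [par n] is
    the translation by [n]. *)
Definition kap z : R[i] := (pb q)^* * z - (0 +i* tau q).

Definition pfix : R[i] := (0 +i* tau q) / (pb q)^*.

Lemma pb_neq0 : pb q != 0.
Proof.
rewrite -normc_eq0 -[_ == 0](@expf_eq0 _ _ 2) pb_norm expf_eq0 /=.
exact: tau_neq0.
Qed.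

Lemma normc_pb : normc (pb q) = `|tau q|.
Proof.
apply/eqP; rewrite -(@eqrXn2 _ 2) ?normc_ge0 //.
by rewrite pb_norm real_normK ?num_real.
Qed.

Lemma tau_gt0 : 0 < `|tau q|.
Proof. by rewrite normr_gt0 tau_neq0. Qed.

Lemma pfix_circle : normc pfix = 1.
Proof.
rewrite normcf_div normc_conj normc_pb /= expr0n /= add0r sqrtr_sqr.
by rewrite divff // gt_eqF // tau_gt0.
Qed.

Lemma kapE z : kap z = (pb q)^* * (z - pfix).
Proof.
rewrite /kap /pfix mulrBr; congr (_ - _).
by rewrite mulrC divfK // conjc_eq0 pb_neq0.
Qed.

Lemma normc_kap z : normc (kap z) = `|tau q| * normc (z - pfix).
Proof. by rewrite kapE normcM normc_conj normc_pb. Qed.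

Lemma normc_kap_le z : normc z <= 1 -> normc (kap z) <= 2 * `|tau q|.
Proof.
move=> z1; rewrite normc_kap mulrC ler_wpM2r //.
by have := ler_normcB z pfix; rewrite pfix_circle; lra.
Qed.

Lemma kap_pfix : kap pfix = 0.
Proof. by rewrite kapE subrr mulr0. Qed.

Lemma kap0 : kap 0 = - (0 +i* tau q).
Proof. by rewrite /kap mulr0 sub0r. Qed.

Lemma su_den_par n z : su_den (par n) z = 1 + (n%:~R)%:C * kap z.
Proof.
rewrite /su_den -[su_a _]/(1 +i* (n%:~R * tau q)).
rewrite -[su_b _]/((n%:~R)%:C * pb q) /kap.
move: (pb q) z => [b1 b2] [x y]; apply/eqP; rewrite eq_complex /=.
by apply/andP; split; apply/eqP; ring.
Qed.

Lemma su_den_par_neq0 n z : normc z <= 1 -> 1 + (n%:~R)%:C * kap z != 0.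
Proof. by move=> z1; rewrite -su_den_par su_den_neq0. Qed.

(** The growth in [n] is quadratic, so that [p ^ n] moves the origin by about
    [2 * ln |n|]; the exponent [1 / 2] comes from this factor [2]. *)
Lemma den_par_sqr n z : den (par n) z ^+ 2 =
  1 + 2 * n%:~R * complex.Re (kap z) + n%:~R ^+ 2 * normc (kap z) ^+ 2.
Proof.
rewrite /den su_den_par; rewrite !sqr_normcE.
by move: (kap z) => [x y] /=; ring.
Qed.

Lemma par0 : par 0 = su_one R.
Proof.
apply: su_ext => /=; last by rewrite mul0r.
by rewrite mul0r.
Qed.

Lemma par_add n k : su_mul (par n) (par k) = par (n + k).
Proof.
have bE : pb q * (pb q)^* = (tau q ^+ 2)%:C by rewrite -sqr_normcJ pb_norm.
apply: su_ext; rewrite [LHS]/=; last first.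
  rewrite -[su_b (par (n + k))]/(((n + k)%:~R)%:C * pb q) intrD.
  move: (pb q) => [b1 b2]; apply/eqP; rewrite eq_complex /=.
  by apply/andP; split; apply/eqP; ring.
rewrite conjcM conjc_real mulrACA bE -[su_a _]/(1 +i* ((n + k)%:~R * tau q)).
apply/eqP; rewrite eq_complex /= intrD.
by apply/andP; split; apply/eqP; ring.
Qed.

Lemma par_opp n : su_inv (par n) = par (- n).
Proof.
apply: su_ext; rewrite [LHS]/=.
  by rewrite /= rmorphN mulNr.
by rewrite -[su_b _]/(((- n)%:~R)%:C * pb q) !rmorphN mulNr.
Qed.

Lemma act_par_add n k z : normc z <= 1 ->
  act (par n) (act (par k) z) = act (par (n + k)) z.
Proof. by move=> z1; rewrite -act_mul // par_add. Qed.

Lemma act_par0 z : act (par 0) z = z.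
Proof. by rewrite par0 act_one. Qed.

Lemma kap_par n z : normc z <= 1 ->
  kap (act (par n) z) = kap z / (1 + (n%:~R)%:C * kap z).
Proof.
move=> z1; have := su_den_par_neq0 n z1; have := su_den_neq0 (par n) z1.
move=> d0 h; apply: (mulIf h); rewrite [in RHS]divfK //.
rewrite -su_den_par {1}/kap mulrBl -mulrA /act divfK // su_den_par.
rewrite -[su_a _]/(1 +i* (n%:~R * tau q)) -[su_b _]/((n%:~R)%:C * pb q).
have bE := pb_norm q; rewrite sqr_normcE in bE; rewrite /kap.
move: (pb q) bE z {z1 d0 h} => [b1 b2] /= bE [x y].
have b1E : b1 ^+ 2 = tau q ^+ 2 - b2 ^+ 2 by lra.
by apply/eqP; rewrite eq_complex /=; apply/andP; split; apply/eqP;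
  ring: b1E.
Qed.

Lemma act_par_pfix n : act (par n) pfix = pfix.
Proof.
have x1 : normc pfix <= 1 by rewrite pfix_circle.
have := kap_par n x1; rewrite kap_pfix mul0r kapE => /eqP.
rewrite mulf_eq0 conjc_eq0 (negbTE pb_neq0) /= subr_eq0 => /eqP //.
Qed.

Lemma normc_kap_par n z : normc z <= 1 ->
  normc (kap (act (par n) z)) = normc (kap z) / den (par n) z.
Proof. by move=> z1; rewrite kap_par // normcf_div -su_den_par. Qed.

Lemma Re_kap_par n z : normc z <= 1 ->
  complex.Re (kap (act (par n) z)) =
  (complex.Re (kap z) + n%:~R * normc (kap z) ^+ 2) / den (par n) z ^+ 2.
Proof.
move=> z1; have d0 := den_neq0 (par n) z1.
have d20 : den (par n) z ^+ 2 != 0 by rewrite expf_eq0.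
apply: (mulIf d20); rewrite divfK // kap_par //.
have d1 := su_den_par_neq0 n z1.
have e : kap z / (1 + (n%:~R)%:C * kap z) * (den (par n) z ^+ 2)%:C =
  kap z * (1 + (n%:~R)%:C * kap z)^*.
  by rewrite /den su_den_par sqr_normcJ mulrA divfK.
have := congr1 (@complex.Re R) e; rewrite sqr_normcE.
move: (_ / _) => [u v]; move: (kap z) => [x y] /=.
move: (den _ _ ^+ 2) => D; rewrite mulr0 subr0 => ->; ring.
Qed.

(** ** The vertical strip *)

(** [strip eta k0] is the part of [|Re (1 / kap)| <= 1/2 - eta] at a definite
    distance of the fixed point, and [outside eta] contains its translates. *)
Definition strip (eta k0 : R) z :=
  k0 <= normc (kap z) /\
  `|complex.Re (kap z)| <= (2^-1 - eta) * normc (kap z) ^+ 2.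

Definition outside (eta : R) z :=
  (2^-1 + eta) * normc (kap z) ^+ 2 <= `|complex.Re (kap z)|.

Lemma norm_int_ge1 n : n != 0 -> 1 <= `|n%:~R : R|.
Proof.
by move=> n0; rewrite -intr_norm -[1]/(1%:~R) ler_int -gtz0_ge1 normr_gt0.
Qed.

Variables eta k0 : R.
Hypothesis eta_gt0 : 0 < eta.
Hypothesis k0_gt0 : 0 < k0.

(** In the coordinate [1 / kap] the strip is translated by [n], away from
    itself. *)
Lemma par_strip n z : n != 0 -> normc z <= 1 -> strip eta k0 z ->
  outside eta (act (par n) z).
Proof.
move=> n0 z1 [_ zs]; rewrite /outside normc_kap_par // Re_kap_par //.
have d0 := den_gt0 (par n) z1.
rewrite expr_div_n normrM mulrA.
rewrite [`|_ ^- 2|]ger0_norm ?invr_ge0 ?sqr_ge0 //.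
rewrite ler_wpM2r ?invr_ge0 ?sqr_ge0 //.
have n1 := norm_int_ge1 n0.
have k2 : 0 <= normc (kap z) ^+ 2 := sqr_ge0 _.
rewrite [X in `|X|]addrC; apply: le_trans (lerB_normD _ _).
by rewrite normrM (ger0_norm k2); nra.
Qed.

Lemma den_par_strip_ge1 n z : normc z <= 1 -> strip eta k0 z ->
  1 <= den (par n) z.
Proof.
move=> z1 [_ zs]; have [->|n0] := eqVneq n 0; first by rewrite par0 den_one.
rewrite -(@ler_sqr R) ?nnegrE ?den_ge0 // expr1n den_par_sqr.
have n1 := norm_int_ge1 n0.
rewrite -[X in X * normc _ ^+ 2]real_normK ?num_real //.
have k2 : 0 <= normc (kap z) ^+ 2 := sqr_ge0 _.
have h : - (`|n%:~R| * `|complex.Re (kap z)|) <= n%:~R * complex.Re (kap z).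
  by rewrite -normrM; exact: lerNnormlW.
have h2 : `|n%:~R : R| * `|complex.Re (kap z)| <=
  `|n%:~R : R| * ((2^-1 - eta) * normc (kap z) ^+ 2) by rewrite ler_wpM2l.
rewrite -[2 * _ * _]mulrA.
move: (`|n%:~R|) (n%:~R * _) (normc (kap z) ^+ 2) n1 h h2 k2 => N M K n1 h h2 k2.
have a1 : 0 <= N * (N - 1) * K by rewrite !mulr_ge0 //; lra.
have a2 : 0 <= N * eta * K by rewrite !mulr_ge0 ?(ltW eta_gt0) //; lra.
by nra.
Qed.

(** In the coordinate [1 / kap] the quantity [den] is [|kap| * |1 / kap + n|],
    and the real part of [1 / kap] is at most [1 / 2] on the strip. *)
Lemma den_par_strip_ge n z : normc z <= 1 -> strip eta k0 z ->
  Num.min (k0 / 4) 1 * (1 + `|n%:~R|) <= den (par n) z.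
Proof.
move=> z1 zs; have d1 := den_par_strip_ge1 n z1 zs; case: zs => zk zs.
have [n0|n0] := eqVneq n 0.
  by rewrite n0 normr0 addr0 mulr1 ge_min par0 den_one lexx orbT.
have n1 := norm_int_ge1 n0.
have kpos : 0 < normc (kap z) := lt_le_trans k0_gt0 zk.
suff h : `|n%:~R| / 2 * normc (kap z) <= den (par n) z.
  apply: le_trans h; rewrite (@le_trans _ _ (k0 / 4 * (1 + `|n%:~R|))) //.
    by rewrite ler_wpM2r ?addr_ge0 // ge_min lexx.
  by nra.
rewrite -(ler_pM2l kpos) -(@ler_sqr R) ?nnegrE ?mulr_ge0 ?den_ge0 ?normc_ge0 //.
have e : (normc (kap z) * den (par n) z) ^+ 2 =
    (n%:~R * normc (kap z) ^+ 2 + complex.Re (kap z)) ^+ 2 +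
    complex.Im (kap z) ^+ 2.
  rewrite exprMn den_par_sqr; set N := normc _ ^+ 2.
  have -> : complex.Im (kap z) ^+ 2 = N - complex.Re (kap z) ^+ 2.
    by rewrite /N sqr_normcE; ring.
  ring.
rewrite e; apply: ler_wpDr; first exact: sqr_ge0.
rewrite -[leRHS]real_normK ?num_real // ler_sqr ?nnegrE ?mulr_ge0 ?normc_ge0 //.
apply: le_trans (lerB_normD _ _).
rewrite normrM (ger0_norm (sqr_ge0 (normc (kap z)))).
have -> : normc (kap z) * (`|n%:~R| / 2 * normc (kap z)) =
  `|n%:~R| / 2 * normc (kap z) ^+ 2 by ring.
have := sqr_ge0 (normc (kap z)).
move: (`|n%:~R|) (normc (kap z) ^+ 2) n1 zs => N K n1 zs K0.
have a1 : 0 <= (N - 1) * K by rewrite mulr_ge0 //; lra.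
have a2 : 0 <= eta * K by rewrite mulr_ge0 ?(ltW eta_gt0).
by lra.
Qed.

Lemma den_par_le n z : normc z <= 1 ->
  den (par n) z <= (1 + 2 * `|tau q|) * (1 + `|n%:~R|).
Proof.
move=> z1; rewrite /den su_den_par (le_trans (ler_normcD _ _)) //.
rewrite normc1 normcM normc_real; have := normc_kap_le z1.
have := normr_ge0 (n%:~R : R); have := normr_ge0 (tau q).
by move: (normc _) => K; nra.
Qed.

(** The strip of width 1 is a fundamental domain. *)
Lemma par_fundamental z : normc z <= 1 -> kap z != 0 ->
  exists n, ~ outside eta (act (par n) z).
Proof.
move=> z1 k; pose N := normc (kap z) ^+ 2.
have N0 : 0 < N by rewrite exprn_gt0 // normc_gt0.
pose V := complex.Re (kap z) / N.
pose n := - Num.floor (V + 2^-1); exists n => h.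
have n0 := den_gt0 (par n) z1.
move: h; rewrite /outside normc_kap_par // Re_kap_par //.
rewrite expr_div_n normrM mulrA.
rewrite [`|_ ^- 2|]ger0_norm ?invr_ge0 ?sqr_ge0 //.
rewrite ler_pM2r ?invr_gt0 ?exprn_gt0 // -/N.
have -> : complex.Re (kap z) + n%:~R * N = (V + n%:~R) * N.
  by rewrite mulrDl /V divfK // gt_eqF.
rewrite normrM (gtr0_norm N0) ler_pM2r //.
have := floor_itv (V + 2^-1); rewrite -/n rmorphD /= => /andP[f1 f2].
rewrite /n rmorphN /= => h.
have : `|V - (Num.floor (V + 2^-1))%:~R| <= 2^-1 by rewrite ler_norml; lra.
by move=> /(le_trans h); rewrite gerDl leNgt eta_gt0.
Qed.

End Parabolic.

(** * Ping-pong *)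

Section StripAndIsometricDiscs.
Variables (R : realType) (q : parabolic_form R).
Implicit Types (z : R[i]).

(** In the coordinate [1 / kap], a real part beyond [1 / 2] is brought closer
    to [0] by one of the two unit translations. *)
Lemma outside_den (et : R) z : 0 <= et -> outside q et z ->
  den (par q 1) z <= 1 \/ den (par q (-1)) z <= 1.
Proof.
move=> et0 oz; apply/orP.
have dle n : (den (par q n) z <= 1) = (den (par q n) z ^+ 2 <= 1).
  by rewrite expr_le1 ?den_ge0.
rewrite !dle !den_par_sqr mulrNz mulr1z expr1n sqrrN expr1n.
have K0 : 0 <= et * normc (kap q z) ^+ 2 by rewrite mulr_ge0 ?sqr_ge0.
move: oz K0; rewrite /outside ler_normr.
move: (normc _ ^+ 2) (complex.Re _) => K x oz K0.
by apply/orP; case/orP: oz => h; [right|left]; lra.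
Qed.

(** A point that neither unit translation brings closer to [0] has a small
    real part; the gap [mu] becomes a margin. *)
Lemma strip_den (mu et : R) z : 1 < mu -> 0 < et ->
  et * (4 * `|tau q| ^+ 2) <= (mu ^+ 2 - 1) / 2 ->
  normc z <= 1 -> mu <= den (par q 1) z -> mu <= den (par q (-1)) z ->
  strip q et (Num.min `|tau q| (mu - 1)) z.
Proof.
move=> mu1 et0 etle z1 d1 d2; split.
  rewrite ge_min; apply/orP; right; rewrite lerBlDr.
  apply: le_trans d1 _; rewrite /den su_den_par mulr1z mul1r addrC.
  by apply: le_trans (ler_normcD _ _) _; rewrite normc1.
have mu0 : 0 <= mu by lra.
have : mu ^+ 2 <= den (par q 1) z ^+ 2 by rewrite ler_sqr ?nnegrE ?den_ge0.
have : mu ^+ 2 <= den (par q (-1)) z ^+ 2 by rewrite ler_sqr ?nnegrE ?den_ge0.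
rewrite !den_par_sqr mulrNz mulr1z expr1n sqrrN expr1n.
have K2 : normc (kap q z) ^+ 2 <= 4 * `|tau q| ^+ 2.
  have -> : 4 * `|tau q| ^+ 2 = (2 * `|tau q|) ^+ 2 by rewrite exprMn; ring.
  by rewrite ler_sqr ?nnegrE ?normc_ge0 ?mulr_ge0 // normc_kap_le.
have etK : et * normc (kap q z) ^+ 2 <= (mu ^+ 2 - 1) / 2.
  by apply: le_trans etle; rewrite ler_wpM2l // ltW.
move: (normc _ ^+ 2) (complex.Re _) (mu ^+ 2) etK => K x M etK h1 h2.
by rewrite ler_norml; apply/andP; split; lra.
Qed.

End StripAndIsometricDiscs.

Section PingPong.
Variable R : realType.
Implicit Types (z : R[i]) (m : su11 R) (e : bool).

Definition signed m e := if e then m else su_inv m.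

Lemma su_invK m : su_inv (su_inv m) = m.
Proof. by apply: su_ext => /=; rewrite ?conjcK ?opprK. Qed.

Lemma signedN m e : signed m (~~ e) = su_inv (signed m e).
Proof. by case: e => //=; rewrite su_invK. Qed.

(** Quantitative ping-pong: [lam > 1] bounds from below the contraction of a
    hyperbolic letter at any point outside its repelling disc; the attracting
    discs lie strictly inside the fundamental strip of the parabolic group. *)
Record pingpong := PingPong {
  hy : su11 R;
  pq : parabolic_form R;
  lam : R; margin : R; k0 : R;
  lam_gt1 : 1 < lam;
  margin_gt0 : 0 < margin;
  k0_gt0 : 0 < k0;
  escape_0 : forall e, lam <= den (signed hy e) 0;
  outside_escape : forall e z, normc z <= 1 -> outside pq margin z ->
    lam <= den (signed hy e) z;
  attract_escape : forall e z, normc z <= 1 ->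
    den (signed hy (~~ e)) z <= lam^-1 -> lam <= den (signed hy e) z;
  attract_strip : forall e z, normc z <= 1 ->
    den (signed hy (~~ e)) z <= lam^-1 -> strip pq margin k0 z;
  strip_0 : strip pq margin k0 0 }.

Lemma signed_b_neq0 m e : su_b m != 0 -> su_b (signed m e) != 0.
Proof. by case: e => //=; rewrite oppr_eq0. Qed.

(** For a hyperbolic matrix the left-hand side exceeds [2], so that the matrix
    and its inverse cannot both expand at a point. *)
Lemma trace_den m z : normc z <= 1 ->
  2 * `|complex.Re (su_a m)| <= den m z + den (su_inv m) z.
Proof.
move=> z1; rewrite /den /su_den /= conjcK conjcN.
apply: le_trans (ler_normcD _ _).
have -> : (su_b m)^* * z + (su_a m)^* + (- (su_b m)^* * z + su_a m) =
   (2 * complex.Re (su_a m))%:C.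
  rewrite mulNr addrACA subrr add0r; case: (su_a m) => x y.
  by apply/eqP; rewrite eq_complex /= addNr eqxx andbT; apply/eqP; ring.
by rewrite normc_real normrM ger0_norm.
Qed.

(** Opposite matrices act alike, hence the trace may be taken to be [2]. *)
Lemma normal_form_parabolic m : complex.Re (su_a m) ^+ 2 = 1 ->
  su_b m != 0 -> exists q : parabolic_form R, forall z, act m z = act (par q 1) z.
Proof.
move=> t1 b0; pose s := complex.Re (su_a m).
have bE : normc (s%:C * su_b m) ^+ 2 = (s * complex.Im (su_a m)) ^+ 2.
  have := su_detE m; rewrite sqr_normcE t1 => h.
  rewrite normcM normc_real !exprMn real_normK ?num_real // /s t1 !mul1r.
  by lra.
have s0 : s != 0 by apply/eqP => s0; move: t1; rewrite -/s s0 expr0n /=; lra.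
have t0 : s * complex.Im (su_a m) != 0.
  rewrite -[_ == 0](@expf_eq0 _ _ 2) -bE expf_eq0 /= normc_eq0 mulf_neq0 //.
  by rewrite eq_complex /= eqxx andbT.
pose q := ParabolicForm t0 bE; exists q => z.
have aE : su_a (par q 1) = s%:C * su_a m.
  rewrite /= mul1r /s; case: (su_a m) t1 => x y /= t1.
  by apply/eqP; rewrite eq_complex /= !mul0r subr0 addr0 -expr2 t1 !eqxx.
have bE' : su_b (par q 1) = s%:C * su_b m.
  have := mul1r (s%:C * su_b m); rewrite -[1](mulr1z (1 : R[i])) => <- //.
rewrite /act /su_den aE bE' !conjcM conjc_real -!mulrA -!mulrDr.
have sC0 : s%:C != 0 by rewrite eq_complex /= eqxx andbT.
by rewrite -mulf_div divff // mul1r.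
Qed.

(** The Schottky condition makes the isometric discs of [h] and [h^-1]
    disjoint from those of [p] and [p^-1]. All constants come from the
    resulting gaps and from the trace of [h]. *)
Lemma schottky_pingpong (h p : disc R -> disc R) : schottky h p ->
  exists P, realizes (hy P) h /\ realizes (par (pq P) 1) p.
Proof.
move=> [hyph parp _ dis].
have [mh rh] : exists m, realizes m h.
  by case: hyph => iso _ _; exact: isometry_realized.
have [mp rp'] : exists m, realizes m p.
  by case: parp => iso _ _; exact: isometry_realized.
have trh := hyperbolic_tr2 hyph rh.
have bh : su_b mh != 0 by case: hyph => _ hx _; exact: isometry_b_neq0 rh hx.
have bp : su_b mp != 0 by case: parp => _ hx _; exact: isometry_b_neq0 rp' hx.
have [q mpE] := normal_form_parabolic (parabolic_tr2 parp rp') bp.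
have rp : realizes (par q 1) p by move=> x; rewrite rp' mpE.
have sep e (s : bool) z : normc z <= 1 -> den (signed mh e) z <= 1 ->
    den (signed (par q 1) s) z <= 1 -> False.
  move=> z1 dh dp.
  suff : set0 z by []. rewrite -dis; split.
    case: e dh => dh.
      apply: (closureS _ (half_plane_closure (realizes_inv rh) z1 _)).
        by apply: image_subset => x; right.
      by rewrite su_invK.
    apply: (closureS _ (half_plane_closure rh z1 dh)).
    by apply: image_subset => x; left.
  case: s dp => dp.
    apply: (closureS _ (half_plane_closure (realizes_inv rp) z1 _)).
      by apply: image_subset => x; right.
    by rewrite su_invK.
  apply: (closureS _ (half_plane_closure rp z1 dp)).
  by apply: image_subset => x; left.
have bq : su_b (par q 1) != 0.
  by rewrite /= mulr1z mul1r pb_neq0.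
have [mu mu1 muP] : exists2 mu : R, 1 < mu & forall e s z,
    (den (signed mh e) z <= 1 -> mu <= den (signed (par q 1) s) z) /\
    (den (signed (par q 1) s) z <= 1 -> mu <= den (signed mh e) z).
  have one e s : exists2 mu : R, 1 < mu & forall z,
    (den (signed mh e) z <= 1 -> mu <= den (signed (par q 1) s) z) /\
    (den (signed (par q 1) s) z <= 1 -> mu <= den (signed mh e) z).
    have be := signed_b_neq0 e bh; have bs := signed_b_neq0 s bq.
    have [m1 m11 m1P] := isometric_discs_gap be bs (@sep e s).
    have [m2 m21 m2P] := isometric_discs_gap bs be
      (fun z le1 a b => @sep e s z le1 b a).
    exists (Num.min m1 m2); first by rewrite lt_min m11.
    move=> z; split=> dz; first by rewrite ge_min m1P.
    by rewrite ge_min m2P ?orbT.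
  have /choice[m mP] : forall es : bool * bool, exists mu : R, 1 < mu /\
      forall z, (den (signed mh es.1) z <= 1 ->
        mu <= den (signed (par q 1) es.2) z) /\
      (den (signed (par q 1) es.2) z <= 1 -> mu <= den (signed mh es.1) z).
    by move=> [e s]; have [mu mu1 muP] := one e s; exists mu.
  pose mu := Num.min (Num.min (m (true, true)) (m (true, false)))
    (Num.min (m (false, true)) (m (false, false))).
  exists mu; first by rewrite !lt_min !(mP _).1.
  move=> e s z; have [_ /(_ z) /= [h1 h2]] := mP (e, s).
  have le : mu <= m (e, s).
    by rewrite /mu; case: e {h1 h2}; case: s; rewrite !ge_min lexx ?orbT.
  by split=> dz; apply: le_trans le _; [exact: h1|exact: h2].
pose al := `|complex.Re (su_a mh)|.
have al1 : 1 < al.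
  rewrite /al -(@ltr_sqr R) ?nnegrE // expr1n real_normK ?num_real //.
pose L := Num.min al mu.
have L1 : 1 < L by rewrite lt_min al1.
have L0 : 0 < L by lra.
have Lal : L <= al by rewrite ge_min lexx.
have Lmu : L <= mu by rewrite ge_min lexx orbT.
have Linv : L^-1 <= 1 by rewrite invf_le1 // ltW.
pose nu := mu ^+ 2 - 1.
have nu0 : 0 < nu by rewrite subr_gt0 exprn_egt1.
have t0 := tau_gt0 q; have t20 : 0 < `|tau q| ^+ 2 by rewrite exprn_gt0.
pose et := Num.min (2^-1) (nu / (8 * `|tau q| ^+ 2)).
have et0 : 0 < et by rewrite lt_min divr_gt0 ?mulr_gt0 // andbT; lra.
have et1 : et <= 2^-1 by rewrite ge_min lexx.
have et2 : et * (4 * `|tau q| ^+ 2) <= nu / 2.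
  have : et <= nu / (8 * `|tau q| ^+ 2) by rewrite ge_min lexx orbT.
  by rewrite ler_pdivlMr ?mulr_gt0 //; lra.
pose k := Num.min `|tau q| (mu - 1).
have kp : 0 < k by rewrite lt_min t0 subr_gt0.
have SF : signed (par q 1) false = par q (-1) by rewrite /signed par_opp.
have trd e z : normc z <= 1 ->
    2 * al <= den (signed mh e) z + den (signed mh (~~ e)) z.
  move=> z1; case: e; first exact: trace_den.
  by rewrite addrC; exact: trace_den.
have strp e z : normc z <= 1 -> den (signed mh (~~ e)) z <= L^-1 ->
    strip q et k z.
  move=> z1 dz; have dz1 := le_trans dz Linv.
  have d1 := (muP (~~ e) true z).1 dz1; have := (muP (~~ e) false z).1 dz1.
  by rewrite SF => d2; exact: (strip_den mu1 et0 et2 z1 d1 d2).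
have escO e z : normc z <= 1 -> outside q et z -> L <= den (signed mh e) z.
  move=> z1 /(outside_den (ltW et0))[] d; apply: le_trans Lmu _.
    exact: (muP e true z).2.
  by apply: (muP e false z).2; rewrite SF.
have esc0 e : L <= den (signed mh e) 0.
  rewrite den0; apply: le_trans Lal _; rewrite /al.
  by case: e => /=; rewrite ?normc_conj normc_Re.
have atE e z : normc z <= 1 -> den (signed mh (~~ e)) z <= L^-1 ->
    L <= den (signed mh e) z.
  move=> z1 dz; have := trd e z z1; have := le_trans dz Linv.
  by move: (den _ _) (den _ _) => d d' h1 h2; clear -h1 h2 Lal al1; lra.
have st0 : strip q et k 0.
  rewrite /strip kap0 normcN /= expr0n /= add0r sqrtr_sqr oppr0 normr0.
  split; first by rewrite ge_min lexx.
  by rewrite mulr_ge0 ?sqr_ge0 //; lra.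
by exists (PingPong L1 et0 kp esc0 escO atE strp st0).
Qed.

End PingPong.

(** * Words and codings *)

Section Coding.
Variables (R : realType) (P : pingpong R).
Implicit Types (z : R[i]) (e : bool).

Local Notation hh := (signed (hy P)).
Local Notation pp := (par (pq P)).
Local Notation lam := (lam P).

(** The point is off the repelling disc of the hyperbolic letter [e];
    [attract] says that it is in the attracting disc. *)
Definition escape e z := lam <= den (hh e) z.
Definition attract e z := den (hh (~~ e)) z <= lam^-1.

(** The letter [(n, e)] stands for [p ^ n * h] or [p ^ n * h^-1]. The power
    [n] may be zero, so that powers of [h] are words too. *)
Definition letter := (int * bool)%type.
Implicit Types (l : letter).

Definition block l : su11 R := su_mul (pp l.1) (hh l.2).
Definition weight l : R := 1 + `|l.1%:~R|.

Lemma lam_gt0 : 0 < lam.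
Proof. exact: lt_trans ltr01 (lam_gt1 P). Qed.

Lemma lamV_lt : lam^-1 < lam.
Proof.
by apply: (@lt_trans _ _ 1); rewrite ?lam_gt1 // invf_lt1 ?lam_gt1 ?lam_gt0.
Qed.

Lemma weight_ge1 l : 1 <= weight l.
Proof. by rewrite lerDl. Qed.

Lemma weight_gt0 l : 0 < weight l.
Proof. exact: lt_le_trans ltr01 (weight_ge1 l). Qed.

Definition den_low : R := Num.min (k0 P / 4) 1.
Definition den_up : R :=
  (1 + 2 * `|tau (pq P)|) * (2 * normc (su_a (hy P))).

Lemma den_low_gt0 : 0 < den_low.
Proof. by rewrite lt_min ltr01 andbT divr_gt0 ?k0_gt0. Qed.

Lemma den_up_gt0 : 0 < den_up.
Proof.
by rewrite !mulr_gt0 ?su_a_gt0 // addr_gt0 // mulr_gt0 // tau_gt0.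
Qed.

Lemma signed_a e : normc (su_a (hh e)) = normc (su_a (hy P)).
Proof. by case: e => //=; rewrite normc_conj. Qed.

Lemma signed_b e : normc (su_b (hh e)) = normc (su_b (hy P)).
Proof. by case: e => //=; rewrite normcN. Qed.

Lemma escape_act e z : normc z <= 1 -> escape e z -> attract e (act (hh e) z).
Proof.
move=> z1 ez; rewrite /attract signedN den_inv //.
by rewrite lef_pV2 ?posrE ?lam_gt0 ?den_gt0.
Qed.

Lemma attract_act e z : normc z <= 1 -> attract e z ->
  escape e (act (hh (~~ e)) z).
Proof.
move=> z1; rewrite /escape /attract => ez.
have -> : hh e = su_inv (hh (~~ e)) by rewrite -signedN negbK.
rewrite den_inv //; by rewrite -[lam]invrK lef_pV2 ?posrE ?invr_gt0 ?lam_gt0 ?den_gt0.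
Qed.

Lemma escape_strip e z : normc z <= 1 -> escape e z ->
  strip (pq P) (margin P) (k0 P) (act (hh e) z).
Proof.
by move=> z1 ez; apply: (attract_strip (e := e)); [exact: act_le1|exact: escape_act].
Qed.

Lemma act_block l z : normc z <= 1 ->
  act (block l) z = act (pp l.1) (act (hh l.2) z).
Proof. exact: act_mul. Qed.

Lemma den_block l z : normc z <= 1 ->
  den (block l) z = den (pp l.1) (act (hh l.2) z) * den (hh l.2) z.
Proof. exact: den_mul. Qed.

(** This bound holds for every letter and gives the exponential contraction of
    words; the next one is better for large powers but may be below [1]. *)
Lemma block_den_ge_lam l z : normc z <= 1 -> escape l.2 z ->
  lam <= den (block l) z.
Proof.
move=> z1 ez; rewrite den_block //.
apply: (le_trans ez); rewrite ler_peMl ?den_ge0 //.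
by apply: den_par_strip_ge1 (escape_strip z1 ez); rewrite ?margin_gt0 ?act_le1.
Qed.

Lemma block_den_ge l z : normc z <= 1 -> escape l.2 z ->
  den_low * weight l <= den (block l) z.
Proof.
move=> z1 ez; rewrite den_block //.
have d : den_low * weight l <= den (pp l.1) (act (hh l.2) z).
  by apply: den_par_strip_ge (escape_strip z1 ez);
    rewrite ?margin_gt0 ?k0_gt0 ?act_le1.
apply: le_trans d _; rewrite ler_peMr ?den_ge0 //.
by apply: le_trans ez; rewrite ltW // lam_gt1.
Qed.

Lemma block_den_le l z : normc z <= 1 -> den (block l) z <= den_up * weight l.
Proof.
move=> z1; rewrite den_block // /den_up mulrAC.
rewrite ler_pM ?den_ge0 //; first by apply: den_par_le; exact: act_le1.
by rewrite -(signed_a l.2) den_le.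
Qed.

Lemma block_outside l z : normc z <= 1 -> escape l.2 z -> l.1 != 0 ->
  outside (pq P) (margin P) (act (block l) z).
Proof.
move=> z1 ez n0; rewrite act_block //.
by apply: par_strip (escape_strip z1 ez); rewrite ?act_le1.
Qed.

Lemma block_escape l e z : normc z <= 1 -> escape l.2 z -> l.1 != 0 ->
  escape e (act (block l) z).
Proof.
move=> z1 ez n0; apply: outside_escape; first exact: act_le1.
exact: block_outside.
Qed.

(** A lower bound for the distance between a tail and the preimage of the
    origin. *)
Definition code_gap : R :=
  Num.min 1 ((lam - lam^-1) / normc (su_a (hy P))).

Lemma code_gap_gt0 : 0 < code_gap.
Proof. by rewrite lt_min ltr01 divr_gt0 ?su_a_gt0 // subr_gt0 lamV_lt. Qed.

(** A coding of [x 0] by letters: the point [x i] is the tail that remains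
    after the first [i] letters have been removed, and each tail avoids the
    repelling disc of the letter before it. *)
Record coding (ls : nat -> letter) (x : nat -> R[i]) : Prop := Coding {
  coding_circle : forall i, normc (x i) = 1;
  coding_step : forall i, x i = act (block (ls i)) (x i.+1);
  coding_escape : forall i, escape (ls i).2 (x i.+1) }.

Fixpoint prefix (ls : nat -> letter) k : su11 R :=
  if k is k'.+1 then su_mul (prefix ls k') (block (ls k')) else su_one R.

Lemma eq_prefix ls ls' k : (forall i, (i < k)%N -> ls i = ls' i) ->
  prefix ls k = prefix ls' k.
Proof.
elim: k => //= k IH h; rewrite IH ?h // => i ik; exact/h/ltnW.
Qed.

Section FixedCoding.
Variables (ls : nat -> letter) (x : nat -> R[i]).
Hypothesis cod : coding ls x.

Lemma coding_le1 i : normc (x i) <= 1.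
Proof. by rewrite (coding_circle cod). Qed.

Lemma act_prefix k : act (prefix ls k) (x k) = x 0%N.
Proof.
elim: k => [|k IH] /=; first by rewrite act_one.
by rewrite act_mul ?coding_le1 // -(coding_step cod).
Qed.

Lemma den_prefixS k : den (prefix ls k.+1) (x k.+1) =
  den (prefix ls k) (x k) * den (block (ls k)) (x k.+1).
Proof. by rewrite /= den_mul ?coding_le1 // -(coding_step cod). Qed.

Lemma den_prefix k :
  den (prefix ls k) (x k) = \prod_(i < k) den (block (ls i)) (x i.+1).
Proof.
elim: k => [|k IH]; first by rewrite big_ord0 den_one.
by rewrite den_prefixS big_ord_recr IH.
Qed.

Lemma den_prefix_ge k :
  den_low ^+ k * \prod_(i < k) weight (ls i) <= den (prefix ls k) (x k).
Proof.
rewrite den_prefix -{1}(card_ord k) -prodr_const -big_split /=.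
apply: ler_prod => i _; rewrite mulr_ge0 ?(ltW den_low_gt0) ?(ltW (weight_gt0 _)) //.
by rewrite block_den_ge ?coding_le1 //; exact: (coding_escape cod).
Qed.

(** The preimage of the origin ends with the inverse of the last letter, hence
    lies in the disc which the tail avoids. *)
Lemma preimage0_attract k :
  attract (~~ (ls k).2) (act (su_inv (prefix ls k.+1)) 0).
Proof.
have inv_block l z : normc z <= 1 ->
    act (su_inv (block l)) z = act (hh (~~ l.2)) (act (pp (- l.1)) z).
  by move=> z1; rewrite -par_opp signedN -act_mul // -su_inv_mul.
have inv_prefix i z : normc z <= 1 -> act (su_inv (prefix ls i.+1)) z =
    act (su_inv (block (ls i))) (act (su_inv (prefix ls i)) z).
  by move=> z1; rewrite -act_mul // -su_inv_mul.
have zero1 : normc (0 : R[i]) <= 1 by rewrite normc0.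
have in1 i : normc (act (su_inv (prefix ls i)) 0) <= 1 by exact: act_le1.
have far i z : normc z <= 1 -> strip (pq P) (margin P) (k0 P) z ->
    (ls i).1 != 0 -> escape (~~ (ls i).2) (act (pp (- (ls i).1)) z).
  move=> z1 zs n0; apply: outside_escape; first exact: act_le1.
  by apply: par_strip zs; rewrite ?oppr_eq0.
elim: k => [|k IH]; rewrite inv_prefix // inv_block //.
  apply: escape_act; first by apply: act_le1; exact: act_le1.
  have -> : act (su_inv (prefix ls 0)) 0 = 0.
    by rewrite act_inv0 /= mul0r oppr0.
  have [n0|n0] := eqVneq (ls 0%N).1 0.
    by rewrite n0 oppr0 act_par0; exact: escape_0.
  by apply: far => //; exact: strip_0.
apply: escape_act; first by apply: act_le1; exact: act_le1.
have [n0|n0] := eqVneq (ls k.+1).1 0; last first.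
  by apply: far => //; apply: attract_strip IH.
rewrite n0 oppr0 act_par0.
have same : (ls k.+1).2 = (ls k).2.
  (* otherwise the tail would lie both in an attracting disc and off it *)
  have := coding_escape cod k; rewrite (coding_step cod k.+1) act_block ?coding_le1 //.
  rewrite n0 act_par0 => esc.
  have := escape_act (coding_le1 k.+2) (coding_escape cod k.+1).
  move: esc; rewrite /escape /attract; case: (ls k.+1).2 (ls k).2 => [] [] //=.
    by move=> /le_trans h /h; rewrite leNgt lamV_lt.
  by move=> /le_trans h /h; rewrite leNgt lamV_lt.
rewrite same; exact: attract_escape IH.
Qed.

Lemma coding_preimage0_dist k :
  code_gap <= normc (x k - act (su_inv (prefix ls k)) 0).
Proof.
case: k => [|k].
  rewrite act_inv0 /= mul0r oppr0 subr0 (coding_circle cod).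
  by rewrite ge_min lexx.
set u := act _ 0.
have du : den (hh (ls k).2) u <= lam^-1.
  by have := preimage0_attract k; rewrite /attract negbK.
have dx := coding_escape cod k.
rewrite ge_min; apply/orP; right; rewrite ler_pdivrMr ?su_a_gt0 //.
apply: le_trans (lerB dx du) _.
apply: le_trans (lerB_normc _ _) _; rewrite /su_den.
have -> : (su_b (hh (ls k).2))^* * x k.+1 + (su_a (hh (ls k).2))^* -
    ((su_b (hh (ls k).2))^* * u + (su_a (hh (ls k).2))^*) =
    (x k.+1 - u) * (su_b (hh (ls k).2))^* by ring.
by rewrite normcM normc_conj signed_b ler_wpM2l ?normc_ge0 // ltW // su_b_lt_a.
Qed.

(** As the tail avoids the preimage of the origin, the prefix contracts there
    as much as anywhere, up to a constant. *)
Lemma den_prefix_su_a k :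
  normc (su_a (prefix ls k)) * code_gap <= den (prefix ls k) (x k).
Proof.
apply: den_ge_preimage0; [exact: coding_le1|exact: coding_preimage0_dist].
Qed.

End FixedCoding.

End Coding.

(** * The orbit of the origin and the limit set *)

Section OrbitAndLimitSet.
Variables (R : realType) (P : pingpong R) (h p : disc R -> disc R).
Hypothesis real_h : realizes (hy P) h.
Hypothesis real_p : realizes (par (pq P) 1) p.
Implicit Types (z y : R[i]) (e : bool).

Local Notation hh := (signed (hy P)).
Local Notation pp := (par (pq P)).
Local Notation G := (generated [set h; p]).

(** ** Reduced words *)

(** The first letter of a reduced word, where a power of the parabolic
    generator counts as one letter. *)
Inductive initial := Empty | Power | Sign of bool.

Inductive orb : initial -> R[i] -> Prop :=
| orb_0 : orb Empty 0
| orb_p n i y : n != 0 -> orb i y -> i <> Power -> orb Power (act (pp n) y)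
| orb_h e i y : orb i y -> i <> Sign (~~ e) -> orb (Sign e) (act (hh e) y).

Lemma orb_lt1 i y : orb i y -> normc y < 1.
Proof.
by elim=> [|n j z _ _ z1 _|e j z _ z1 _]; rewrite ?normc0 // act_lt1.
Qed.

(** Ping-pong: a reduced word sends the origin to the region of its first
    letter. *)
Lemma orb_region i y : orb i y ->
  match i with
  | Empty => y = 0
  | Power => outside (pq P) (margin P) y
  | Sign e => attract P e y
  end.
Proof.
elim=> // [n j z n0 oz IH jP|e j z oz IH je].
  have z1 := ltW (orb_lt1 oz).
  suff zs : strip (pq P) (margin P) (k0 P) z by apply: par_strip zs.
  case: j oz IH jP => [oz ->|//|s oz az] _; first exact: strip_0.
  exact: attract_strip az.
have z1 := ltW (orb_lt1 oz); apply: escape_act => //.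
case: j oz IH je => [oz ->|oz oz' _|s oz az se]; first by rewrite /escape escape_0.
  exact: outside_escape.
have -> : e = s by case: e s se {oz az} => [] [].
exact: attract_escape.
Qed.

Lemma orb_strip i y : orb i y -> i <> Power ->
  strip (pq P) (margin P) (k0 P) y.
Proof.
move=> oy; have y1 := ltW (orb_lt1 oy); move/orb_region: (oy).
case: i oy => [_ -> _|//|e _ ay _]; first exact: strip_0.
exact: attract_strip ay.
Qed.

(** A power of the parabolic generator either becomes the first letter or
    merges with it. *)
Lemma orb_par n i y : orb i y -> exists j, orb j (act (pp n) y).
Proof.
move=> oy; have [->|n0] := eqVneq n 0; first by exists i; rewrite act_par0.
have [|nP] := pselect (i = Power); last by exists Power; exact: orb_p oy nP.
case: _ / oy => // k j z k0 oz jP _; have z1 := ltW (orb_lt1 oz).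
rewrite act_par_add //; have [->|nk] := eqVneq (n + k) 0.
  by exists j; rewrite act_par0.
by exists Power; exact: orb_p oz jP.
Qed.

Lemma orb_hy e i y : orb i y -> exists j, orb j (act (hh e) y).
Proof.
move=> oy; have [|ne] := pselect (i = Sign (~~ e)); last first.
  by exists (Sign e); exact: orb_h oy ne.
case: _ / oy => // s j z oz je [] se; have z1 := ltW (orb_lt1 oz).
by exists j; rewrite se signedN act_Kinv.
Qed.

Definition preserves_orb m := forall i y, orb i y -> exists j, orb j (act m y).

(** ** The group *)

Definition in_group m := exists2 g, G g & realizes m g.

Lemma in_group_one : in_group (su_one R).
Proof. by exists id; [exact: generated_id|exact: realizes_id]. Qed.

Lemma in_group_inv m : in_group m -> in_group (su_inv m).
Proof.
move=> [g Gg mg]; exists (disc_inv g); first exact: generated_inv.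
exact: realizes_inv.
Qed.

Lemma in_group_mul m n : in_group m -> in_group n -> in_group (su_mul m n).
Proof.
move=> [f Gf mf] [g Gg ng]; exists (f \o g); first exact: generated_comp.
exact: realizes_comp.
Qed.

Lemma in_group_hy e : in_group (hh e).
Proof.
have H : in_group (hy P) by exists h => //; apply: generated_mem; left.
by case: e => //; exact: in_group_inv.
Qed.

Lemma in_group_par n : in_group (pp n).
Proof.
have H1 : in_group (pp 1) by exists p => //; apply: generated_mem; right.
have Hn (k : nat) : in_group (pp k%:Z).
  elim: k => [|k IH]; first by rewrite par0; exact: in_group_one.
  by rewrite -addn1 PoszD -par_add; exact: in_group_mul.
case: n => k; first exact: (Hn k).
by rewrite NegzE -par_opp; exact: in_group_inv.
Qed.

Lemma in_group_prefix ls k : in_group (prefix P ls k).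
Proof.
elim: k => [|k IH] /=; first exact: in_group_one.
apply: in_group_mul => //.
by apply: in_group_mul; [exact: in_group_par|exact: in_group_hy].
Qed.

(** The inverse is carried along so that the induction passes the inverses of
    the group. *)
Lemma generated_matrix g : G g ->
  exists m, [/\ realizes m g, preserves_orb m & preserves_orb (su_inv m)].
Proof.
elim=> [|f [->|->]|f _ [m [mf m1 m2]]|f1 f2 _ [m [mf m1 m2]] _ [n [nf n1 n2]]].
- exists (su_one R); split; first exact: realizes_id.
    by move=> i y; exists i; rewrite act_one.
  move=> i y oy; exists i.
  by have := act_invK (su_one R) (ltW (orb_lt1 oy)); rewrite act_one => ->.
- exists (hy P); split => //; first exact: (@orb_hy true).
  exact: (@orb_hy false).
- exists (pp 1); split => //; first exact: orb_par.
  by rewrite par_opp; exact: orb_par.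
- by exists (su_inv m); split; rewrite ?su_invK //; exact: realizes_inv.
- exists (su_mul m n); split; first exact: realizes_comp.
    move=> i y oy; rewrite act_mul ?(ltW (orb_lt1 oy)) //.
    by have [j /m1] := n1 _ _ oy.
  move=> i y oy; rewrite su_inv_mul act_mul ?(ltW (orb_lt1 oy)) //.
  by have [j /n2] := m2 _ _ oy.
Qed.

Lemma orbit_orb y : (exists2 g, G g & \val (g (disc0 R)) = y) ->
  exists i, orb i y.
Proof.
move=> [g /generated_matrix[m [mg m1 _]] <-]; rewrite mg val_disc0.
exact: (m1 _ _ orb_0).
Qed.

Lemma in_group_orb m : in_group m -> exists i, orb i (act m 0).
Proof.
by move=> [g Gg mg]; apply: orbit_orb; exists g.
Qed.

Definition height_bound : R := (`|tau (pq P)| / k0 P) ^+ 2.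

(** No orbit point enters the horoball [1 - |y| ^ 2 > H * |y - pfix| ^ 2]:
    reduced words that start with a hyperbolic letter stay away from the fixed
    point, and the parabolic group preserves horoballs. *)
Lemma orb_height i y : orb i y ->
  1 - normc y ^+ 2 <= height_bound * normc (y - pfix (pq P)) ^+ 2.
Proof.
have low j z : orb j z -> j <> Power ->
    1 - normc z ^+ 2 <= height_bound * normc (z - pfix (pq P)) ^+ 2.
  move=> oz jP; have [zk _] := orb_strip oz jP.
  rewrite /height_bound -exprMn mulrAC -normc_kap.
  apply: (@le_trans _ _ 1); first by rewrite gerBl sqr_ge0.
  by apply: exprn_ege1; rewrite ler_pdivlMr ?mul1r ?k0_gt0.
move=> oy; have [iP|] := pselect (i = Power); last exact: low.
case: _ / oy iP => // n j z n0 oz jP _.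
have z1 := ltW (orb_lt1 oz).
have x1 : normc (pfix (pq P)) <= 1 by rewrite pfix_circle.
have d1 : den (pp n) (pfix (pq P)) = 1.
  by rewrite /den su_den_par kap_pfix mulr0 addr0 normc1.
rewrite act_normB // -[in X in _ <= X](act_par_pfix (pq P) n) act_dist // d1 mulr1.
rewrite expr_div_n mulrA ler_wpM2r ?invr_ge0 ?sqr_ge0 //.
exact: low oz jP.
Qed.

(** ** The limit set *)

Lemma closure_seq (A : set R[i]) z : closure A z ->
  exists2 u : nat -> R[i], (forall n, A (u n)) & u n @[n --> \oo] --> z.
Proof.
move=> /closure_normcP cl.
have {}cl (n : nat) : exists w, A w /\ normc (z - w) < harmonic n.
  by have [|w Aw zw] := cl (harmonic n); [exact: harmonic_gt0|exists w].
have [u uP] := choice cl; exists u; first by move=> n; exact: (uP n).1.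
apply/cvg_normcP => eps eps0.
have /cvgrPdist_lt/(_ _ eps0) := @cvg_harmonic R.
apply: filterS => n; rewrite sub0r normrN ger0_norm ?harmonic_ge0 //.
by apply: lt_trans; exact: (uP n).2.
Qed.

Lemma cvg_den m z (u : nat -> R[i]) : u n @[n --> \oo] --> z ->
  den m (u n) @[n --> \oo] --> den m z.
Proof.
move=> /cvg_normcP uz; apply: cvg_normc; apply/cvg_normcP => eps eps0.
have a0 := su_a_gt0 m.
have := uz (eps / normc (su_a m)) (divr_gt0 eps0 a0).
apply: filterS => n; rewrite ltr_pdivlMr // => le.
have -> : su_den m z - su_den m (u n) = (z - u n) * (su_b m)^*.
  by rewrite /su_den; ring.
rewrite normcM normc_conj; apply: le_lt_trans le.
by rewrite ler_wpM2l ?normc_ge0 // ltW // su_b_lt_a.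
Qed.

Definition limit z := closure_at_infinity (Defs.orbit G (disc0 R)) z.

(** The regions are closed and contain the whole orbit but the origin, which
    is not near the circle. *)
Lemma limit_region z : normc z = 1 -> limit z ->
  outside (pq P) (margin P) z \/ exists e, attract P e z.
Proof.
move=> z1 /closure_seq[u uA uz].
have uorb n : exists i, orb i (u n).
  by apply: orbit_orb; have [x [g Gg <-] <-] := uA n; exists g.
apply: contrapT => /not_orP[no na].
have ku : kap (pq P) (u n) @[n --> \oo] --> kap (pq P) z.
  apply/cvg_normcP => eps eps0; have /cvg_normcP uz' := uz.
  have t0 := tau_gt0 (pq P).
  have := uz' (eps / `|tau (pq P)|) (divr_gt0 eps0 t0).
  apply: filterS => n; rewrite ltr_pdivlMr // => le.
  have -> : kap (pq P) z - kap (pq P) (u n) = (z - u n) * (pb (pq P))^*.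
    by rewrite /kap; ring.
  by rewrite normcM normc_conj normc_pb.
have Reu : complex.Re (kap (pq P) (u n)) @[n --> \oo] -->
    complex.Re (kap (pq P) z).
  apply/cvgrPdist_lt => eps eps0; have /cvg_normcP/(_ _ eps0) := ku.
  apply: filterS => n; apply: le_lt_trans.
  by rewrite -raddfB; exact: normc_Re.
have c1 : \forall n \near \oo, ~ outside (pq P) (margin P) (u n).
  pose F w := (2^-1 + margin P) * normc (kap (pq P) w) ^+ 2 -
     `|complex.Re (kap (pq P) w)|.
  have Fu : F (u n) @[n --> \oo] --> F z.
    apply: cvgB; last exact: cvg_norm.
    apply: cvgM; first exact: cvg_cst.
    rewrite expr2; under eq_cvg do rewrite expr2.
    by apply: cvgM; exact: cvg_normc.
  have F0 : 0 < F z by rewrite subr_gt0 ltNge; apply/negP.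
  have : \forall n \near \oo, 0 < F (u n) by exact: (cvgr_gt _ Fu).
  by apply: filterS => n; rewrite subr_gt0 ltNge => /negP.
have c2 e : \forall n \near \oo, ~ attract P e (u n).
  have F0 : (lam P)^-1 < den (hh (~~ e)) z.
    by rewrite ltNge; apply/negP => ae; apply: na; exists e.
  have : \forall n \near \oo, (lam P)^-1 < den (hh (~~ e)) (u n).
    by apply: (cvgr_gt (den (hh (~~ e)) z)) => //; exact: cvg_den.
  by apply: filterS => n; rewrite ltNge => /negP.
have c3 : \forall n \near \oo, 0 < normc (u n).
  by apply: (cvgr_gt (normc z)); [exact: cvg_normc|rewrite z1].
have : \forall n \near \oo, False.
  near=> n; have [i ui] := uorb n.
  have : ~ outside (pq P) (margin P) (u n) by near: n.
  have : ~ attract P true (u n) by near: n; exact: c2.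
  have : ~ attract P false (u n) by near: n; exact: c2.
  have : 0 < normc (u n) by near: n.
  have := orb_region ui; case: i {ui} => [->|//|[]//].
  by rewrite normc0 ltxx.
by case/filter_ex.
Unshelve. all: by end_near. Qed.

Lemma limit_act m z : in_group m -> normc z <= 1 -> limit z ->
  limit (act m z).
Proof.
move=> [g Gg mg] z1 /closure_seq[u uA uz].
have u1 n : normc (u n) <= 1 by have [x _ <-] := uA n; exact: disc_le1.
have /cvg_normcP h1 : act m (u n) @[n --> \oo] --> act m z.
  exact: act_continuous.
apply/closure_normcP => eps /h1/filter_ex[n zn]; exists (act m (u n)) => //.
have [x [f Gf fx] xu] := uA n; exists (g x); last by rewrite mg xu.
by exists (g \o f); [exact: generated_comp|rewrite /= fx].
Qed.

(** The parabolic group brings the point back to the strip, where only the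
    region of a hyperbolic letter can contain it; the inverses of both are the
    first letter. *)
Lemma limit_letter z : normc z = 1 -> limit z -> z != pfix (pq P) ->
  exists lz : letter * R[i], [/\ normc lz.2 = 1, limit lz.2,
    escape P lz.1.2 lz.2 & z = act (block P lz.1) lz.2].
Proof.
move=> z1 lz zp; have z1' : normc z <= 1 by rewrite z1.
have kz : kap (pq P) z != 0.
  by rewrite kapE mulf_neq0 ?subr_eq0 // conjc_eq0 pb_neq0.
have [n nz] := par_fundamental (margin_gt0 P) z1' kz.
set y := act (pp n) z in nz.
have y1 : normc y = 1 by exact: act_circle.
have y1' : normc y <= 1 by rewrite y1.
have ly : limit y by apply: limit_act lz => //; exact: in_group_par.
have [//|[e ey]] := limit_region y1 ly.
exists ((- n, e), act (hh (~~ e)) y); split => /=.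
- exact: act_circle.
- by apply: limit_act => //; exact: in_group_hy.
- exact: attract_act.
rewrite act_block; last exact: act_le1.
rewrite /= signedN act_Kinv // /y act_par_add //.
by rewrite addNr act_par0.
Qed.

(** Letters are extracted for ever, unless a tail is the parabolic fixed
    point. *)
Lemma limit_coding z : normc z = 1 -> limit z ->
  (exists ls k, z = act (prefix P ls k) (pfix (pq P))) \/
  (exists ls x, coding P ls x /\ x 0%N = z).
Proof.
move=> z1 lz.
have /choice[f fP] : forall y, exists ly : letter * R[i],
    normc y = 1 -> limit y -> y != pfix (pq P) ->
    [/\ normc ly.2 = 1, limit ly.2, escape P ly.1.2 ly.2 &
      y = act (block P ly.1) ly.2].
  move=> y.
  have [[y1 [ly yp]]|no] := pselect (normc y = 1 /\ limit y /\ y != pfix (pq P)).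
    by have [ly' H] := limit_letter y1 ly yp; exists ly'.
  by exists ((0, true), 0) => y1 ly yp; exfalso; apply: no.
pose x i := iter i (fun y => (f y).2) z.
pose ls i := (f (x i)).1.
have xP k : (forall i, (i < k)%N -> x i != pfix (pq P)) ->
    [/\ normc (x k) = 1, limit (x k) & act (prefix P ls k) (x k) = z].
  elim: k => [|k IH] nf; first by split; rewrite //= act_one.
  have [i ik|x1 lx xz] := IH; first by apply: nf; exact: ltnW.
  have [a b c d] := fP _ x1 lx (nf k (ltnSn k)).
  split => //; rewrite /= act_mul ?a //.
  by rewrite /= -/(x k) /ls -d.
have [[k kf]|nf] := pselect (exists k, x k == pfix (pq P)).
  left; have E : exists k, x k == pfix (pq P) by exists k.
  case: (ex_minnP E) => i /eqP xi imin; exists ls, i; rewrite -xi.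
  by have [|_ _ //] := xP i => j ji; apply: contraL ji => /imin; rewrite leqNgt.
have nf' i : x i != pfix (pq P) by apply/negP => xi; apply: nf; exists i.
right; exists ls, x; split => //; split => i.
- by have [] := xP i (fun j _ => nf' j).
- have [x1 lx _] := xP i (fun j _ => nf' j).
  by have [_ _ _ ->] := fP _ x1 lx (nf' i).
- have [x1 lx _] := xP i (fun j _ => nf' j).
  by have [_ _ ? _] := fP _ x1 lx (nf' i).
Qed.

End OrbitAndLimitSet.

(** * Geodesics and the visual distance *)

Section Geodesics.
Variable R : realType.
Implicit Types (x y : disc R) (xi zeta : circle R) (z : R[i]).

(** The part of the distance that depends on both points. It extends
    continuously to the circle, which gives the Busemann functions. *)
Definition hsum (z w : R[i]) := normc (1 - z^* * w) + normc (z - w).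

Lemma hdist_hsum x y : hdist x y = 2 * ln (hsum (\val x) (\val y))
  - ln (1 - normc (\val x) ^+ 2) - ln (1 - normc (\val y) ^+ 2).
Proof. exact: hdist_logE. Qed.

Lemma hsum_circle z xi : hsum z (\val xi) = 2 * normc (z - \val xi).
Proof. by rewrite /hsum normc_dist_circle ?circle_eq1 //; ring. Qed.

Lemma dist_circle_gt0 x xi : 0 < normc (\val x - \val xi).
Proof.
rewrite normc_gt0 subr_eq0; apply/eqP => e.
by have := disc_lt1 x; rewrite e circle_eq1 ltxx.
Qed.

Lemma cvg_hsum (T : Type) (F : set_system T) (FF : Filter F) (u : T -> R[i]) z w :
  u t @[t --> F] --> w -> hsum z (u t) @[t --> F] --> hsum z w.
Proof.
move=> /cvg_normcP uw; apply: cvgD; apply: cvg_normc; apply/cvg_normcP => e e0.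
  have d0 : 0 < e / (1 + normc z).
    by rewrite divr_gt0 // ltr_pwDl // normc_ge0.
  have := uw _ d0; apply: filterS => t.
  rewrite ltr_pdivlMr ?ltr_pwDl ?normc_ge0 // => le.
  have -> : 1 - z^* * w - (1 - z^* * u t) = - ((w - u t) * z^*) by ring.
  rewrite normcN normcM normc_conj; apply: le_lt_trans le.
  by rewrite ler_wpM2l ?normc_ge0 // lerDr.
have := uw _ e0; apply: filterS => t.
have -> : z - w - (z - u t) = - (w - u t) by ring.
by rewrite normcN.
Qed.

Lemma cvg_ln_pos (T : Type) (F : set_system T) (FF : Filter F)
    (f : T -> R) (a : R) :
  0 < a -> f t @[t --> F] --> a -> ln (f t) @[t --> F] --> ln a.
Proof. by move=> a0 fa; exact: (continuous_cvg _ (continuous_ln a0) fa). Qed.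

(** The logarithm of the inverse Poisson kernel. *)
Definition poisson_log xi x : R :=
  2 * ln (normc (\val x - \val xi)) - ln (1 - normc (\val x) ^+ 2).

Lemma cvg_busemann (T : Type) (F : set_system T) (FF : Filter F)
    (c : T -> disc R) xi x y :
  \val (c t) @[t --> F] --> \val xi ->
  hdist x (c t) - hdist y (c t) @[t --> F] -->
    poisson_log xi x - poisson_log xi y.
Proof.
move=> cxi.
have lim (w : disc R) : ln (hsum (\val w) (\val (c t))) @[t --> F] -->
    ln (hsum (\val w) (\val xi)).
  apply: cvg_ln_pos; last exact: cvg_hsum.
  by rewrite hsum_circle mulr_gt0 // dist_circle_gt0.
have -> : poisson_log xi x - poisson_log xi y =
    (2 * ln (hsum (\val x) (\val xi)) - ln (1 - normc (\val x) ^+ 2)) -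
    (2 * ln (hsum (\val y) (\val xi)) - ln (1 - normc (\val y) ^+ 2)).
  have e (w : disc R) : ln (hsum (\val w) (\val xi)) =
      ln 2 + ln (normc (\val w - \val xi)).
    by rewrite hsum_circle lnM ?posrE //; exact: dist_circle_gt0.
  by rewrite !e /poisson_log; ring.
under eq_cvg => t.
  have -> : hdist x (c t) - hdist y (c t) =
    (2 * ln (hsum (\val x) (\val (c t))) - ln (1 - normc (\val x) ^+ 2)) -
    (2 * ln (hsum (\val y) (\val (c t))) - ln (1 - normc (\val y) ^+ 2)).
    by rewrite !hdist_hsum; ring.
  over.
have half (w : disc R) : 2 * ln (hsum (\val w) (\val (c t))) - ln (1 - normc (\val w) ^+ 2)
    @[t --> F] --> 2 * ln (hsum (\val w) (\val xi)) - ln (1 - normc (\val w) ^+ 2).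
  apply: cvgB; last exact: cvg_cst.
  by apply: cvgM; [exact: cvg_cst|exact: lim].
exact: cvgB.
Qed.

(** ** Diameters *)

(** [tanh (t / 2)] *)
Definition radius (t : R) : R := (1 - expR (- t)) / (1 + expR (- t)).

Lemma one_addexp_gt0 (t : R) : 0 < 1 + expR (- t) :> R.
Proof. by rewrite addr_gt0 // expR_gt0. Qed.

Lemma radius_1B t : 1 - radius t = 2 * expR (- t) / (1 + expR (- t)).
Proof. by have := one_addexp_gt0 t => q; rewrite /radius; field; rewrite gt_eqF. Qed.

Lemma radius_1D t : 1 + radius t = 2 / (1 + expR (- t)).
Proof. by have := one_addexp_gt0 t => q; rewrite /radius; field; rewrite gt_eqF. Qed.

Lemma radius_lt1 t : `|radius t| < 1.
Proof.
have q := one_addexp_gt0 t; have e0 := expR_gt0 (- t).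
rewrite ltr_norml; apply/andP; split.
  by rewrite -subr_gt0 opprK addrC radius_1D divr_gt0.
by rewrite -subr_gt0 radius_1B !divr_gt0 // mulr_gt0.
Qed.

Lemma diameter_in_disc xi t : normc ((radius t)%:C * \val xi) < 1.
Proof. by rewrite normcM circle_eq1 mulr1 normc_real radius_lt1. Qed.

Definition diam_line xi t : disc R := sval (to_disc (diameter_in_disc xi t)).

Lemma diam_lineE xi t : \val (diam_line xi t) = (radius t)%:C * \val xi.
Proof. by rewrite /diam_line; case: to_disc. Qed.

Lemma diam_line_geodesic xi : geodesic_line (diam_line xi).
Proof.
have main s t : t <= s -> hdist (diam_line xi s) (diam_line xi t) = s - t.
  move=> ts; rewrite /hdist !diam_lineE.
  have e1 : (radius s)%:C * \val xi - (radius t)%:C * \val xi =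
    (radius s - radius t)%:C * \val xi by rewrite rmorphB; ring.
  have e2 : 1 - ((radius s)%:C * \val xi)^* * ((radius t)%:C * \val xi) =
    (1 - radius s * radius t)%:C.
    have rM (a b : R) : (1 - a * b)%:C = 1 - a%:C * b%:C :> R[i].
      by rewrite rmorphB rmorphM rmorph1.
    rewrite conjcM conjc_real rM.
    have : \val xi * (\val xi)^* = 1 by rewrite -sqr_normcJ circle_eq1 expr1n.
    by move=> xx; ring: xx.
  rewrite -[Num.conj _]/(((radius s)%:C * \val xi)^*) e1 e2 normcM circle_eq1 mulr1 !normc_real.
  have rs := radius_lt1 s; have rt := radius_lt1 t.
  move: rs rt; rewrite !ltr_norml => /andP[s1 s2] /andP[t1 t2].
  have rle : radius t <= radius s.
    rewrite -[radius t](subKr 1) -[radius s](subKr 1) lerD2l lerN2 !radius_1B.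
    have qs := one_addexp_gt0 s; have qt := one_addexp_gt0 t.
    rewrite ler_pdivrMr // mulrAC ler_pdivlMr //.
    have : expR (- s) <= expR (- t) by rewrite ler_expR lerN2.
    by have := expR_gt0 (- s); have := expR_gt0 (- t); nra.
  rewrite !ger0_norm ?subr_ge0 //; last by nra.
  have -> : 1 - radius s * radius t + (radius s - radius t) =
    (1 + radius s) * (1 - radius t) by ring.
  have -> : 1 - radius s * radius t - (radius s - radius t) =
    (1 - radius s) * (1 + radius t) by ring.
  rewrite !radius_1B !radius_1D.
  have eE : expR (s - t) = expR (- t) / expR (- s).
    by rewrite -expRN opprK -expRD addrC.
  have qs := one_addexp_gt0 s; have qt := one_addexp_gt0 t.
  have es := expR_gt0 (- s); have et := expR_gt0 (- t).
  rewrite -[RHS]expRK eE; congr ln.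
  by field; rewrite !gt_eqF.
move=> s t; have [st|/ltW ts] := leP s t.
  by rewrite hdistC main // distrC ger0_norm // subr_ge0.
by rewrite main // ger0_norm // subr_ge0.
Qed.

Lemma expRN_cvg0 : expR (- t) @[t --> +oo] --> (0 : R).
Proof. exact: cvgr_expR. Qed.

Lemma diam_line_dist xi t : normc (\val xi - \val (diam_line xi t)) =
  2 * expR (- t) / (1 + expR (- t)).
Proof.
rewrite diam_lineE.
have -> : \val xi - (radius t)%:C * \val xi = (1 - radius t)%:C * \val xi.
  by rewrite rmorphB rmorph1; ring.
by rewrite normcM circle_eq1 mulr1 normc_real radius_1B ger0_norm.
Qed.

Lemma diam_line_dist_le xi t :
  normc (\val xi - \val (diam_line xi t)) <= 2 * expR (- t).
Proof.
have q := one_addexp_gt0 t; have e0 := expR_gt0 (- t).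
by rewrite diam_line_dist ler_pdivrMr //; nra.
Qed.

Lemma diam_line_depth xi t : 1 - normc (\val (diam_line xi t)) ^+ 2 =
  4 * expR (- t) / (1 + expR (- t)) ^+ 2.
Proof.
rewrite diam_lineE normcM circle_eq1 mulr1 normc_real real_normK ?num_real //.
have -> : 1 - radius t ^+ 2 = (1 - radius t) * (1 + radius t) by ring.
rewrite radius_1B radius_1D.
by have := one_addexp_gt0 t => q; field; rewrite gt_eqF.
Qed.

Lemma diam_line_cvg xi : \val (diam_line xi t) @[t --> +oo] --> \val xi.
Proof.
apply/cvg_normcP => e e0; have e20 : 0 < e / 2 by rewrite divr_gt0.
have /cvgrPdist_lt/(_ _ e20) := expRN_cvg0.
apply: filterS => t; rewrite sub0r normrN ger0_norm ?expR_ge0 // => te.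
by apply: le_lt_trans (diam_line_dist_le xi t) _; lra.
Qed.

Lemma diam_line_ray xi : ray_to xi (diam_line xi).
Proof.
split; last exact: diam_line_cvg.
by move=> s t _ _; exact: diam_line_geodesic.
Qed.

Lemma diam_line_opp xi t : \val (diam_line xi (- t)) = - \val (diam_line xi t).
Proof.
rewrite !diam_lineE -mulNr -rmorphN; congr ((_)%:C * _).
rewrite /radius opprK.
have e := expRN t; have e0 := expR_gt0 t.
by rewrite e; field; rewrite !gt_eqF ?addr_gt0 // ?invr_gt0.
Qed.

Lemma busemannE xi x y : busemann xi x y = poisson_log xi x - poisson_log xi y.
Proof.
rewrite /busemann; have : ray_to xi (xget (fun=> disc0 R) [set c | ray_to xi c]).
  exact: (@xgetPex _ (fun=> disc0 R) [set c | ray_to xi c]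
    (ex_intro _ _ (diam_line_ray xi))).
by case=> _ cxi; apply: cvg_lim => //; exact: cvg_busemann.
Qed.

(** ** Existence of geodesics *)

Lemma add_conj_Re (z w : R[i]) :
  z * w^* + z^* * w = 2 * (complex.Re (z * w^*))%:C.
Proof.
case: z w => a b [c d]; apply/eqP; rewrite eq_complex /=.
by apply/andP; split; apply/eqP; ring.
Qed.

(** The entries are the half-sum and the half-difference of the square roots
    of [zeta] and [- xi], one of them rescaled to make the determinant [1]. *)
Lemma exists_su_boundary xi zeta : xi <> zeta ->
  exists m : su11 R, act m (- 1) = \val xi /\ act m 1 = \val zeta.
Proof.
move=> ne; pose al := sqrtc (\val zeta); pose be := sqrtc (- \val xi).
have al2 : al ^+ 2 = \val zeta by exact: sqr_sqrtc.
have be2 : be ^+ 2 = - \val xi by exact: sqr_sqrtc.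
have al1 : normc al = 1.
  apply/eqP; rewrite -(@eqrXn2 _ 2) ?normc_ge0 // expr1n expr2 -normcM -expr2.
  by rewrite al2 circle_eq1.
have be1 : normc be = 1.
  apply/eqP; rewrite -(@eqrXn2 _ 2) ?normc_ge0 // expr1n expr2 -normcM -expr2.
  by rewrite be2 normcN circle_eq1.
have ala : al * al^* = 1 by rewrite -sqr_normcJ al1 expr1n.
have beb : be * be^* = 1 by rewrite -sqr_normcJ be1 expr1n.
pose r := complex.Re (al * be^*).
have r0 : r != 0.
  apply/eqP => r0; apply: ne; apply: val_inj.
  have sum0 : al * be^* + al^* * be = 0.
    by rewrite add_conj_Re -/r r0 rmorph0 mulr0.
  have e1 : al ^+ 2 + be ^+ 2 = (al * be^* + al^* * be) * (al * be).
    by ring: ala beb.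
  apply/eqP; rewrite eq_sym -subr_eq0 -al2 -[\val xi]opprK -be2 opprK e1 sum0.
  by rewrite mul0r.
pose u := (r^-1)%:C * al; pose hf : R[i] := (2^-1)%:C;
pose a := hf * (u + be); pose b := hf * (u - be).
have ur : u * be^* + u^* * be = 2.
  rewrite add_conj_Re /u -mulrA.
  have -> : complex.Re ((r^-1)%:C * (al * be^*)) = 1.
    rewrite /r; move: r0; rewrite /r; case: (al * be^*) => x y /= x0.
    by rewrite mul0r subr0 mulVf.
  by rewrite rmorph1 mulr1.
have hf2 : hf * 2 = 1.
  by apply/eqP; rewrite eq_complex /=; apply/andP; split; apply/eqP; field.
have aE : a^* = hf * (u^* + be^*) by rewrite conjcM conjc_real conjcD.
have bE : b^* = hf * (u^* - be^*) by rewrite conjcM conjc_real conjcD conjcN.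
have ab : a * a^* = 1 + b * b^*.
  have -> : (1 : R[i]) = hf ^+ 2 * 2 * (u * be^* + u^* * be).
    by rewrite ur -mulrA -expr2 -exprMn hf2 expr1n.
  by rewrite aE bE /a /b; ring.
have be0 : be != 0 by rewrite -normc_gt0 be1.
have al0 : al != 0 by rewrite -normc_gt0 al1.
exists (SU11 ab); split; rewrite /act /su_den /=.
  have -> : a * -1 + b = - be by rewrite ?mulrN1 ?mulr1 -[RHS]mul1r -hf2 /a /b; ring.
  have -> : b^* * -1 + a^* = be^* by rewrite ?mulrN1 ?mulr1 -[RHS]mul1r -hf2 aE bE; ring.
  have bei : be^* = be^-1 by apply: (mulfI be0); rewrite beb mulfV.
  by rewrite bei invrK mulNr -expr2 be2 opprK.
have -> : a * 1 + b = u by rewrite ?mulrN1 ?mulr1 -[RHS]mul1r -hf2 /a /b; ring.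
have -> : b^* * 1 + a^* = u^* by rewrite ?mulrN1 ?mulr1 -[RHS]mul1r -hf2 aE bE; ring.
rewrite /u conjcM conjc_real.
have rC : (r^-1)%:C != 0 :> R[i] by rewrite eq_complex /= eqxx andbT invr_eq0.
have ali : al^* = al^-1 by apply: (mulfI al0); rewrite ala mulfV.
by rewrite -mulf_div divff // mul1r ali invrK -expr2.
Qed.

Lemma exists_geodesic xi zeta : xi <> zeta ->
  exists x, geodesic_between xi zeta x.
Proof.
move=> /exists_su_boundary[m [mxi mzeta]].
have one1 : normc (1 : R[i]) = 1 by exact: normc1.
have [one oneE] := to_circle one1.
have act_in t := act_lt1 m (disc_lt1 (diam_line one t)).
pose c t : disc R := sval (to_disc (act_in t)).
have cE t : \val (c t) = act m (\val (diam_line one t)).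
  by rewrite /c; case: to_disc.
pose g (x : disc R) : disc R := sval (to_disc (act_lt1 m (disc_lt1 x))).
have mg : realizes m g by move=> x; rewrite /g; case: to_disc.
have cg t : c t = g (diam_line one t) by apply: val_inj; rewrite cE mg.
exists (c 0), c; split; last by exists 0.
- by move=> s t; rewrite !cg (hdist_realizes _ _ mg) diam_line_geodesic.
- apply/(@cvgNy_compNP _ _ (fun t => \val (c t))).
  rewrite -mxi; under eq_cvg => t do rewrite /= cE diam_line_opp.
  apply: act_continuous; rewrite ?normcN ?normc1 //.
    by move=> t; rewrite normcN disc_le1.
  apply/cvg_normcP => e e0.
  have /cvg_normcP/(_ _ e0) := diam_line_cvg (xi := one).
  apply: filterS => t; rewrite oneE.
  by rewrite -opprD normcN.
- under eq_cvg do rewrite cE; rewrite -mzeta -oneE.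
  apply: act_continuous; rewrite ?circle_le1 //; last exact: diam_line_cvg.
  by move=> t; rewrite disc_le1.
Qed.

Lemma real_cvg_unique (T : Type) (F : set_system T) {FF : ProperFilter F}
    (f : T -> R) (a b : R) :
  f t @[t --> F] --> a -> f t @[t --> F] --> b -> a = b.
Proof. by move=> fa fb; exact: (cvg_unique (@Rhausdorff R) fa fb). Qed.

(** The Busemann function decreases at unit speed along the ray. *)
Lemma ray_poisson (c : R -> disc R) xi (s : R) : ray_to xi c -> 0 <= s ->
  poisson_log xi (c s) = poisson_log xi (c 0) - s.
Proof.
move=> [geo cxi] s0.
have lim1 : hdist (c 0) (c t) - hdist (c s) (c t) @[t --> +oo] --> s.
  apply: cvg_near_cst; near=> t.
  have t0 : s <= t by near: t; apply: nbhs_pinfty_ge; rewrite num_real.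
  have tp : 0 <= t := le_trans s0 t0.
  rewrite (geo 0 t) // (geo s t) // sub0r normrN ger0_norm //.
  by rewrite distrC ger0_norm ?subr_ge0 // subKr.
have lim2 : hdist (c 0) (c t) - hdist (c s) (c t) @[t --> +oo] -->
  poisson_log xi (c 0) - poisson_log xi (c s) by exact: cvg_busemann.
have e := real_cvg_unique lim2 lim1.
by rewrite -[X in _ = _ - X]e subKr.
Unshelve. all: by end_near. Qed.

(** For [s <= t0], the distance from [x] to [c s] is also the variation of the
    Busemann function at [zeta]; the equality of the two formulas passes to
    the limit [s --> -oo]. *)
Lemma geodesic_between_poisson xi zeta x : xi <> zeta ->
  geodesic_between xi zeta x ->
  ln (normc (\val xi - \val zeta)) + ln (1 - normc (\val x) ^+ 2) =
  ln 2 + ln (normc (\val x - \val xi)) + ln (normc (\val x - \val zeta)).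
Proof.
move=> ne [c [geo cm cp [t0 ct0]]].
have side (s : R) : s <= t0 -> 2 * ln (normc (\val x - \val zeta)) -
    2 * ln (normc (\val (c s) - \val zeta)) + 2 * ln (hsum (\val x) (\val (c s)))
    - 2 * ln (1 - normc (\val x) ^+ 2) = 0.
  move=> st0.
  have h1 : poisson_log zeta x - poisson_log zeta (c s) = s - t0.
    have lim : hdist x (c t) - hdist (c s) (c t) @[t --> +oo] -->
      poisson_log zeta x - poisson_log zeta (c s) by exact: cvg_busemann.
    apply: (real_cvg_unique lim).
    apply: cvg_near_cst; near=> t.
    have tt0 : t0 <= t by near: t; apply: nbhs_pinfty_ge; rewrite num_real.
    by rewrite -ct0 !geo !ler0_norm ?subr_le0 ?(le_trans st0) //; ring.
  have := geo t0 s; rewrite ct0 hdist_hsum ger0_norm ?subr_ge0 //.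
  move: h1; rewrite /poisson_log; lra.
pose F s := 2 * ln (normc (\val x - \val zeta)) -
    2 * ln (normc (\val (c s) - \val zeta)) + 2 * ln (hsum (\val x) (\val (c s)))
    - 2 * ln (1 - normc (\val x) ^+ 2).
have F0 : F s @[s --> -oo] --> (0 : R).
  apply: cvg_near_cst; near=> s; apply: side.
  by near: s; apply: nbhs_ninfty_le; rewrite num_real.
have xz : 0 < normc (\val xi - \val zeta).
  by rewrite normc_gt0 subr_eq0; apply/eqP => e; apply: ne; apply: val_inj.
have Fl : F s @[s --> -oo] --> 2 * ln (normc (\val x - \val zeta)) -
    2 * ln (normc (\val xi - \val zeta)) + 2 * ln (hsum (\val x) (\val xi))
    - 2 * ln (1 - normc (\val x) ^+ 2).
  apply: cvgB; last exact: cvg_cst.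
  apply: cvgD; last first.
    apply: cvgM; first exact: cvg_cst.
    apply: cvg_ln_pos; last by apply: cvg_hsum; exact: cm.
    by rewrite hsum_circle mulr_gt0 // dist_circle_gt0.
  apply: cvgB; first exact: cvg_cst.
  apply: cvgM; first exact: cvg_cst.
  apply: cvg_ln_pos xz _; apply: cvg_normc; apply/cvg_normcP => e e0.
  have /cvg_normcP/(_ _ e0) := cm; apply: filterS => s.
  by rewrite [_ - _ - (_ - _)](_ : _ = \val xi - \val (c s)) //; ring.
have e : 2 * ln (normc (\val x - \val zeta)) -
    2 * ln (normc (\val xi - \val zeta)) + 2 * ln (hsum (\val x) (\val xi))
    - 2 * ln (1 - normc (\val x) ^+ 2) = 0 by apply: real_cvg_unique Fl F0.
move: e; rewrite hsum_circle lnM ?posrE ?ltr0n //; last exact: dist_circle_gt0.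
move: (ln _) (ln _) (ln _) (ln _) (ln _) => a b d f g e.
lra.
Unshelve. all: by end_near. Qed.

(** ** The visual distance *)

(** The visual distance is half the chordal one. [geodesic_between_poisson]
    evaluates the Gromov product at an arbitrary point of the geodesic. *)
Lemma visual_distE xi zeta :
  visual_dist xi zeta = normc (\val xi - \val zeta) / 2.
Proof.
rewrite /visual_dist; have [->|/eqP ne] := eqVneq xi zeta.
  by rewrite subrr normc0 mul0r.
have xz : 0 < normc (\val xi - \val zeta).
  by rewrite normc_gt0 subr_eq0; apply/eqP => e; apply: ne; apply: val_inj.
rewrite /gromov_product; set x := xget _ _.
have gx : geodesic_between xi zeta x.
  have [y gy] := exists_geodesic ne.
  exact: (@xgetPex _ (disc0 R) (geodesic_between xi zeta) (ex_intro _ y gy)).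
rewrite !busemannE.
have p0 eta : poisson_log eta (disc0 R) = 0.
  rewrite /poisson_log val_disc0 sub0r normcN circle_eq1 ln1 normc0.
  by rewrite expr0n subr0 ln1 mulr0 subr0.
have := geodesic_between_poisson ne gx; rewrite !p0 /poisson_log => e.
have -> : - (2^-1 * (0 - (2 * ln (normc (\val x - \val xi)) -
    ln (1 - normc (\val x) ^+ 2)) + (0 - (2 * ln (normc (\val x - \val zeta)) -
    ln (1 - normc (\val x) ^+ 2))))) = ln (normc (\val xi - \val zeta)) - ln 2.
  by lra.
by rewrite -ln_div ?posrE ?ltr0n // lnK // posrE divr_gt0.
Qed.

Lemma expR_2ln (a : R) : 0 < a -> expR (2 * ln a) = a ^+ 2.
Proof.
move=> a0; have -> : 2 * ln a = ln a + ln a by ring.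
by rewrite expRD lnK ?posrE // expr2.
Qed.

(** [ray_poisson] gives the first estimate, and the distance to [c 0] the
    second. *)
Lemma ray_dist (c : R -> disc R) xi : ray_to xi c ->
  exists2 K : R, 0 < K & forall t, 0 <= t ->
    normc (\val xi - \val (c t)) ^+ 2 <=
      K * expR (- t) * (1 - normc (\val (c t)) ^+ 2) /\
    expR (- t) <= K * (1 - normc (\val (c t)) ^+ 2).
Proof.
move=> rc; have [geo _] := rc.
have x0 := disc_sqr_lt1 (c 0).
pose K1 := expR (poisson_log xi (c 0)).
pose K2 := (1 - normc (\val (c 0)) ^+ 2) / (1 - normc (\val (c 0))) ^+ 2.
have c01 : 0 < 1 - normc (\val (c 0)) by rewrite subr_gt0 disc_lt1.
have K20 : 0 < K2 by rewrite divr_gt0 // exprn_gt0.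
exists (K1 + K2); first by rewrite addr_gt0 // expR_gt0.
move=> t t0; have xt := disc_sqr_lt1 (c t); have et := expR_gt0 (- t).
have K10 : 0 < K1 by exact: expR_gt0.
split.
  have e : normc (\val xi - \val (c t)) ^+ 2 =
      K1 * expR (- t) * (1 - normc (\val (c t)) ^+ 2).
    have d0 := dist_circle_gt0 (c t) xi.
    rewrite /K1 -expRD -(ray_poisson rc t0) /poisson_log expRD expRN lnK //.
    by rewrite divfK ?gt_eqF // expR_2ln // normcB.
  by rewrite e ler_wpM2r ?(ltW xt) // ler_wpM2r ?(ltW et) // lerDl ltW.
have := geo 0 t (lexx _) t0; rewrite hdist_hsum sub0r normrN ger0_norm // => e.
have S0 : 1 - normc (\val (c 0)) <= hsum (\val (c 0)) (\val (c t)).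
  rewrite /hsum; apply: ler_wpDr; first exact: normc_ge0.
  apply: le_trans (lerB_normc _ _); rewrite normc1 lerB // normcM normc_conj.
  by rewrite ler_piMr ?normc_ge0 // disc_le1.
have Spos : 0 < hsum (\val (c 0)) (\val (c t)) by exact: lt_le_trans S0.
have e2 : expR (- t) * hsum (\val (c 0)) (\val (c t)) ^+ 2 =
   (1 - normc (\val (c 0)) ^+ 2) * (1 - normc (\val (c t)) ^+ 2).
  have -> : - t = ln (1 - normc (\val (c 0)) ^+ 2) +
    ln (1 - normc (\val (c t)) ^+ 2) - 2 * ln (hsum (\val (c 0)) (\val (c t))).
    lra.
  rewrite !expRD expRN !lnK ?posrE // expR_2ln //.
  by rewrite divfK // expf_eq0 /= gt_eqF.
have : expR (- t) <= K2 * (1 - normc (\val (c t)) ^+ 2).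
  rewrite /K2 mulrAC ler_pdivlMr ?exprn_gt0 // -e2.
  by rewrite ler_wpM2l ?(ltW et) // ler_sqr ?nnegrE // ltW.
move=> h; apply: le_trans h _.
by rewrite ler_wpM2r ?(ltW xt) // lerDr ltW.
Qed.

End Geodesics.

(** * Compact subsets of the quotient surface *)

Section Quotient.
Variables (R : realType) (G : set (disc R -> disc R)).
Hypothesis G_one : G id.
Hypothesis G_inv : forall g, G g -> G (disc_inv g).
Hypothesis G_comp : forall f g, G f -> G g -> G (f \o g).
Hypothesis G_matrix : forall g, G g -> exists m, realizes m g.

Local Notation Sigma := (quotient_surface G).
Local Notation pi := (\pi_(Sigma)%qT : disc R -> Sigma).
Implicit Types (x y : disc R).

Lemma pi_eqP x y : pi x = pi y <-> exists2 g, G g & g x = y.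
Proof.
have self z : Defs.orbit G z z by exists id.
split=> [e|[g Gg gxy]].
  have /asboolP e' : same_orbit G x y.
    by apply/(eqmodP (same_orbit_equiv_rel G)); exact: e.
  by have := self y; rewrite -e' => -[g Gg gx]; exists g.
apply/(eqmodP (same_orbit_equiv_rel G))/asboolP.
have [m mg] := G_matrix Gg.
have yx : disc_inv g y = x by rewrite -gxy (disc_invK mg).
apply/seteqP; split=> z [f Gf <-].
  by exists (f \o disc_inv g); [exact/G_comp/G_inv|rewrite /= yx].
by exists (f \o g); [exact: G_comp|rewrite /= gxy].
Qed.

Lemma normc_open (a b c d : R[i]) (r : R) :
  open [set z : R[i] | normc (a * z + b) < r * normc (c * z + d)].
Proof.
rewrite openE => z /= zr; apply/nbhs_normcP.
pose k := normc a + `|r| * normc c + 1.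
have k0 : 0 < k.
  by rewrite ltr_wpDl // addr_ge0 ?mulr_ge0 ?normc_ge0.
pose gap := r * normc (c * z + d) - normc (a * z + b).
have gap0 : 0 < gap by rewrite subr_gt0.
exists (gap / k); first by rewrite divr_gt0.
move=> w; rewrite ltr_pdivlMr // => zw /=.
have n0 := normc_ge0 (z - w).
have h1 : normc (a * w + b) <= normc (a * z + b) + normc a * normc (z - w).
  rewrite -normcM -lerBlDl; apply: le_trans (lerB_normc _ _) _.
  have -> : a * w + b - (a * z + b) = - (a * (z - w)) by ring.
  by rewrite normcN.
have h2 : r * normc (c * w + d) >=
    r * normc (c * z + d) - `|r| * (normc c * normc (z - w)).
  rewrite -normcM.
  have -> : c * (z - w) = (c * z + d) - (c * w + d) by ring.
  move: (c * z + d) (c * w + d) => X Y.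
  rewrite lerBlDr -lerBlDl -mulrBr; apply: le_trans (ler_norm _) _.
  rewrite normrM ler_wpM2l // ler_norml lerB_normc andbT lerNl opprB.
  by rewrite normcB lerB_normc.
rewrite /gap /k in zw; nra.
Qed.

(** The surface is the increasing union of the open images of the discs of
    radii [r < 1]. *)
Lemma compact_lift (W : set Sigma) : compact W ->
  exists2 r : R, r < 1 & forall x, W (pi x) ->
    exists2 g, G g & normc (\val (g x)) <= r.
Proof.
move=> cW; apply: contrapT => no.
pose U r : set Sigma := [set s | exists2 y, normc (\val y) < r & pi y = s].
have U_open r : open (U r).
  suff : open (pi @^-1` U r) by [].
  pose V := \bigcup_(m in [set m | exists2 g, G g & realizes m g])
    [set z : R[i] | normc (su_a m * z + su_b m) <
      r * normc ((su_b m)^* * z + (su_a m)^*)].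
  have VE : pi @^-1` U r = set_val @^-1` V.
    apply/seteqP; split=> x /=.
      move=> [y yr /esym/pi_eqP[g Gg gx]]; have [m mg] := G_matrix Gg.
      exists m; first by exists g.
      rewrite /= -ltr_pdivrMr; last exact: (den_gt0 m (disc_le1 x)).
      by rewrite -normcf_div -[_ / _]/(act m (\val x)) -mg gx.
    move=> [m [g Gg mg]] /=.
    rewrite -ltr_pdivrMr; last exact: (den_gt0 m (disc_le1 x)).
    rewrite -normcf_div -[_ / _]/(act m (\val x)) -mg => gr.
    exists (g x) => //; apply/esym/pi_eqP; by exists g.
  rewrite VE; apply: open_comp; first by move=> x _; exact: initial_continuous.
  by apply: bigcup_open => m _; exact: normc_open.
pose F := filter_from [set r : R | r < 1] (fun r => W `\` U r).
have FF : ProperFilter F.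
  apply: filter_from_proper.
    apply: filter_from_filter; first by exists 0; exact: ltr01.
    move=> r r' r1 r1'; exists (Num.max r r').
      by rewrite /= gt_max r1.
    move=> s [Ws nU]; split; split => // -[y yr ys]; apply: nU; exists y => //.
      by rewrite lt_max yr.
    by rewrite lt_max yr orbT.
  move=> r r1; apply: contrapT => e; apply: no; exists r => // x Wx.
  have [[y yr /esym/pi_eqP[g Gg gx]]|nU] := pselect (U r (pi x)).
    by exists g => //; rewrite gx ltW.
  by exfalso; apply: e; exists (pi x).
have FW : F W by exists 0; [exact: ltr01|move=> s []].
have [s [Ws cs]] := cW F FF FW.
have [y ys] : exists y, pi y = s by exists (repr s); exact: reprK.
pose r := (1 + normc (\val y)) / 2.
have y1 := disc_lt1 y.
have Us : nbhs s (U r).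
  apply: open_nbhs_nbhs; split; first exact: U_open.
  by exists y => //; rewrite /r; lra.
have Fr : F (W `\` U r) by exists r => //=; rewrite /r; lra.
by have [t [[_ nt] /nt]] := cs _ _ Fr Us.
Qed.

(** A cluster point is found in the plane, and belongs to the open disc
    because [r < 1]. *)
Lemma disc_ball_compact (r : R) : r < 1 ->
  compact [set x : disc R | normc (\val x) <= r].
Proof.
move=> r1 F FF Fr.
pose f (x : disc R) : R * R := (complex.Re (\val x), complex.Im (\val x)).
have box : compact (`[-1, 1]%classic `*` `[-1, 1]%classic : set (R * R)).
  by apply: compact_setX; exact: segment_compact.
have Fbox : (f @ F) (`[-1, 1]%classic `*` `[-1, 1]%classic).
  suff : F (f @^-1` (`[-1, 1]%classic `*` `[-1, 1]%classic)) by [].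
  apply: filterS filterT => x _; have x1 := disc_le1 x.
  by rewrite /= !in_itv /= -!ler_norml; split;
    [exact: le_trans (normc_Re _) _|exact: le_trans (normc_Im _) _].
have [[a b] [_ cl]] := box (f @ F) _ Fbox.
have near_pt (e : R) (B : set (disc R)) : 0 < e -> F B ->
    exists x, [/\ B x, normc (\val x) <= r & normc (\val x - (a +i* b)) < e].
  move=> e0 FB; have e2 : 0 < e / 2 by rewrite divr_gt0.
  have FBr : (f @ F) (f @` (B `&` [set x | normc (\val x) <= r])).
    suff : F (f @^-1` (f @` (B `&` [set x | normc (\val x) <= r]))) by [].
    by apply: filterS (filterI FB Fr) => x Bx; exists x.
  have N : nbhs ((a, b) : R * R) (ball (a, b) (e / 2)) by exact: nbhsx_ballx.
  have [_ [[x [Bx xr] <-] [/= h1 h2]]] := cl _ _ FBr N.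
  exists x; split => //; apply: le_lt_trans (normc_le_ReIm _) _.
  move: h1 h2; rewrite -!ball_normE /ball_ /= => h1 h2.
  have -> : complex.Re (\val x - (a +i* b)) = complex.Re (\val x) - a.
    by case: (\val x).
  have -> : complex.Im (\val x - (a +i* b)) = complex.Im (\val x) - b.
    by case: (\val x).
  by rewrite distrC [X in _ + X]distrC; lra.
have wr : normc (a +i* b) <= r.
  rewrite leNgt; apply/negP => rw.
  have [|x [_ xr xw]] := near_pt (normc (a +i* b) - r) setT _ filterT.
    by rewrite subr_gt0.
  have := lerB_normc (a +i* b) (\val x); rewrite normcB; lra.
have [w wE] := to_disc (le_lt_trans wr r1).
exists w; split; first by rewrite /= wE.
move=> B V FB [A0 [[Q oQ OE] A0w VV]].
have : Q (a +i* b) by rewrite -wE; move: A0w; rewrite -OE.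
move: oQ; rewrite openE => oQ /oQ /nbhs_normcP[e e0 eO].
have [x [Bx _ xw]] := near_pt e B e0 FB; exists x; split => //.
apply: VV; rewrite -OE /=; apply: eO; by rewrite normcB.
Qed.

Lemma compact_cover_lift (r : R) : r < 1 ->
  exists2 W : set Sigma, compact W & forall x g, G g ->
    normc (\val (g x)) <= r -> W (pi x).
Proof.
move=> r1; exists (pi @` [set x : disc R | normc (\val x) <= r]).
  apply: continuous_compact; last exact: disc_ball_compact.
  apply: continuous_subspaceT => x; exact: pi_continuous.
move=> x g Gg gr; exists (g x) => //.
by apply/esym/pi_eqP; exists g.
Qed.

End Quotient.

(** * Integrals of indicator functions *)

Section Integrals.
Variable R : realType.
Local Notation mu := (@lebesgue_measure R).

(** The functions of interest are indicators of sets of times, which are only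
    known to lie between measurable ones. *)
Lemma ge0_le_integralW (D : set R) (f g : R -> \bar R) :
  (forall x, D x -> (0 <= f x)%E) -> (forall x, D x -> (f x <= g x)%E) ->
  (\int[mu]_(x in D) f x <= \int[mu]_(x in D) g x)%E.
Proof.
move=> f0 fg; have g0 x : D x -> (0 <= g x)%E.
  by move=> Dx; exact: le_trans (f0 x Dx) (fg x Dx).
rewrite !ge0_integralE //; apply: ereal_sup_le => _ [k kf <-]; exists k => // x.
apply: le_trans (kf x) _; rewrite /patch; case: ifPn => // xD.
by apply: fg; rewrite inE in xD.
Qed.

Variable T : R.
Hypothesis T0 : 0 <= T.

Lemma mu_itv_T : mu `[0, T]%classic = T%:E.
Proof.
rewrite lebesgue_measure_itv /= lte_fin; case: ltP => [_|T1].
  by rewrite sube0.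
by have -> : T = 0 by apply/le_anti/andP.
Qed.

Lemma integral_indic_fin (A : set R) :
  (\int[mu]_(t in `[0%R, T]) (\1_A t)%:E)%E \is a fin_num.
Proof.
rewrite ge0_fin_numE; last first.
  by apply: integral_ge0 => t _; rewrite lee_fin.
apply: (@le_lt_trans _ _ T%:E); last exact: ltry.
rewrite -mu_itv_T -[X in (_ <= mu X)%E]setIid -integral_indic //.
apply: ge0_le_integralW => t tT; first by rewrite lee_fin.
by rewrite lee_fin !indicE (mem_set tT) lern1 leq_b1.
Qed.

Lemma Rintegral_indic_ge (A B : set R) (b : R) : measurable B ->
  B `<=` A -> B `<=` `[0, T]%classic -> (b%:E <= mu B)%E ->
  b <= \int[mu]_(t in `[0, T]) \1_A t.
Proof.
move=> mB BA BT bB; rewrite -lee_fin /Rintegral fineK; last first.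
  exact: integral_indic_fin.
apply: le_trans bB _; have -> : mu B = mu (B `&` `[0, T]%classic).
  by congr mu; apply/esym/setIidl.
rewrite -integral_indic //; apply: ge0_le_integralW => t _; rewrite lee_fin //.
rewrite !indicE ler_nat; case: (boolP (t \in B)) => // tB.
by rewrite (mem_set (BA t _)) //; rewrite inE in tB.
Qed.

Lemma Rintegral_indic_le (A B : set R) (b : R) : measurable B ->
  (forall t, 0 <= t <= T -> A t -> B t) -> (mu B <= b%:E)%E ->
  \int[mu]_(t in `[0, T]) \1_A t <= b.
Proof.
move=> mB AB Bb; rewrite -lee_fin /Rintegral fineK; last first.
  exact: integral_indic_fin.
apply: le_trans Bb; apply: (@le_trans _ _ (mu (B `&` `[0, T]%classic))).
  rewrite -integral_indic //; apply: ge0_le_integralW => t; rewrite ?lee_fin //.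
  rewrite /= in_itv /= => tT.
  rewrite !indicE ler_nat; case: (boolP (t \in A)) => // tA.
  by rewrite (mem_set (AB t _ _)) //; rewrite inE in tA.
by apply: le_measure; rewrite ?inE //; exact: measurableI.
Qed.

End Integrals.

(** * Time spent in the thick part *)

Section Times.
Variable R : realType.
Local Notation mu := (@lebesgue_measure R).
Implicit Types (s : nat -> R) (A : set R).

(** The intervals of length [d] that start at the points [s i] are
    disjoint. *)
Lemma time_ge s (A : set R) (d : R) k : 0 <= d -> 0 <= s 0%N ->
  (forall i, s i + d <= s i.+1) ->
  (forall i t, s i <= t < s i + d -> A t) ->
  k%:R * d <= \int[mu]_(t in `[0, s k]) \1_A t.
Proof.
move=> d0 s0 gap sA.
have [B [mB BA Bs Bmu]] : exists B : set R, [/\ measurable B, B `<=` A,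
    B `<=` `[0, s k[%classic & (k%:R * d)%:E = mu B].
  elim: k => [|k [B [mB BA Bs Bmu]]].
    by exists set0; split => //; rewrite mul0r measure0.
  have sk0 : 0 <= s k.
    elim: k {B mB BA Bs Bmu} => // j IH; apply: le_trans IH _.
    by apply: le_trans (gap j); rewrite lerDl.
  have le := gap k.
  exists (B `|` `[s k, s k + d[%classic); split.
  - exact: measurableU.
  - move=> t [/BA //|/=]; rewrite in_itv /=; exact: sA.
  - move=> t [/Bs|] /=; rewrite !in_itv /= => /andP[t1 t2]; apply/andP; split.
    + by [].
    + by apply: lt_le_trans t2 _; apply: le_trans le; rewrite lerDl.
    + exact: le_trans t1.
    + exact: lt_le_trans le.
  rewrite measureU //; last first.
    apply/seteqP; split=> // t [/Bs /=].
    by rewrite !in_itv /= => /andP[_ t2] /andP[t3 _]; move: t2; rewrite ltNge t3.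
  apply: (@etrans _ _ (mu B + mu `[s k, (s k + d)%R[%classic)%E) => //.
  have -> : mu `[s k, s k + d[%classic = d%:E.
    rewrite lebesgue_measure_itv /= lte_fin; case: ltP => [_|h].
      by rewrite -EFinB addrAC subrr add0r.
    by have -> : d = 0 by apply/le_anti; rewrite d0 andbT; lra.
  rewrite -Bmu -EFinD; congr (_%:E); rewrite -natr1 mulrDl mul1r //.
apply: (@Rintegral_indic_ge _ _ _ _ B) => //; last by rewrite Bmu.
  elim: k {B mB BA Bs Bmu} => // j IH; apply: le_trans IH _.
  by apply: le_trans (gap j); rewrite lerDl.
by move=> t /Bs /=; rewrite !in_itv /= => /andP[-> /ltW].
Qed.

Lemma time_le s (A : set R) (a T : R) N : 0 <= a -> 0 <= T ->
  (forall t, 0 <= t <= T -> A t -> exists2 i, (i < N)%N & `|t - s i| <= a) ->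
  \int[mu]_(t in `[0, T]) \1_A t <= 2 * a * N%:R.
Proof.
move=> a0 T0 cov.
pose I i : set R := `[s i - a, s i + a]%classic.
have muI i : (mu (I i) <= (2 * a)%:E)%E.
  rewrite /I lebesgue_measure_itv /= lte_fin; case: ltP => [_|_].
    by rewrite -EFinB lee_fin; lra.
  by rewrite lee_fin mulr_ge0.
apply: (@Rintegral_indic_le _ _ _ _ (\big[setU/set0]_(i < N) I i)) => //.
- by apply: bigsetU_measurable => i _; exact: measurable_itv.
- move=> t tT At; have [i iN ti] := cov t tT At.
  rewrite -bigcup_mkord; exists i => //=; rewrite /I /= in_itv /=.
  by move: ti; rewrite ler_norml; lra.
elim: N {cov} => [|N IH]; first by rewrite big_ord0 measure0 mulr0.
rewrite big_ord_recr /=; apply: le_trans (measureU2 _ _ _) _ => //.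
- by apply: bigsetU_measurable => i _; exact: measurable_itv.
- exact: measurable_itv.
have -> : 2 * a * N.+1%:R = 2 * a * N%:R + 2 * a by rewrite -natr1; ring.
by rewrite EFinD; apply: leeD => //; exact: muI.
Qed.

End Times.

(** * Codings of diverging points have heavy prefixes *)

Section Heavy.
Variables (R : realType) (P : pingpong R) (h p : disc R -> disc R).
Hypothesis real_h : realizes (hy P) h.
Hypothesis real_p : realizes (par (pq P) 1) p.
Local Notation G := (generated [set h; p]).
Local Notation Sigma := (quotient_surface G).
Local Notation pi := (\pi_(Sigma)%qT : disc R -> Sigma).

Lemma group_matrix g : G g -> exists m, realizes m g.
Proof.
by move=> /(generated_matrix real_h real_p)[m [mg _ _]]; exists m.
Qed.

Variables (ls : nat -> letter) (x : nat -> R[i]).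
Hypothesis cod : coding P ls x.

(** At this time the ray from the origin passes near the image of the origin
    under the prefix of length [k]. *)
Definition code_time k : R := 2 * ln (den (prefix P ls k) (x k)).

Lemma den_prefix_gt0 k : 0 < den (prefix P ls k) (x k).
Proof. by apply: den_gt0; exact: (coding_le1 cod). Qed.

Lemma code_time0 : code_time 0 = 0.
Proof. by rewrite /code_time den_one ln1 mulr0. Qed.

Lemma code_timeS k : code_time k.+1 =
  code_time k + 2 * ln (den (block P (ls k)) (x k.+1)).
Proof.
rewrite /code_time (den_prefixS cod) lnM ?posrE ?den_prefix_gt0 //; first by ring.
by apply: den_gt0; exact: (coding_le1 cod).
Qed.

Lemma expR_code_time k :
  expR (- code_time k) = (den (prefix P ls k) (x k)) ^- 2.
Proof. by rewrite expRN /code_time expR_2ln // den_prefix_gt0. Qed.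

Lemma ln_lam_gt0 : 0 < ln (lam P).
Proof. exact: ln_gt0 (lam_gt1 P). Qed.

Lemma code_time_step k : code_time k + 2 * ln (lam P) <= code_time k.+1.
Proof.
rewrite code_timeS lerD2l ler_pM2l // ler_ln ?posrE ?lam_gt0 //.
  by apply: block_den_ge_lam; [exact: (coding_le1 cod)|exact: (coding_escape cod)].
by apply: den_gt0; exact: (coding_le1 cod).
Qed.

Lemma code_time_ge k : k%:R * (2 * ln (lam P)) <= code_time k.
Proof.
elim: k => [|k IH]; first by rewrite mul0r code_time0.
by apply: le_trans (code_time_step k); rewrite -natr1 mulrDl mul1r lerD2r.
Qed.

Lemma code_time_ge0 k : 0 <= code_time k.
Proof.
apply: le_trans (code_time_ge k); rewrite mulr_ge0 // mulr_ge0 //.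
exact: ltW ln_lam_gt0.
Qed.

Lemma code_time_le k : code_time k <=
  2 * (k%:R * ln (den_up P) + ln (\prod_(i < k) weight R (ls i))).
Proof.
have wp j : 0 < \prod_(i < j) weight R (ls i).
  by apply: prodr_gt0 => i _; exact: weight_gt0.
elim: k => [|k IH].
  by rewrite code_time0 big_ord0 ln1 mul0r addr0 mulr0.
rewrite code_timeS big_ord_recr /= lnM ?posrE ?weight_gt0 ?wp //.
have x1 := coding_le1 cod k.+1.
have : ln (den (block P (ls k)) (x k.+1)) <=
    ln (den_up P) + ln (weight R (ls k)).
  rewrite -lnM ?posrE ?den_up_gt0 ?weight_gt0 // ler_ln ?posrE ?den_gt0 //.
    exact: block_den_le.
  by rewrite mulr_gt0 ?den_up_gt0 ?weight_gt0.
have kS a : k.+1%:R * a = k%:R * a + a by rewrite -natr1 mulrDl mul1r.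
move: IH; rewrite kS.
move: (ln (den_up P)) (ln (\prod_(i < k) _)) (ln (weight _ _)) (ln (den _ _)).
move=> a b c d; move: (k%:R * a) (code_time k) => ka s; lra.
Qed.

(** A lower bound for the depth of the points which the ray visits just after
    [code_time k], once they are brought back by the prefix. *)
Definition thick_depth : R := expR (- 1) / (1 + 2 / code_gap P) ^+ 2.

Lemma thick_depth_gt0 : 0 < thick_depth.
Proof.
have g0 := code_gap_gt0 P.
by rewrite divr_gt0 ?expR_gt0 // exprn_gt0 // addr_gt0 // divr_gt0.
Qed.

(** The derivative of the inverse of the prefix at [xi] is [D ^ 2], and
    [den_prefix_su_a] prevents it from being much smaller at a distance of
    order [D ^- 2] from [xi]. The depth of the ray is there of order [D ^- 2],
    and is brought back to order [1]. *)
Lemma ray_near_orbit (xi : circle R) k (t : R) : x 0%N = \val xi ->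
  code_time k <= t <= code_time k + 1 ->
  thick_depth <= 1 - normc (act (su_inv (prefix P ls k))
                             (\val (diam_line xi t))) ^+ 2.
Proof.
move=> x0 /andP[t1 t2]; have t0 : 0 <= t := le_trans (code_time_ge0 k) t1.
set z := \val _; set g := prefix P ls k; set D := den g (x k).
have D0 : 0 < D := den_prefix_gt0 k.
have z1 : normc z <= 1 := disc_le1 _.
have g0 := code_gap_gt0 P.
have q1 : expR (- t) <= D ^- 2.
  by rewrite -expR_code_time ler_expR lerN2.
have q2 : expR (- 1) * D ^- 2 <= expR (- t).
  by rewrite -expR_code_time -expRD ler_expR -opprD lerN2 addrC.
have qle1 : expR (- t) <= 1 by rewrite -expR0 ler_expR oppr_le0.
have q0 := expR_gt0 (- t).
have dz : den (su_inv g) z <= (1 + 2 / code_gap P) / D.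
  have e1 : den (su_inv g) (\val xi) = D^-1.
    by rewrite -x0 -(act_prefix cod k) den_inv // (coding_le1 cod).
  have e2 : su_den (su_inv g) z = su_den (su_inv g) (\val xi) +
      (su_b (su_inv g))^* * (z - \val xi) by rewrite /su_den; ring.
  rewrite /den e2; apply: le_trans (ler_normcD _ _) _.
  rewrite -/(den _ _) e1 mulrDl mul1r lerD2l normcM normc_conj /= normcN.
  have bD : normc (su_b g) <= D / code_gap P.
    rewrite ler_pdivlMr //; apply: le_trans (den_prefix_su_a cod k).
    by rewrite ler_wpM2r ?(ltW g0) // ltW // su_b_lt_a.
  have zx : normc (z - \val xi) <= 2 * D ^- 2.
    rewrite normcB; apply: le_trans (diam_line_dist_le xi t) _.
    by rewrite ler_wpM2l.
  apply: le_trans (ler_pM (normc_ge0 _) (normc_ge0 _) bD zx) _.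
  rewrite le_eqVlt; apply/orP; left; apply/eqP; field.
  by rewrite !gt_eqF.
rewrite act_normB // ler_pdivlMr; last by rewrite exprn_gt0 // den_gt0.
apply: (@le_trans _ _ (thick_depth * ((1 + 2 / code_gap P) / D) ^+ 2)).
  rewrite ler_wpM2l ?(ltW thick_depth_gt0) // ler_sqr ?nnegrE ?den_ge0 //.
  by rewrite divr_ge0 ?(ltW D0) // addr_ge0 // divr_ge0 // ltW.
have -> : thick_depth * ((1 + 2 / code_gap P) / D) ^+ 2 = expR (- 1) * D ^- 2.
  have c0 : 1 + 2 / code_gap P != 0.
    by rewrite gt_eqF // addr_gt0 // divr_gt0.
  rewrite /thick_depth expr_div_n.
  move: (1 + 2 / code_gap P) c0 => c c0; field.
  by rewrite c0 gt_eqF.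
apply: le_trans q2 _; rewrite /z diam_line_depth ler_pdivlMr.
  have : (1 + expR (- t)) ^+ 2 <= 4 by rewrite expr2; nra.
  nra.
by rewrite exprn_gt0 // one_addexp_gt0.
Qed.

(** Each letter brings a definite time in a fixed compact set, so that
    divergence on average makes the mean time per letter unbounded; and this
    time is at most twice the logarithm of the weight, up to a constant. *)
Lemma diverging_heavy (xi : circle R) (M : R) : x 0%N = \val xi ->
  diverging_on_average G xi -> 0 <= M ->
  exists N : nat, forall k, (N <= k)%N ->
    expR (M * k%:R) <= \prod_(i < k) weight R (ls i).
Proof.
move=> x0 [_ div] M0.
have td := thick_depth_gt0.
have r1 : 1 - thick_depth / 2 < 1 by lra.
have [W cW WP] := compact_cover_lift
  (@generated_id _ _) (@generated_inv _ _) (@generated_comp _ _) group_matrix r1.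
pose c := diam_line xi; pose sigma t := pi (c t).
pose A : set R := [set t | W (sigma t)].
have Aint t k : code_time k <= t <= code_time k + 1 -> A t.
  move=> tk; have := ray_near_orbit x0 tk.
  have [g Gg mg] := in_group_inv (in_group_prefix real_h real_p ls k).
  rewrite -mg => near; apply: (WP _ g Gg).
  have n0 := normc_ge0 (\val (g (diam_line xi t))).
  have n1 := disc_le1 (g (diam_line xi t)).
  by rewrite -/c in near n0 n1 *; nra.
have lim := div sigma (ex_intro _ c (conj (diam_line_ray xi) (fun t _ => erefl))) W cW.
pose d := Num.min 1 (2 * ln (lam P)).
have l0 := ln_lam_gt0.
have d0 : 0 < d by rewrite lt_min ltr01 mulr_gt0.
pose K := 2 * (`|ln (den_up P)| + M) + 1.
have K0 : 0 < K by rewrite ltr_wpDl // mulr_ge0 // addr_ge0.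
have dK : 0 < d / K by rewrite divr_gt0.
have [T0 T0P] : exists T0 : R, forall T, T0 <= T -> 0 <= T ->
    T^-1 * (\int[lebesgue_measure]_(t in `[0, T]) \1_W (sigma t)) < d / K.
  have /cvgrPdist_lt/(_ _ dK) := lim; move=> [T0 [_ H]].
  exists (T0 + 1) => T TT T00; have := H T; rewrite sub0r normrN => /(_ _).
  have h1 : T0 < T by lra.
  by move=> /(_ h1); apply: le_lt_trans; exact: ler_norm.
pose N := (Num.truncn (`|T0| / (2 * ln (lam P)))).+1.
exists N => k Nk; rewrite leNgt; apply/negP => light.
have sk : 0 < code_time k.
  apply: lt_le_trans (code_time_ge k); rewrite mulr_gt0 ?mulr_gt0 // ltr0n.
  exact: leq_trans Nk.
have T0s : T0 <= code_time k.
  apply: le_trans (code_time_ge k); apply: le_trans (ler_norm _) _.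
  rewrite -ler_pdivrMr ?mulr_gt0 //.
  apply: (@le_trans _ _ N%:R); last by rewrite ler_nat.
  by rewrite ltW // truncnS_gt.
have := T0P _ T0s (ltW sk); apply/negP; rewrite -leNgt.
have low : k%:R * d <= \int[lebesgue_measure]_(t in `[0, code_time k]) \1_A t.
  apply: time_ge; rewrite ?code_time0 // ?(ltW d0) //.
    move=> i; apply: le_trans (code_time_step i); rewrite lerD2l.
    by rewrite ge_min lexx orbT.
  move=> i t /andP[t1 t2]; apply: (Aint t i); rewrite t1 (le_trans (ltW t2)) //.
  by rewrite lerD2l ge_min lexx.
have up : code_time k <= K * k%:R.
  apply: le_trans (code_time_le k) _; have k0 : 0 <= k%:R :> R by [].
  have lw : ln (\prod_(i < k) weight R (ls i)) <= M * k%:R.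
    rewrite -[leRHS]expRK ler_ln ?posrE ?expR_gt0 ?ltW //.
    by apply: prodr_gt0 => i _; exact: weight_gt0.
  have := ler_norm (ln (den_up P)); rewrite /K; nra.
rewrite [X in _ <= X]mulrC ler_pdivlMr // mulrAC ler_pdivrMr //.
have := ltW d0; move: low; rewrite /A.
set I := \int[_]_(_ in _) _; move=> low d00.
apply: (@le_trans _ _ (d * (K * k%:R))); first by rewrite ler_wpM2l.
have := ler_wpM2r (ltW K0) low; apply: le_trans.
by rewrite le_eqVlt; apply/orP; left; apply/eqP; ring.
Qed.

End Heavy.

(** * Sums over letters and words *)

Section Sums.
Variable R : realType.

Lemma ler_sum_uniq_sub (I : eqType) (s s' : seq I) (F : I -> R) :
  (forall i, 0 <= F i) -> uniq s -> {subset s <= s'} ->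
  \sum_(i <- s) F i <= \sum_(i <- s') F i.
Proof.
move=> F0; elim: s s' => [|i s IH] s' us sub.
  by rewrite big_nil sumr_ge0.
have is' : i \in s' by apply: sub; rewrite mem_head.
rewrite (perm_big _ (perm_to_rem is')) !big_cons lerD2l.
move: us => /= /andP[is_ us]; apply: IH => // j js.
have := sub j; rewrite in_cons js orbT => /(_ isT).
rewrite (perm_mem (perm_to_rem is')) in_cons => /orP[/eqP ji|//].
by move: is_; rewrite -ji js.
Qed.

Lemma geo_sum_le (r : R) k0 n : 0 <= r -> r < 1 ->
  \sum_(k <- iota k0 n) r ^+ k <= r ^+ k0 / (1 - r).
Proof.
move=> r0 r1; have r1' : 0 < 1 - r by rewrite subr_gt0.
rewrite ler_pdivlMr // mulr_suml.
elim: n k0 => [|n IH] k0; first by rewrite big_nil exprn_ge0.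
rewrite /= big_cons; apply: le_trans (lerD (lexx _) (IH k0.+1)) _.
by rewrite mulrBr mulr1 -exprSr subrK.
Qed.

Section Words.
Variables (L : eqType) (a : L -> R).
Hypothesis a0 : forall l, 0 <= a l.

Fixpoint words (s : seq L) k : seq (seq L) :=
  if k is k'.+1 then [seq l :: w | l <- s, w <- words s k'] else [:: [::]].

Lemma mem_words s w : all (mem s) w -> w \in words s (size w).
Proof.
elim: w => //= l w IH /andP[ls ws]; apply/allpairsP.
by exists (l, w); split => //; exact: IH.
Qed.

Lemma sum_words s k :
  \sum_(w <- words s k) \prod_(l <- w) a l = (\sum_(l <- s) a l) ^+ k.
Proof.
elim: k => [|k IH] /=; first by rewrite big_seq1 big_nil.
rewrite big_allpairs_dep exprS mulr_suml; apply: eq_bigr => l _.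
by rewrite -IH mulr_sumr; apply: eq_bigr => w _; rewrite big_cons.
Qed.

(** Long words contribute as little as the tail of a geometric series. *)
Lemma sum_long_words (r : R) k0 (ws : seq (seq L)) : r < 1 ->
  (forall s, uniq s -> \sum_(l <- s) a l <= r) -> uniq ws ->
  all (fun w => k0 <= size w)%N ws ->
  \sum_(w <- ws) \prod_(l <- w) a l <= r ^+ k0 / (1 - r).
Proof.
move=> r1 sr uws long.
have p0 (w : seq L) : 0 <= \prod_(l <- w) a l by rewrite prodr_ge0.
have r0 : 0 <= r by have := sr [::] isT; rewrite big_nil.
pose s := undup (flatten ws).
pose K := \max_(w <- ws) size w.
apply: le_trans (geo_sum_le k0 K.+1 r0 r1).
apply: (@le_trans _ _ (\sum_(w <- flatten [seq words s k | k <- iota k0 K.+1])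
   \prod_(l <- w) a l)).
  apply: ler_sum_uniq_sub => // w wws; apply/flatten_mapP; exists (size w).
    rewrite mem_iota (allP long w wws) /= addnS ltnS.
    by apply: leq_trans (leq_addl _ _); exact: leq_bigmax_seq.
  apply: mem_words; apply/allP => l lw; rewrite inE mem_undup.
  by apply/flattenP; exists w.
rewrite big_flatten big_map; apply: ler_sum => k _.
rewrite sum_words lerXn2r ?nnegrE ?sumr_ge0 //.
by apply: sr; exact: undup_uniq.
Qed.

End Words.

(** ** Power series over the integers *)

(** Comparison of a power with the increment of its primitive. *)
Lemma telescope_pow (b : R) (n : nat) : 0 < b ->
  b * expR (- (1 + b) * ln n.+2%:R) <=
  expR (- b * ln n.+1%:R) - expR (- b * ln n.+2%:R).
Proof.
move=> b0; have n1 : 0 < n.+1%:R :> R by [].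
have n2 : 0 < n.+2%:R :> R by [].
have lnle : ln n.+1%:R - ln n.+2%:R <= - n.+2%:R^-1 :> R.
  rewrite -ln_div ?posrE //.
  have -> : n.+1%:R / n.+2%:R = 1 + - n.+2%:R^-1 :> R.
    have -> : n.+1%:R = n.+2%:R - 1 :> R by rewrite -[n.+2%:R]natr1 addrK.
    by field; rewrite gt_eqF.
  by apply: le_ln1Dx; rewrite ltrN2 invf_lt1 // ltr1n.
have e1 : expR (- b * ln n.+1%:R) =
    expR (- b * ln n.+2%:R) * expR (- b * (ln n.+1%:R - ln n.+2%:R)) :> R.
  by rewrite -expRD; congr expR; ring.
have e2 : expR (- (1 + b) * ln n.+2%:R) =
    expR (- b * ln n.+2%:R) * n.+2%:R^-1 :> R.
  have -> : - (1 + b) * ln n.+2%:R = - b * ln n.+2%:R - ln n.+2%:R by ring.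
  by rewrite expRD expRN lnK.
rewrite e1 e2 mulrCA -{3}[expR (- b * ln n.+2%:R)]mulr1 -mulrBr.
rewrite ler_wpM2l ?expR_ge0 // lerBrDl.
apply: le_trans (expR_ge1Dx _); rewrite lerD2l.
by rewrite mulNr -mulrN ler_wpM2l ?(ltW b0) // lerNr.
Qed.

Lemma sum_pow_nat (b : R) N : 0 < b ->
  \sum_(n < N) expR (- (1 + b) * ln n.+1%:R) <= 1 + b^-1.
Proof.
move=> b0; case: N => [|N].
  by rewrite big_ord0 addr_ge0 // invr_ge0 ltW.
rewrite big_ord_recl /= ln1 mulr0 expR0 lerD2l.
suff : b * \sum_(i < N) expR (- (1 + b) * ln i.+2%:R) <=
    1 - expR (- b * ln N.+1%:R).
  move=> h; rewrite -[leRHS]mul1r ler_pdivlMr // mulrC.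
  by apply: le_trans h _; rewrite gerBl expR_ge0.
elim: N => [|N IH]; first by rewrite big_ord0 mulr0 ln1 mulr0 expR0 subrr.
rewrite big_ord_recr /= mulrDr.
by have := telescope_pow N b0; lra.
Qed.

Lemma sum_pow_int (b : R) (s : seq int) : 0 < b -> uniq s ->
  \sum_(n <- s) expR (- (1 + b) * ln (1 + `|n%:~R|)) <= 2 * (1 + b^-1).
Proof.
move=> b0 us.
pose f (n : nat) : R := expR (- (1 + b) * ln n.+1%:R).
have f0 n : 0 <= f n by exact: expR_ge0.
have half (t : seq int) : uniq t -> {in t &, injective absz} ->
    \sum_(n <- t) expR (- (1 + b) * ln (1 + `|n%:~R|)) <= 1 + b^-1.
  move=> ut inj; have -> : \sum_(n <- t) expR (- (1 + b) * ln (1 + `|n%:~R|)) =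
      \sum_(j <- map absz t) f j.
    rewrite big_map; apply: eq_bigr => n _; rewrite /f.
    have -> : 1 + `|n%:~R| = (absz n).+1%:R :> R.
      by rewrite -intr_norm -abszE -natr1 addrC.
    done.
  pose N := \max_(j <- map absz t) j.
  apply: le_trans (sum_pow_nat N.+1 b0).
  rewrite -(big_mkord xpredT f) /index_iota subn0.
  apply: ler_sum_uniq_sub => //; first by rewrite map_inj_in_uniq.
  by move=> j jt; rewrite mem_iota add0n ltnS; exact: leq_bigmax_seq.
rewrite (bigID (fun n : int => 0 <= n)) /= mulr2n mulrDl mul1r.
rewrite -big_filter -[X in _ + X <= _]big_filter.
apply: lerD; apply: half; rewrite ?filter_uniq //.
  move=> m n; rewrite !mem_filter => /andP[m0 _] /andP[n0 _] e.
  by rewrite -[m]gez0_abs // -[n]gez0_abs // e.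
move=> m n; rewrite !mem_filter -!ltNge => /andP[m0 _] /andP[n0 _] e.
by apply: oppr_inj; rewrite -!ltz0_abs // e.
Qed.

End Sums.

(** * Hausdorff measures *)

Section HausdorffBounds.
Context {R : realType} {X : Type} (dist : X -> X -> R).
Hypothesis dist_xx : forall x, dist x x = 0.
Hypothesis dist_ge0 : forall x y, 0 <= dist x y.
Local Open Scope ereal_scope.

Lemma diameter_set0 : diameter dist set0 = -oo.
Proof.
rewrite /diameter; have -> : set0 `*` set0 = set0 :> set (X * X).
  by rewrite setX0.
by rewrite image_set0 ereal_sup0.
Qed.

Lemma diameter_ge0 (U : set X) : U !=set0 -> 0 <= diameter dist U.
Proof.
move=> [x Ux]; apply: ereal_sup_ubound; exists (x, x); first by split.
by rewrite /= dist_xx.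
Qed.

Lemma diameter_le (U : set X) (b : R) :
  (forall u v, U u -> U v -> (dist u v <= b)%R) -> diameter dist U <= b%:E.
Proof.
by move=> Ub; apply: ge_ereal_sup => _ [[u v] [/= Uu Uv] <-]; rewrite lee_fin Ub.
Qed.

Lemma poweR_diameter_ge0 (U : set X) (s : R) : 0 <= poweR (diameter dist U) s.
Proof.
rewrite /poweR; case: (diameter dist U) => [r| |].
- by rewrite lee_fin powR_ge0.
- by case: ifP.
- by case: ifP => _; rewrite ?lee_fin ?ler01.
Qed.

Lemma poweR_diameter_le (U : set X) (s b : R) : (0 < s)%R -> (0 <= b)%R ->
  (forall u v, U u -> U v -> (dist u v <= b)%R) ->
  poweR (diameter dist U) s <= (b `^ s)%:E.
Proof.
move=> s0 b0 Ub; have [->|/set0P U0] := eqVneq U set0.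
  by rewrite diameter_set0 /= gt_eqF // lee_fin powR_ge0.
have := diameter_ge0 U0; have := diameter_le Ub.
case: (diameter dist U) => [r| |] //; rewrite !lee_fin => rb r0 /=.
by apply: ge0_ler_powR; rewrite ?nnegrE // ltW.
Qed.

Lemma hausdorff_measure_null (s : R) (A : set X) : (0 < s)%R ->
  (forall e d : R, (0 < e)%R -> (0 < d)%R ->
    exists (U : nat -> set X) (b : nat -> R), [/\ A `<=` \bigcup_i U i,
      forall i, (0 <= b i <= d)%R,
      forall i u v, U i u -> U i v -> (dist u v <= b i)%R &
      forall n, (\sum_(i < n) b i `^ s <= e)%R]) ->
  hausdorff_measure dist s A = 0.
Proof.
move=> s0 cover.
have content d : (0 < d)%R -> hausdorff_content dist s d A = 0.
  move=> d0; apply/eqP; rewrite eq_le; apply/andP; split; last first.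
    apply: le_ereal_inf_tmp => _ [U [_ _] <-].
    by apply: nneseries_ge0 => i _ _; exact: poweR_diameter_ge0.
  apply/lee_addgt0Pr => e e0; rewrite add0e.
  have [U [b [AU bd Ub sum]]] := cover e d e0 d0.
  apply: ge_ereal_inf; exists (\sum_(0 <= i <oo) (poweR (diameter dist (U i)) s)).
    exists U => //; split => // i; apply: le_trans (diameter_le (Ub i)) _.
    by rewrite lee_fin; case/andP: (bd i).
  apply: lime_le.
    by apply: is_cvg_nneseries => i _ _; exact: poweR_diameter_ge0.
  apply: nearW => n.
  apply: (@le_trans _ _ (\sum_(0 <= i < n) (b i `^ s)%:E)).
    apply: lee_sum => i _; apply: poweR_diameter_le => //; last exact: Ub.
    by case/andP: (bd i).
  by rewrite sumEFin lee_fin big_mkord.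
apply/eqP; rewrite eq_le; apply/andP; split.
  by apply: ge_ereal_sup => _ [d /= d0 <-]; rewrite content.
apply: ereal_sup_ubound; exists 1%R; first exact: ltr01.
exact: content ltr01.
Qed.

Lemma hausdorff_dim_le (A : set X) (s0 : R) : (0 <= s0)%R ->
  (forall s, (s0 < s)%R -> hausdorff_measure dist s A = 0) ->
  hausdorff_dim dist A <= s0%:E.
Proof.
move=> s00 h; apply/lee_addgt0Pr => e e0; apply: ge_ereal_inf.
exists (s0 + e)%:E => //; exists (s0 + e)%R => //; split => /=; first by lra.
by apply: h; rewrite ltrDl.
Qed.

(** The parameters of the points of a set of diameter [d] lie in an interval
    of length [2 * K * d `^ s]; a cover of [A] yields a cover of [0, 1), of
    total length at least [1]. *)
Lemma hausdorff_measure_holder (s K : R) (A : set X) (f : R -> X) :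
  (0 < s)%R -> (0 < K)%R ->
  (forall t, (0 <= t < 1)%R -> A (f t)) ->
  (forall t u, (0 <= t < 1)%R -> (0 <= u < 1)%R ->
    (`|t - u| <= K * dist (f t) (f u) `^ s)%R) ->
  hausdorff_measure dist s A != 0.
Proof.
move=> s0 K0 fA holder; rewrite gt_eqF //.
have : (2 * K)^-1%:E <= hausdorff_content dist s 1 A.
  apply: le_ereal_inf_tmp => _ [U [AU Ud] <-].
  pose mu := @lebesgue_measure R.
  have J i : exists J : set R, [/\ measurable J,
      (forall t, (0 <= t < 1)%R -> U i (f t) -> J t) &
      mu J <= (2 * K)%:E * poweR (diameter dist (U i)) s].
    have [no|/contrapT[t0 [t01 Ut0]]] := pselect (~ exists t,
        (0 <= t < 1)%R /\ U i (f t)).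
      exists set0; split => // [t t01 Ut|]; first by apply: no; exists t.
      have -> : mu set0 = 0 by exact: measure0.
      by rewrite mule_ge0 ?poweR_diameter_ge0 // lee_fin mulr_ge0 // ltW.
    have dge : 0 <= diameter dist (U i) by apply: diameter_ge0; exists (f t0).
    have [d dE] : exists d : R, diameter dist (U i) = d%:E.
      by have := Ud i; move: dge; case: diameter => // r _ _; exists r.
    have d0 : (0 <= d)%R by rewrite -lee_fin -dE.
    exists `[(t0 - K * d `^ s)%R, (t0 + K * d `^ s)%R]%classic; split => //.
      move=> t t01' Ut; rewrite /= in_itv /=.
      have : (`|t - t0| <= K * d `^ s)%R.
        apply: le_trans (holder _ _ t01' t01) _; rewrite ler_pM2l //.
        have du : (dist (f t) (f t0) <= d)%R.
          by rewrite -lee_fin -dE; apply: ereal_sup_ubound; exists (f t, f t0).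
        by apply: ge0_ler_powR; rewrite ?nnegrE // ltW.
      by rewrite ler_norml; move: (K * _)%R => L; lra.
    have L0 : (0 <= K * d `^ s)%R by rewrite mulr_ge0 ?powR_ge0 // ltW.
    rewrite /mu lebesgue_measure_itv /= lte_fin dE /=; case: ltP => [_|_].
      by rewrite -EFinB -EFinM lee_fin; move: (d `^ s)%R L0 => L; nra.
    by rewrite -EFinM lee_fin -mulrA mulr_ge0.
  have /choice[Jf JP] := J.
  have mJ i : measurable (Jf i) by case: (JP i).
  have cov : `[0%R, 1%R[%classic `<=` \bigcup_i Jf i.
    move=> t; rewrite /= in_itv /= => t01; have [i _ Ui] := AU _ (fA t t01).
    by exists i => //; have [_ h _] := JP i; exact: h.
  have mu1 : mu `[0%R, 1%R[%classic = 1%:E.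
    by rewrite /mu lebesgue_measure_itv /= lte_fin ltr01 sube0.
  have := measure_sigma_subadditive mu mJ (measurable_itv `[0%R, 1%R[) cov.
  rewrite -[X in X <= _]/(mu `[0%R, 1%R[%classic) mu1 => h.
  have h2 : 1%:E <= (2 * K)%:E * \sum_(0 <= i <oo) poweR (diameter dist (U i)) s.
    apply: le_trans h _; rewrite -nneseriesZl; last first.
      by move=> i _; exact: poweR_diameter_ge0.
    by apply: lee_nneseries => // i _; case: (JP i).
  have K2 : (0 < 2 * K)%R by rewrite mulr_gt0.
  by rewrite -[X in X <= _]mule1 lee_pdivrMl.
move=> h; apply: lt_le_trans (_ : (2 * K)^-1%:E <= _).
  by rewrite lte_fin invr_gt0 mulr_gt0.
apply: le_trans h _; apply: ereal_sup_ubound; exists 1%R => //=.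
Qed.

End HausdorffBounds.

(** * The upper bound *)

Section UpperBound.
Variables (R : realType) (P : pingpong R) (h p : disc R -> disc R).
Hypothesis real_h : realizes (hy P) h.
Hypothesis real_p : realizes (par (pq P) 1) p.
Local Notation G := (generated [set h; p]).
Implicit Types (w : seq letter) (l : letter).

Lemma prod_weight_mkseq ls k :
  \prod_(l <- mkseq ls k) weight R l = \prod_(i < k) weight R (ls i).
Proof.
rewrite /mkseq big_map -(big_mkord xpredT (fun i => weight R (ls i))).
by rewrite /index_iota subn0.
Qed.

(** A limit point belongs to cylinders of all sizes, or is a cusp
    ([limit_coding]). *)
Definition cylinder w : set (circle R) :=
  [set xi | exists ls x, [/\ coding P ls x, x 0%N = \val xi &
    mkseq ls (size w) = w]].

Definition cusp w : set (circle R) :=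
  [set xi | exists2 ls, mkseq ls (size w) = w &
    \val xi = act (prefix P ls (size w)) (pfix (pq P))].

Lemma eq_prefix_mkseq ls ls' k : mkseq ls k = mkseq ls' k ->
  prefix P ls k = prefix P ls' k.
Proof.
move=> e; apply: eq_prefix => i ik.
by have := congr1 (nth (0, true) ^~ i) e; rewrite !nth_mkseq.
Qed.

Lemma cusp_dist w xi zeta : cusp w xi -> cusp w zeta -> visual_dist xi zeta = 0.
Proof.
move=> [ls lw e] [ls' lw' e']; rewrite visual_distE e e'.
by rewrite (@eq_prefix_mkseq ls' ls) ?lw ?lw' // subrr normc0 mul0r.
Qed.

Definition cylinder_size w : R :=
  expR (- 2 * ((size w)%:R * ln (den_low P) + ln (\prod_(l <- w) weight R l))).

(** Two points of the cylinder are images of points of the circle by the same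
    prefix, of which [den_prefix_ge] bounds both derivatives. *)
Lemma cylinder_dist w xi zeta : cylinder w xi -> cylinder w zeta ->
  visual_dist xi zeta <= cylinder_size w.
Proof.
move=> [ls [x [cx x0 lw]]] [ls' [y [cy y0 lw']]].
have wp : 0 < \prod_(l <- w) weight R l.
  by rewrite big_seq; apply: prodr_gt0 => l _; exact: weight_gt0.
have c0 := den_low_gt0 P.
pose B := den_low P ^+ size w * \prod_(l <- w) weight R l.
have B0 : 0 < B by rewrite mulr_gt0 // exprn_gt0.
have sizeE : cylinder_size w = B ^- 2.
  have lnB : ln B =
      (size w)%:R * ln (den_low P) + ln (\prod_(l <- w) weight R l).
    by rewrite /B lnM ?posrE ?exprn_gt0 // lnXn // [in RHS]mulr_natl.
  by rewrite /cylinder_size mulNr expRN -lnB expR_2ln.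
rewrite visual_distE -x0 -y0 -(act_prefix cx (size w)) -(act_prefix cy (size w)).
rewrite (@eq_prefix_mkseq ls' ls) ?lw ?lw' //.
rewrite act_dist ?(coding_le1 cx) ?(coding_le1 cy) // sizeE.
have dx : B <= den (prefix P ls (size w)) (x (size w)).
  by have := den_prefix_ge cx (size w); rewrite -prod_weight_mkseq lw.
have dy : B <= den (prefix P ls (size w)) (y (size w)).
  have := den_prefix_ge cy (size w); rewrite -prod_weight_mkseq lw'.
  by rewrite (@eq_prefix_mkseq ls' ls) ?lw ?lw'.
rewrite ler_pdivrMr // ler_pdivrMr; last first.
  by rewrite mulr_gt0 // ?(lt_le_trans B0 dx) ?(lt_le_trans B0 dy).
have d2 : normc (x (size w) - y (size w)) <= 2.
  apply: le_trans (ler_normcB _ _) _.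
  by rewrite (coding_circle cx) (coding_circle cy).
apply: le_trans d2 _.
have BB : B ^+ 2 <= den (prefix P ls (size w)) (x (size w)) *
    den (prefix P ls (size w)) (y (size w)).
  by rewrite expr2 ler_pM // ltW.
rewrite mulrAC ler_peMl // mulrC ler_pdivlMr ?mul1r // exprn_gt0 //.
Qed.

Section Exponent.
Variable b : R.
Hypothesis b0 : 0 < b.
Local Notation s := (2^-1 + b).

(* The sum over the letters is at most [4 * (1 + b^-1)], times the ratio; the
   choice of [M] makes the product at most [2^-1]. *)
Let Q : R := `| - (2 * s) * ln (den_low P) + ln (8 * (1 + b^-1))|.
Let M : R := Q / b.
Let ratio : R := expR (- (2 * s) * ln (den_low P) - b * M).

(** Of the exponent [2 * s = 1 + 2 * b] of the weight, [1 + b] keeps the sum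
    over the letters finite. In a heavy word the remaining [b] is worth a
    factor [expR (- b * M)] per letter, which makes that sum as small as
    needed. *)
Definition letter_cost l : R :=
  expR (- (2 * s) * ln (den_low P) - b * M) *
  expR (- (1 + b) * ln (weight R l)).

Lemma letter_cost_ge0 l : 0 <= letter_cost l.
Proof. by rewrite mulr_ge0 ?expR_ge0. Qed.

Lemma sum_letter_cost (ls : seq letter) : uniq ls ->
  \sum_(l <- ls) letter_cost l <= 2^-1.
Proof.
move=> uls; have c0 : 0 < 1 + b^-1 by rewrite addr_gt0 // invr_gt0.
have ratio_le : ratio * (4 * (1 + b^-1)) <= 2^-1.
  have -> : 4 * (1 + b^-1) = 2^-1 * (8 * (1 + b^-1)) by field; rewrite gt_eqF.
  rewrite mulrCA ler_piMr //.
  rewrite -[X in _ * X]lnK ?posrE ?mulr_gt0 // -expRD -[leRHS]expR0 ler_expR.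
  have -> : b * M = Q by rewrite /M mulrC divfK // gt_eqF.
  by rewrite addrAC subr_le0; exact: ler_norm.
rewrite -mulr_sumr; apply: le_trans ratio_le; rewrite ler_wpM2l ?expR_ge0 //.
have half (e : bool) (t : seq letter) : uniq t -> all (fun l => l.2 == e) t ->
    \sum_(l <- t) expR (- (1 + b) * ln (weight R l)) <= 2 * (1 + b^-1).
  move=> ut te; have -> : \sum_(l <- t) expR (- (1 + b) * ln (weight R l)) =
     \sum_(n <- map fst t) expR (- (1 + b) * ln (1 + `|n%:~R|)).
    by rewrite big_map.
  apply: sum_pow_int => //; rewrite map_inj_in_uniq // => -[n1 e1] [n2 e2].
  by move=> /(allP te)/eqP /= -> /(allP te)/eqP /= -> ->.
rewrite (bigID (fun l => l.2)) /=.
rewrite -big_filter -[X in _ + X <= _]big_filter.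
have -> : 4 * (1 + b^-1) = 2 * (1 + b^-1) + 2 * (1 + b^-1) by ring.
apply: lerD.
  apply: (half true); first exact: filter_uniq.
  by apply/allP => l; rewrite mem_filter => /andP[-> _].
apply: (half false); first exact: filter_uniq.
by apply/allP => l; rewrite mem_filter => /andP[/negbTE -> _].
Qed.

Definition heavy w := expR (M * (size w)%:R) <= \prod_(l <- w) weight R l.

(** The factors [expR (- b * M)] are paid by the excess of weight. *)
Lemma heavy_cost w : heavy w ->
  cylinder_size w `^ s <= \prod_(l <- w) letter_cost l.
Proof.
have wp (t : seq letter) : 0 < \prod_(l <- t) weight R l.
  by rewrite big_seq; apply: prodr_gt0 => l _; exact: weight_gt0.
have -> : \prod_(l <- w) letter_cost l =
    expR ((size w)%:R * (- (2 * s) * ln (den_low P) - b * M)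
      - (1 + b) * ln (\prod_(l <- w) weight R l)).
  elim: w => [|l w IH]; first by rewrite !big_nil /= mul0r ln1 mulr0 subr0 expR0.
  rewrite !big_cons IH /letter_cost -!expRD; congr expR.
  rewrite lnM ?posrE ?weight_gt0 //= -natr1.
  ring.
rewrite /heavy => hw.
have lw : M * (size w)%:R <= ln (\prod_(l <- w) weight R l).
  by rewrite -[leLHS]expRK ler_ln ?posrE ?expR_gt0.
rewrite /cylinder_size /powR gt_eqF ?expR_gt0 // expRK ler_expR.
move: (ln (\prod_(l <- w) _)) (ln (den_low P)) lw => W c lw.
have hb : b * (M * (size w)%:R) <= b * W by rewrite ler_wpM2l // ltW.
move: (size w)%:R hb => k hb.
rewrite -subr_ge0; have -> : k * (- (2 * s) * c - b * M) - (1 + b) * W -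
  s * (- 2 * (k * c + W)) = b * W - b * (M * k) by field.
by rewrite subr_ge0.
Qed.

Lemma diverging_measure_null :
  hausdorff_measure (@visual_dist R) s (diverging_on_average G) = 0.
Proof.
have s0 : 0 < s by rewrite addr_gt0.
apply: hausdorff_measure_null => //.
  by move=> xi; rewrite visual_distE subrr normc0 mul0r.
move=> e d e0 d0.
have [k0 [k0e k0d]] : exists k0 : nat, (2^-1 : R) ^+ k0 <= e / 2 /\
    (2^-1 : R) ^+ k0 <= d `^ s.
  have half1 : `|2^-1 : R| < 1 by rewrite ger0_norm ?invr_ge0 // invf_lt1 // ltr1n.
  have m0 : 0 < Num.min (e / 2) (d `^ s).
    by rewrite lt_min divr_gt0 //= powR_gt0.
  have /cvgrPdist_lt/(_ _ m0)/filter_ex[k0] := cvg_expr half1.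
  rewrite sub0r normrN ger0_norm ?exprn_ge0 ?invr_ge0 // lt_min => /andP[h1 h2].
  by exists k0; split; apply: ltW.
(* Heavy cylinders of words that are long enough, and all the cusps, which
   have diameter zero. *)
pose good w := (k0 <= size w)%N && heavy w.
pose V (x : bool * seq letter) : set (circle R) :=
  if x.1 then (if good x.2 then cylinder x.2 else set0) else cusp x.2.
pose B (x : bool * seq letter) : R :=
  if x.1 && good x.2 then cylinder_size x.2 else 0.
pose dec : nat -> option (bool * seq letter) := pickle_inv.
have M0 : 0 <= M by rewrite divr_ge0 ?(ltW b0) ?normr_ge0.
have cost_le w : good w -> cylinder_size w <= d.
  move=> /andP[kw hw]; rewrite leNgt; apply/negP => dw.
  have : d `^ s < cylinder_size w `^ s.
    by apply: gt0_ltr_powR; rewrite ?nnegrE ?expR_ge0 // ltW.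
  apply/negP; rewrite -leNgt; apply: le_trans (heavy_cost hw) _.
  apply: le_trans k0d.
  apply: (@le_trans _ _ ((2^-1) ^+ size w)); last first.
    by rewrite ler_wiXn2l // ?invr_ge0 // invf_le1 // ler1n.
  elim: w {kw hw dw} => [|l w IH]; first by rewrite big_nil expr0.
  rewrite big_cons exprS ler_pM ?letter_cost_ge0 //.
    by apply: prodr_ge0 => ? _; exact: letter_cost_ge0.
  by have := @sum_letter_cost [:: l] isT; rewrite big_seq1.
exists (fun i => oapp V set0 (dec i)), (fun i => oapp B 0 (dec i)); split.
- move=> xi Dxi; have [lxi _] := Dxi.
  have sel x : V x xi -> (\bigcup_i oapp V set0 (dec i)) xi.
    by move=> Vx; exists (pickle x) => //; rewrite /dec pickleK_inv.
  have [[ls [k xiE]]|[ls [x [cx x0]]]] :=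
      limit_coding real_h real_p (circle_eq1 xi) lxi.
    apply: (sel (false, mkseq ls k)); exists ls; rewrite size_mkseq //.
  have [N NP] := diverging_heavy real_h real_p cx x0 Dxi M0.
  pose k := maxn N k0; apply: (sel (true, mkseq ls k)); rewrite /V /=.
  have -> : good (mkseq ls k).
    by rewrite /good /heavy size_mkseq prod_weight_mkseq leq_maxr NP // leq_maxl.
  by exists ls, x; split; rewrite ?size_mkseq.
- move=> i; case: (dec i) => [[[] w]|] /=; rewrite ?lexx ?(ltW d0) // /B /=.
  case: ifPn => [gw|_]; last by rewrite lexx ltW.
  by rewrite expR_ge0 cost_le.
- move=> i xi zeta; case: (dec i) => [[[] w]|] //=; rewrite /V /B /=.
    by case: ifPn => // _; exact: cylinder_dist.
  by move=> c1 c2; rewrite (cusp_dist c1 c2).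
move=> n; pose xs := pmap dec (iota 0 n).
have uxs : uniq xs.
  by apply: (pmap_uniq (@pickle_invK (bool * seq letter)%type)); exact: iota_uniq.
have -> : \sum_(i < n) oapp B 0 (dec i) `^ s = \sum_(x <- xs) B x `^ s.
  rewrite -(big_mkord xpredT (fun i => oapp B 0 (dec i) `^ s)) /index_iota subn0.
  rewrite /xs; elim: (iota 0 n) => [|i t IH]; first by rewrite !big_nil.
  rewrite big_cons IH /=; case: (dec i) => [x|] /=; first by rewrite big_cons.
  by rewrite powR0 ?gt_eqF // add0r.
pose ws := [seq x.2 | x <- xs & x.1 && good x.2].
apply: (@le_trans _ _ (\sum_(w <- ws) \prod_(l <- w) letter_cost l)).
  rewrite big_map big_filter [leRHS]big_mkcond /=; apply: ler_sum => x _.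
  rewrite /B; case: ifPn => [/andP[_ /andP[_ hw]]|_]; first exact: heavy_cost.
  by rewrite powR0 // gt_eqF.
have half1 : 2^-1 < 1 :> R by rewrite invf_lt1 // ltr1n.
apply: le_trans (sum_long_words (k0 := k0) letter_cost_ge0 half1 sum_letter_cost _ _) _.
- rewrite map_inj_in_uniq ?filter_uniq // => -[b1 w1] [b2 w2].
  by rewrite !mem_filter => /andP[/andP[/= -> _] _] /andP[/andP[/= -> _] _] ->.
- apply/allP => w /mapP[x]; rewrite mem_filter => /andP[/andP[_ /andP[kx _]] _].
  by move=> ->.
have -> : 1 - 2^-1 = 2^-1 :> R by field.
by rewrite invrK -ler_pdivlMr.
Qed.

End Exponent.

Lemma diverging_dim_le :
  (hausdorff_dim (@visual_dist R) (diverging_on_average G) <= (2^-1)%:E)%E.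
Proof.
apply: hausdorff_dim_le => // s sb.
have b0 : 0 < s - 2^-1 by rewrite subr_gt0.
by have := diverging_measure_null b0; rewrite addrCA subrr addr0.
Qed.

End UpperBound.

(** * Points with a prescribed coding *)

Section Completeness.
Variable R : realType.

Lemma real_geometric_cvg (v : nat -> R) (r : R) : 0 <= r -> r < 1 ->
  (forall k, `|v k.+1 - v k| <= r ^+ k) -> exists l : R, v k @[k --> \oo] --> l.
Proof.
move=> r0 r1 vr.
have c : cvgn (series (fun k => v k.+1 - v k)).
  apply: normed_cvg; apply: (@series_le_cvg _ _ (geometric 1 r)).
  - by move=> k; exact: normr_ge0.
  - by move=> k; rewrite /geometric /= mul1r exprn_ge0.
  - by move=> k; rewrite /geometric /= mul1r.
  - by apply: is_cvg_geometric_series; rewrite ger0_norm.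
exists (v 0%N + limn (series (fun k => v k.+1 - v k))).
have vE k : v k = v 0%N + series (fun k => v k.+1 - v k) k.
  by rewrite seriesEnat /= telescope_sumr // addrC subrK.
under eq_cvg do rewrite vE.
by apply: cvgD; [exact: cvg_cst|exact: c].
Qed.

Lemma plane_geometric_cvg (u : nat -> R[i]) (r : R) : 0 <= r -> r < 1 ->
  (forall k, normc (u k.+1 - u k) <= r ^+ k) ->
  exists z : R[i], u k @[k --> \oo] --> z.
Proof.
move=> r0 r1 ur.
have [a ca] : exists a : R, complex.Re (u k) @[k --> \oo] --> a.
  apply: (real_geometric_cvg r0 r1) => k.
  by rewrite -raddfB; apply: le_trans (normc_Re _) (ur k).
have [b cb] : exists b : R, complex.Im (u k) @[k --> \oo] --> b.
  apply: (real_geometric_cvg r0 r1) => k.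
  by rewrite -raddfB; apply: le_trans (normc_Im _) (ur k).
exists (a +i* b); apply/cvg_normcP => e e0; have e2 : 0 < e / 2 by rewrite divr_gt0.
have /cvgrPdist_lt/(_ _ e2) ha := ca; have /cvgrPdist_lt/(_ _ e2) hb := cb.
near=> k; apply: le_lt_trans (normc_le_ReIm _) _.
have -> : complex.Re ((a +i* b) - u k) = a - complex.Re (u k) by case: (u k).
have -> : complex.Im ((a +i* b) - u k) = b - complex.Im (u k) by case: (u k).
have : `|a - complex.Re (u k)| < e / 2 by near: k.
have : `|b - complex.Im (u k)| < e / 2 by near: k.
lra.
Unshelve. all: by end_near. Qed.

End Completeness.

Section PrescribedCoding.
Variables (R : realType) (P : pingpong R) (ls : nat -> letter).
Hypothesis ls_neq0 : forall i, (ls i).1 != 0.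

(** The images of the origin under the factors of the word. They satisfy the
    estimates of the tails and converge to them. *)
Fixpoint approx i k : R[i] :=
  if k is k'.+1 then act (block P (ls i)) (approx i.+1 k') else 0.

Lemma approx0 i : approx i 0 = 0.
Proof. by []. Qed.

Lemma approxS i k : approx i k.+1 = act (block P (ls i)) (approx i.+1 k).
Proof. by []. Qed.

Lemma approx_lt1 i k : normc (approx i k) < 1.
Proof.
by elim: k i => [|k IH] i; [rewrite approx0 normc0|exact: act_lt1].
Qed.

Lemma approx_le1 i k : normc (approx i k) <= 1.
Proof. exact: ltW (approx_lt1 i k). Qed.

Lemma approx_escape e i k : escape P e (approx i k).
Proof.
elim: k e i => [|k IH] e i; first exact: escape_0.
by apply: block_escape => //; exact: approx_le1.
Qed.

Lemma lamV2_lt1 : (lam P) ^- 2 < 1.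
Proof. by rewrite invf_lt1 ?exprn_gt0 ?lam_gt0 // exprn_egt1 // lam_gt1. Qed.

Lemma lamV2_ge0 : 0 <= (lam P) ^- 2.
Proof. by rewrite invr_ge0 sqr_ge0. Qed.

Lemma approx_contract i x y : normc x <= 1 -> normc y <= 1 ->
  escape P (ls i).2 x -> escape P (ls i).2 y ->
  normc (act (block P (ls i)) x - act (block P (ls i)) y) <=
    (lam P) ^- 2 * normc (x - y).
Proof.
move=> x1 y1 ex ey; rewrite act_dist // mulrC ler_wpM2r ?normc_ge0 //.
rewrite lef_pV2 ?posrE ?exprn_gt0 ?lam_gt0 ?mulr_gt0 ?den_gt0 // expr2.
by rewrite ler_pM ?block_den_ge_lam // ltW // lam_gt0.
Qed.

Lemma approx_step i k : normc (approx i k.+1 - approx i k) <= ((lam P) ^- 2) ^+ k.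
Proof.
elim: k i => [|k IH] i.
  by rewrite approx0 subr0 expr0 approx_le1.
rewrite exprS; apply: le_trans (ler_wpM2l lamV2_ge0 (IH i.+1)).
exact: (approx_contract (approx_le1 _ _) (approx_le1 _ _)
  (approx_escape _ _ k.+1) (approx_escape _ _ k)).
Qed.

Lemma approx_depth i k : 1 - normc (approx i k) ^+ 2 <= ((lam P) ^- 2) ^+ k.
Proof.
elim: k i => [|k IH] i; first by rewrite approx0 normc0 expr0n subr0 expr0.
rewrite approxS act_normB ?approx_le1 // [leRHS]exprS [leRHS]mulrC.
have d0 := den_gt0 (block P (ls i)) (approx_le1 i.+1 k).
rewrite ler_pM ?invr_ge0 ?sqr_ge0 //.
  by rewrite subr_ge0 expr_le1 ?normc_ge0 ?approx_le1.
rewrite lef_pV2 ?posrE ?exprn_gt0 ?lam_gt0 // ler_sqr ?nnegrE ?den_ge0 //.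
  exact: (block_den_ge_lam (approx_le1 _ _) (approx_escape _ _ _)).
exact: ltW (lam_gt0 P).
Qed.

Lemma act_prefix_approx j k :
  act (prefix P ls j) (approx j k) = approx 0 (j + k).
Proof.
elim: j k => [|j IH] k /=; first by rewrite act_one.
by rewrite act_mul ?approx_le1 // -approxS IH addnS.
Qed.

(** Since no power is zero, the tails escape both hyperbolic letters. *)
Lemma coding_exists : exists x, [/\ coding P ls x,
  forall e i, escape P e (x i) & approx 0 k @[k --> \oo] --> x 0%N].
Proof.
have c i : exists z : R[i], approx i k @[k --> \oo] --> z.
  exact: (plane_geometric_cvg lamV2_ge0 lamV2_lt1 (approx_step i)).
have [x xP] := choice c; exists x.
have x1 i : normc (x i) = 1.
  have n2 : 1 - normc (approx i k) ^+ 2 @[k --> \oo] --> 1 - normc (x i) ^+ 2.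
    apply: cvgB; first exact: cvg_cst.
    rewrite expr2; under eq_cvg do rewrite expr2.
    by apply: cvgM; apply: cvg_normc; exact: xP.
  have p0 : ((lam P) ^- 2) ^+ k @[k --> \oo] --> (0 : R).
    by apply: cvg_expr; rewrite ger0_norm ?lamV2_ge0 ?lamV2_lt1.
  have h0 : 1 - normc (x i) ^+ 2 = 0.
    apply: real_cvg_unique n2 _; apply: (squeeze_cvgr _ (cvg_cst 0) p0).
    apply: nearW => k; rewrite approx_depth andbT subr_ge0.
    by rewrite expr_le1 ?normc_ge0 ?approx_le1.
  by apply/eqP; rewrite -(@eqrXn2 _ 2) ?normc_ge0 // expr1n; lra.
have x1' i : normc (x i) <= 1 by rewrite x1.
have ex e i : escape P e (x i).
  rewrite /escape.
  have cd := cvg_den (m := signed (hy P) e) (xP i).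
  by apply: (cvgr_to_ge cd); apply: nearW => k; exact: approx_escape.
split; [|exact: ex|exact: xP]; split => // i.
have s1 : approx i k.+1 @[k --> \oo] --> act (block P (ls i)) (x i.+1).
  by apply: act_continuous => // k; exact: approx_le1.
have s2 : approx i k.+1 @[k --> \oo] --> x i.
  by have := xP i; rewrite -(cvg_shiftS (approx i)).
exact: (cvg_unique (@norm_hausdorff _ _) s2 s1).
Qed.

Variables (h p : disc R -> disc R).
Hypothesis real_h : realizes (hy P) h.
Hypothesis real_p : realizes (par (pq P) 1) p.

Lemma prescribed_point : exists (xi : circle R) x,
  [/\ coding P ls x, x 0%N = \val xi, forall e i, escape P e (x i) &
    limit_set (generated [set h; p]) xi].
Proof.
have [x [cx ex lx]] := coding_exists.
have [xi xiE] := to_circle (coding_circle cx 0%N).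
exists xi, x; split; [exact: cx|by rewrite xiE|exact: ex|].
rewrite /limit_set /= xiE.
apply/closure_normcP => e e0; have /cvg_normcP/(_ _ e0)/filter_ex[k xk] := lx.
have [g Gg mg] := in_group_prefix real_h real_p ls k.
exists (approx 0 k) => //; exists (g (disc0 R)); first by exists g.
have := act_prefix_approx k 0; rewrite addn0 approx0 => <-.
by rewrite mg val_disc0.
Qed.

End PrescribedCoding.

(** * Points whose letters grow diverge on average *)

Section Excursions.
Variables (R : realType) (P : pingpong R) (h p : disc R -> disc R).
Hypothesis real_h : realizes (hy P) h.
Hypothesis real_p : realizes (par (pq P) 1) p.
Local Notation G := (generated [set h; p]).
Local Notation Sigma := (quotient_surface G).
Local Notation pi := (\pi_(Sigma)%qT : disc R -> Sigma).
Local Notation pinf := (pfix (pq P)).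

(** Moebius maps act on horoballs: the ratio of the depth of a point to its
    squared distance from a boundary point is multiplied by a constant. *)
Lemma horoball_act (m : su11 R) (z zeta : R[i]) : normc z <= 1 ->
  normc zeta = 1 ->
  (1 - normc (act m z) ^+ 2) * normc (z - zeta) ^+ 2 =
  (1 - normc z ^+ 2) * den m zeta ^+ 2 * normc (act m z - act m zeta) ^+ 2.
Proof.
move=> z1 zeta1; have zeta1' : normc zeta <= 1 by rewrite zeta1.
rewrite act_normB // act_dist // expr_div_n exprMn.
have dz := den_neq0 m z1; have dzeta := den_neq0 m zeta1'.
by field; rewrite dz dzeta.
Qed.

Lemma pinf_le1 : normc pinf <= 1.
Proof. by rewrite pfix_circle. Qed.

(** The horoball free of orbit points is also free, up to a constant, of the
    points at a bounded distance from the orbit. *)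
Lemma thin_bound (m : su11 R) (z : R[i]) (r : R) : in_group h p m ->
  normc z < 1 -> r < 1 ->
  (exists2 g, in_group h p g & normc (act g z) <= r) ->
  1 - normc (act m z) ^+ 2 <=
    height_bound P / (1 - r) ^+ 2 * normc (act m z - pinf) ^+ 2.
Proof.
move=> mG z1 r1 [g gG gz]; have z1' := ltW z1.
have r10 : 0 < 1 - r by rewrite subr_gt0.
pose n := su_mul m (su_inv g).
have nG : in_group h p n by apply: in_group_mul => //; exact: in_group_inv.
pose v := act g z; have v1 : normc v < 1 by exact: act_lt1.
have v1' := ltW v1.
have mzE : act m z = act n v by rewrite act_mul // act_invK.
pose q := act (su_inv n) pinf.
have q1 : normc q = 1 by apply: act_circle; exact: pfix_circle.
have nq : act n q = pinf by rewrite act_Kinv // pinf_le1.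
have d2 : den n q ^+ 2 <= height_bound P.
  have [i oi] := in_group_orb real_h real_p nG.
  have n0 : normc (0 : R[i]) <= 1 by rewrite normc0.
  have := horoball_act n n0 q1; rewrite sub0r normcN q1 nq normc0 !expr1n.
  rewrite expr0n subr0 mul1r mulr1 => e.
  have := orb_height oi; rewrite e.
  have : 0 < normc (act n 0 - pinf) ^+ 2.
    rewrite exprn_gt0 // normc_gt0 subr_eq0; apply/eqP => e2.
    have : normc (act n 0) < 1 by apply: act_lt1; rewrite normc0.
    by rewrite e2 pfix_circle ltxx.
  by move=> np; rewrite ler_pM2r.
have := horoball_act n v1' q1; rewrite nq -mzE => e.
have vq : 1 - r <= normc (v - q).
  have := lerB_normc q v; rewrite normcB q1 => h1.
  by apply: le_trans h1; rewrite lerD2l lerN2.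
have vq2 : (1 - r) ^+ 2 <= normc (v - q) ^+ 2.
  by rewrite ler_sqr ?nnegrE ?normc_ge0 // ltW.
rewrite mulrAC ler_pdivlMr ?exprn_gt0 //.
have A0 : 0 <= 1 - normc (act m z) ^+ 2.
  by rewrite subr_ge0 expr_le1 ?normc_ge0 // act_le1.
apply: le_trans (ler_wpM2l A0 vq2) _; rewrite e.
rewrite ler_wpM2r ?sqr_ge0 //; apply: le_trans d2.
by rewrite ler_piMl ?sqr_ge0 // gerBl sqr_ge0.
Qed.

Variables (ls : nat -> letter) (x : nat -> R[i]).
Hypothesis cod : coding P ls x.
Local Notation time := (code_time P ls x).

Lemma den_prefix_pinf k :
  den (prefix P ls k) pinf <= 2 / code_gap P * den (prefix P ls k) (x k).
Proof.
have g0 := code_gap_gt0 P.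
apply: le_trans (den_le _ pinf_le1) _; rewrite mulrAC ler_pdivlMr // -mulrA.
by rewrite ler_wpM2l // den_prefix_su_a.
Qed.

(** A large power sends the tail close to the parabolic fixed point, within
    the square root of the contraction factor, up to a constant. *)
Lemma tail_pinf k : normc (x k - pinf) ^+ 2 <=
  16 * normc (su_a (hy P)) ^+ 2 * expR (time k - time k.+1).
Proof.
have y1 := coding_le1 cod k.+1.
have hy1 : normc (act (signed (hy P) (ls k).2) (x k.+1)) <= 1 by exact: act_le1.
have D0 := den_gt0 (block P (ls k)) y1.
have -> : time k - time k.+1 = - (2 * ln (den (block P (ls k)) (x k.+1))).
  by rewrite (code_timeS cod) opprD addrA subrr add0r.
rewrite expRN expR_2ln //.
have -> : 16 * normc (su_a (hy P)) ^+ 2 * (den (block P (ls k)) (x k.+1)) ^- 2 =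
  (4 * normc (su_a (hy P)) / den (block P (ls k)) (x k.+1)) ^+ 2.
  by field; rewrite gt_eqF.
rewrite ler_sqr ?nnegrE ?normc_ge0 ?divr_ge0 ?mulr_ge0 ?normc_ge0 ?(ltW D0) //.
have t0 := tau_gt0 (pq P).
rewrite -(ler_pM2l t0) -normc_kap (coding_step cod) act_block // normc_kap_par //.
have dp := den_gt0 (par (pq P) (ls k).1) hy1.
rewrite den_block // ler_pdivrMr //.
have d2 := den_gt0 (signed (hy P) (ls k).2) y1.
rewrite [leRHS](_ : _ = 4 * normc (su_a (hy P)) * `|tau (pq P)| /
   den (signed (hy P) (ls k).2) (x k.+1)); last by field; rewrite !gt_eqF.
rewrite ler_pdivlMr //.
have k1 := normc_kap_le (pq P) hy1.
have k2 := den_le (signed (hy P) (ls k).2) y1; rewrite signed_a in k2.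
apply: le_trans (ler_pM (normc_ge0 _) (den_ge0 _ _) k1 k2) _.
by rewrite le_eqVlt; apply/orP; left; apply/eqP; ring.
Qed.

(** Between [time k] and [time k.+1], and more than a bounded time away from
    both, the ray runs inside a horoball at the image of the parabolic fixed
    point under the prefix; it is deep enough to avoid the points at a bounded
    distance from the orbit. *)
Lemma excursion (c : R -> disc R) (xi : circle R) (r : R) :
  x 0%N = \val xi -> ray_to xi c -> r < 1 ->
  exists2 a : R, 0 <= a & forall k t, 0 <= t ->
    (exists2 g, in_group h p g & normc (act g (\val (c t))) <= r) ->
    t < time k + a \/ time k.+1 - a < t.
Proof.
move=> x0 rc r1; have [K K0 KP] := ray_dist rc.
have r10 : 0 < 1 - r by rewrite subr_gt0.
pose H := height_bound P / (1 - r) ^+ 2.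
have H0 : 0 <= H by rewrite divr_ge0 ?sqr_ge0.
have g0 := code_gap_gt0 P.
pose C := 2 * H * K * (4 / code_gap P ^+ 2 + 16 * normc (su_a (hy P)) ^+ 2).
have C0 : 0 <= C.
  have HK : 0 <= 2 * H * K by exact: mulr_ge0 (mulr_ge0 (ler0n _ 2) H0) (ltW K0).
  have h1 : 0 <= 4 / code_gap P ^+ 2 by rewrite divr_ge0 ?sqr_ge0.
  have h2 : 0 <= 16 * normc (su_a (hy P)) ^+ 2 by rewrite mulr_ge0 ?sqr_ge0.
  by rewrite mulr_ge0 // addr_ge0.
have main k t : 0 <= t ->
    (exists2 g, in_group h p g & normc (act g (\val (c t))) <= r) ->
    1 <= C * (expR (- (t - time k)) + expR (- (time k.+1 - t))).
  move=> t0 near; set z := \val (c t) in near.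
  have z1 : normc z < 1 := disc_lt1 _; have z1' := ltW z1.
  set g := prefix P ls k; set D := den g (x k).
  have D0 : 0 < D by apply: den_gt0; exact: (coding_le1 cod).
  have gG : in_group h p (su_inv g).
    by apply: in_group_inv; exact: (in_group_prefix real_h real_p).
  have thin := thin_bound gG z1 r1 near; rewrite -/H in thin.
  pose q := act g pinf; have q1 : normc q = 1.
    by apply: act_circle; exact: pfix_circle.
  have gq : act (su_inv g) q = pinf by rewrite act_invK // pinf_le1.
  have dq : den (su_inv g) q = (den g pinf)^-1 by rewrite den_inv // pinf_le1.
  have dp0 := den_gt0 g pinf_le1.
  have X0 : 0 < 1 - normc z ^+ 2 by rewrite subr_gt0 expr_lt1 ?normc_ge0.
  (* the horoball bound, pulled back to the ray itself *)
  have pull : 1 - normc z ^+ 2 <= H * den g pinf ^+ 2 * normc (z - q) ^+ 2.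
    have := horoball_act (su_inv g) z1' q1; rewrite gq dq => e.
    have yp : 0 < normc (act (su_inv g) z - pinf) ^+ 2.
      rewrite exprn_gt0 // normc_gt0 subr_eq0; apply/eqP => e2.
      by have := act_lt1 (su_inv g) z1; rewrite e2 pfix_circle ltxx.
    rewrite -(ler_pM2r yp).
    have -> : (1 - normc z ^+ 2) * normc (act (su_inv g) z - pinf) ^+ 2 =
      den g pinf ^+ 2 * ((1 - normc (act (su_inv g) z) ^+ 2) *
         normc (z - q) ^+ 2).
      by rewrite e; field; rewrite gt_eqF.
    have := ler_wpM2r (sqr_ge0 (normc (z - q))) thin.
    move=> /(ler_wpM2l (sqr_ge0 (den g pinf))) /le_trans; apply.
    by rewrite le_eqVlt; apply/orP; left; apply/eqP; ring.
  have xq : normc (\val xi - q) = normc (x k - pinf) / (D * den g pinf).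
    by rewrite -x0 -(act_prefix cod k) /q act_dist ?(coding_le1 cod) ?pinf_le1.
  have zq : normc (z - q) ^+ 2 <=
      2 * (normc (\val xi - z) ^+ 2 + normc (\val xi - q) ^+ 2).
    have tri := ler_normc_dist z q (\val xi).
    have tri2 : normc (z - q) ^+ 2 <= (normc (\val xi - z) + normc (\val xi - q)) ^+ 2.
      rewrite ler_sqr ?nnegrE ?normc_ge0 ?addr_ge0 ?normc_ge0 //.
      by rewrite [normc (\val xi - z)]normcB.
    apply: le_trans tri2 _.
    move: (normc (\val xi - z)) (normc (\val xi - q)) => u v.
    by have := sqr_ge0 (u - v); rewrite !expr2; nra.
  have [ray1 ray2] := KP t t0; rewrite -/z in ray1 ray2.
  have et := expR_gt0 (- t).
  have tl := tail_pinf k; set B := 16 * _ in tl.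
  have B0 : 0 <= B by rewrite mulr_ge0 // sqr_ge0.
  have DE : D ^+ 2 = expR (time k) by rewrite /code_time expR_2ln.
  have dpD : den g pinf ^+ 2 <= 4 / code_gap P ^+ 2 * expR (time k).
    rewrite -DE; have -> : 4 / code_gap P ^+ 2 * D ^+ 2 =
      (2 / code_gap P * D) ^+ 2 by field; rewrite gt_eqF.
    rewrite ler_sqr ?nnegrE ?den_ge0 //; first exact: den_prefix_pinf.
    by rewrite mulr_ge0 ?(ltW D0) // divr_ge0 // ltW.
  (* the two terms: distance of the ray to its endpoint, and of the endpoint
     to the base of the horoball *)
  have t1 : den g pinf ^+ 2 * normc (\val xi - z) ^+ 2 <=
      K * (4 / code_gap P ^+ 2) * expR (- (t - time k)) * (1 - normc z ^+ 2).
    apply: le_trans (ler_pM (sqr_ge0 _) (sqr_ge0 _) dpD ray1) _.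
    rewrite opprB expRD le_eqVlt; apply/orP; left; apply/eqP; ring.
  have t2 : den g pinf ^+ 2 * normc (\val xi - q) ^+ 2 <=
      K * B * expR (- (time k.+1 - t)) * (1 - normc z ^+ 2).
    rewrite xq expr_div_n exprMn.
    have -> : den g pinf ^+ 2 * (normc (x k - pinf) ^+ 2 /
        (D ^+ 2 * den g pinf ^+ 2)) = normc (x k - pinf) ^+ 2 / D ^+ 2.
      by field; rewrite !gt_eqF.
    rewrite DE ler_pdivrMr ?expR_gt0 //; apply: le_trans tl _.
    have -> : expR (time k - time k.+1) =
        expR (- (time k.+1 - t)) * expR (time k) * expR (- t).
      by rewrite -!expRD; congr expR; ring.
    have := ler_wpM2l (mulr_ge0 (mulr_ge0 B0 (expR_ge0 (- (time k.+1 - t))))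
      (expR_ge0 (time k))) ray2.
    move=> le; apply: le_trans (le_trans _ le) _.
      by rewrite le_eqVlt; apply/orP; left; apply/eqP; ring.
    by rewrite le_eqVlt; apply/orP; left; apply/eqP; ring.
  have fin : 1 - normc z ^+ 2 <= C * (expR (- (t - time k)) +
      expR (- (time k.+1 - t))) * (1 - normc z ^+ 2).
    apply: le_trans pull _.
    apply: le_trans (ler_wpM2l (mulr_ge0 H0 (sqr_ge0 _)) zq) _.
    have -> : H * den g pinf ^+ 2 * (2 * (normc (\val xi - z) ^+ 2 +
       normc (\val xi - q) ^+ 2)) = 2 * H * (den g pinf ^+ 2 *
       normc (\val xi - z) ^+ 2 + den g pinf ^+ 2 * normc (\val xi - q) ^+ 2).
      by ring.
    have H20 : 0 <= 2 * H by rewrite mulr_ge0.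
    apply: le_trans (ler_wpM2l H20 (lerD t1 t2)) _.
    have e1 := expR_ge0 (- (t - time k)).
    have e2 := expR_ge0 (- (time k.+1 - t)).
    have c1 : 0 <= 4 / code_gap P ^+ 2 by rewrite divr_ge0 ?sqr_ge0.
    rewrite /C -/B; move: (4 / _) c1 => c1 c10.
    move: (expR (- (t - _))) (expR (- (time k.+1 - _))) e1 e2 => E F E0 F0.
    rewrite -subr_ge0.
    have -> : 2 * H * K * (c1 + B) * (E + F) * (1 - normc z ^+ 2) -
      2 * H * (K * c1 * E * (1 - normc z ^+ 2) +
         K * B * F * (1 - normc z ^+ 2)) =
      2 * H * K * (1 - normc z ^+ 2) * (c1 * F + B * E) by ring.
    exact: mulr_ge0 (mulr_ge0 (mulr_ge0 H20 (ltW K0)) (ltW X0))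
      (addr_ge0 (mulr_ge0 c10 F0) (mulr_ge0 B0 E0)).
  by rewrite -(ler_pM2r X0) mul1r.
exists (ln (1 + 2 * C) + 1).
  by rewrite addr_ge0 // ln_ge0 // lerDl mulr_ge0.
move=> k t t0 near; apply/orP; rewrite -[_ || _]negbK negb_or -!leNgt.
apply/negP => /andP[ta tb]; have := main k t t0 near; apply/negP.
rewrite -ltNge.
set a := ln _ + 1 in ta tb.
have pos : 0 < 1 + 2 * C by rewrite ltr_wpDr // mulr_ge0.
have small u : a <= u -> expR (- u) <= (1 + 2 * C)^-1.
  move=> au; rewrite -[(1 + 2 * C)]lnK ?posrE // -expRN ler_expR lerN2.
  by apply: le_trans au; rewrite lerDl.
have s1 := small _ (_ : a <= t - time k).
have s2 := small _ (_ : a <= time k.+1 - t).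
apply: (@le_lt_trans _ _ (C * ((1 + 2 * C)^-1 + (1 + 2 * C)^-1))).
  by rewrite ler_wpM2l // lerD // ?s1 ?s2 //; lra.
have -> : C * ((1 + 2 * C)^-1 + (1 + 2 * C)^-1) = 2 * C / (1 + 2 * C) by ring.
by rewrite ltr_pdivrMr // mul1r ltrDr.
Qed.

(** By [excursion] the ray is near the orbit for a bounded time per letter,
    and superlinear growth makes the number of letters met before [T]
    negligible with respect to [T]. *)
Lemma diverging_of_growth (xi : circle R) : x 0%N = \val xi ->
  limit_set G xi ->
  (forall M : R, exists C : R, forall k, M * k%:R - C <= time k) ->
  diverging_on_average G xi.
Proof.
move=> x0 lxi growth; split => // sigma [c [rc sigmaE]] W cW.
have [r r1 WP] := compact_lift (@generated_id _ _) (@generated_inv _ _)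
  (@generated_comp _ _) (group_matrix real_h real_p) cW.
have [a a0 ex] := excursion x0 rc r1.
apply/cvgrPdist_lt => e e0.
pose M := 4 * (a + 1) / e.
have M0 : 0 < M by rewrite divr_gt0 // mulr_gt0 // ltr_wpDl.
have [C CP] := growth M.
pose T0 := 2 * (a + `|C|) + 8 * (a + 1) / e + 1.
near=> T.
have TT0 : T0 <= T by near: T; apply: nbhs_pinfty_ge; rewrite num_real.
have ae : 0 <= 8 * (a + 1) / e.
  by rewrite divr_ge0 ?(ltW e0) // mulr_ge0 // addr_ge0.
have C0 := normr_ge0 C; have Cn := ler_norm C.
have T1 : 1 <= T by rewrite /T0 in TT0; lra.
have T10 : 0 < T by lra.
pose N := (Num.truncn ((T + a + `|C|) / M)).+1.
have N1 : (T + a + `|C|) / M < N%:R by exact: truncnS_gt.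
have N2 : N%:R <= (T + a + `|C|) / M + 1.
  rewrite /N -natr1 lerD2r truncn_le //.
  by rewrite divr_ge0 ?(ltW M0) //; lra.
have tN : T + a < time N.
  apply: lt_le_trans (CP N); rewrite ltrBrDr mulrC.
  by move: N1; rewrite ltr_pdivrMr //; lra.
have mono i j : (i <= j)%N -> time i <= time j.
  move=> ij; elim: j ij => [|j IH]; first by rewrite leqn0 => /eqP ->.
  rewrite leq_eqVlt => /orP[/eqP -> //|]; rewrite ltnS => /IH le.
  apply: le_trans le _; apply: le_trans (code_time_step cod j).
  by rewrite lerDl mulr_ge0 // ltW // ln_lam_gt0.
have cov t : 0 <= t <= T -> W (sigma t) ->
    exists2 i, (i < N)%N & `|t - time i| <= a.
  move=> /andP[t0 tT]; rewrite sigmaE // => Wt.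
  have near : exists2 g, in_group h p g & normc (act g (\val (c t))) <= r.
    have [g Gg gr] := WP _ Wt; have [m mg] := group_matrix real_h real_p Gg.
    by exists m; [exists g|rewrite -mg].
  have E : exists k, t < time k by exists N; lra.
  case: (ex_minnP E) => -[|k] tk kmin.
    by move: tk; rewrite code_time0 ltNge t0.
  have kt : time k <= t.
    by rewrite leNgt; apply/negP => /kmin; rewrite ltnn.
  have kN : (k < N)%N.
    rewrite ltnNge; apply/negP => /mono; lra.
  have [t1|t1] := ex k t t0 near.
    by exists k => //; rewrite ger0_norm ?subr_ge0 //; lra.
  exists k.+1; last by rewrite ltr0_norm ?subr_lt0 //; lra.
  rewrite ltnNge; apply/negP => /mono; lra.
have up := time_le a0 (ltW T10) cov.
have lo : 0 <= \int[lebesgue_measure]_(t in `[0, T]) \1_W (sigma t).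
  by apply: Rintegral_ge0 => t _.
rewrite sub0r normrN ger0_norm; last first.
  by rewrite mulr_ge0 // invr_ge0 ltW.
rewrite mulrC ltr_pdivrMr //; apply: le_lt_trans up _.
have b1 : 2 * a * N%:R <= 2 * (a + 1) * ((T + a + `|C|) / M + 1).
  rewrite ler_pM ?mulr_ge0 //; lra.
apply: le_lt_trans b1 _.
have -> : 2 * (a + 1) * ((T + a + `|C|) / M + 1) =
    e / 2 * (T + a + `|C|) + 2 * (a + 1).
  rewrite /M; field; rewrite !gt_eqF //; lra.
have k1 : a + `|C| <= T / 2 by rewrite /T0 in TT0; lra.
have k2 : 8 * (a + 1) < e * T.
  by rewrite [ltRHS]mulrC -ltr_pdivrMr //; rewrite /T0 in TT0; lra.
have k3 : e / 2 * (T + a + `|C|) <= e / 2 * (T + T / 2).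
  by rewrite ler_wpM2l ?divr_ge0 ?(ltW e0) //; lra.
nra.
Unshelve. all: by end_near. Qed.

End Excursions.

(** * The lower bound *)

Section StripTranslates.
Variables (R : realType) (q : parabolic_form R) (et k : R).
Hypothesis et1 : et <= 2^-1.
Hypothesis k_gt0 : 0 < k.
Implicit Types (y : R[i]) (n m : int).

Lemma Re_inv (z : R[i]) : complex.Re z^-1 = complex.Re z / normc z ^+ 2.
Proof. by rewrite sqr_normcE; case: z => a b. Qed.

Lemma strip_kap_neq0 y : strip q et k y -> kap q y != 0.
Proof. by case=> h _; rewrite -normc_gt0; exact: lt_le_trans h. Qed.

Lemma strip_Re_inv y : strip q et k y ->
  `|complex.Re (kap q y)^-1| <= 2^-1 - et.
Proof.
move=> sy; have k0 := strip_kap_neq0 sy; case: sy => _ h.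
rewrite Re_inv normrM normfV [`|normc _ ^+ 2|]ger0_norm ?sqr_ge0 //.
by rewrite ler_pdivrMr // exprn_gt0 // normc_gt0.
Qed.

Lemma kap_par_inv n y : normc y <= 1 -> kap q y != 0 ->
  (kap q (act (par q n) y))^-1 = (kap q y)^-1 + (n%:~R)%:C.
Proof.
move=> y1 ky; rewrite kap_par // invf_div.
by rewrite mulrDl mul1r -mulrA divff // mulr1.
Qed.

(** In the coordinate [1 / kap] two distinct translates of the strip are a
    definite distance apart. *)
Lemma par_strip_apart n m y y' : n != m -> normc y <= 1 -> normc y' <= 1 ->
  strip q et k y -> strip q et k y' ->
  2 * et * `|n%:~R - m%:~R| *
    (normc (kap q (act (par q n) y)) * normc (kap q (act (par q m) y'))) <=
  normc (kap q (act (par q n) y) - kap q (act (par q m) y')).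
Proof.
move=> nm y1 y1' sy sy'.
have ky := strip_kap_neq0 sy; have ky' := strip_kap_neq0 sy'.
have e1 := kap_par_inv n y1 ky; have e2 := kap_par_inv m y1' ky'.
have K1 : kap q (act (par q n) y) != 0.
  by rewrite kap_par // mulf_neq0 // invr_eq0 -su_den_par su_den_neq0.
have K2 : kap q (act (par q m) y') != 0.
  by rewrite kap_par // mulf_neq0 // invr_eq0 -su_den_par su_den_neq0.
move: K1 K2 e1 e2; set K := kap q (act _ _); set K' := kap q (act _ _).
move=> K1 K2 e1 e2.
have -> : K - K' = (K'^-1 - K^-1) * (K * K') by field; rewrite K1 K2.
rewrite !normcM ler_wpM2r ?mulr_ge0 ?normc_ge0 //.
rewrite e1 e2; apply: le_trans (normc_Re _).
have -> : complex.Re ((kap q y')^-1 + (m%:~R)%:C - ((kap q y)^-1 + (n%:~R)%:C)) =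
    - (n%:~R - m%:~R) + (complex.Re (kap q y')^-1 - complex.Re (kap q y)^-1).
  by move: (_^-1) (_^-1) => [a b] [c d] /=; ring.
apply: le_trans (lerB_normD _ _); rewrite normrN.
have h1 := strip_Re_inv sy; have h2 := strip_Re_inv sy'.
have h3 := ler_normB (complex.Re (kap q y')^-1) (complex.Re (kap q y)^-1).
have h4 : 1 <= `|n%:~R - m%:~R : R|.
  by rewrite -intrB; apply: norm_int_ge1; rewrite subr_eq0.
move: (`|n%:~R - m%:~R|) h4 => N N1.
have hN : 0 <= (N - 1) * (1 - 2 * et).
  by apply: mulr_ge0; [lra|have et1' := et1; lra].
have h5 := le_trans h3 (lerD h2 h1).
by move: (`|_ - _|) h5 => X h5; lra.
Qed.

End StripTranslates.

Section Digits.
Variable R : realType.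
Implicit Types (t u : R) (j : nat).

(** The product of the bases [2 ^ i] for [i < j]. *)
Definition scale j : R := 2 ^+ 'C(j, 2).

Lemma scaleS j : scale j.+1 = scale j * 2 ^+ j.
Proof. by rewrite /scale binS bin1 exprD. Qed.

Lemma scale_gt0 j : 0 < scale j.
Proof. by rewrite exprn_gt0. Qed.

Lemma scale_ge j : j%:R <= scale j.
Proof.
case: j => [|j]; first by rewrite ltW // scale_gt0.
rewrite scaleS; apply: (@le_trans _ _ (1 * 2 ^+ j)).
  by rewrite mul1r -natrX ler_nat ltn_expl.
by rewrite ler_wpM2r ?exprn_ge0 // exprn_ege1 // ler1n.
Qed.

Definition level t j := Num.truncn (t * scale j).
(** Digits in the mixed radix system with bases [2 ^ j]. *)
Definition digit t j := (level t j.+1 %% 2 ^ j)%N.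

Lemma level_itv t j : 0 <= t ->
  (level t j)%:R <= t * scale j < (level t j)%:R + 1.
Proof.
move=> t0; rewrite natr1; apply: truncn_itv.
by rewrite mulr_ge0 // ltW // scale_gt0.
Qed.

Lemma levelS t j : 0 <= t -> level t j.+1 = (level t j * 2 ^ j + digit t j)%N.
Proof.
move=> t0; rewrite {1}(divn_eq (level t j.+1) (2 ^ j)); congr (_ * _ + _)%N.
have p0 : (0 < 2 ^ j)%N by rewrite expn_gt0.
have pR : 0 < 2 ^+ j :> R by rewrite exprn_gt0.
have /andP[a1 a2] := level_itv j t0; have /andP[b1 b2] := level_itv j.+1 t0.
rewrite scaleS mulrA in b1 b2.
apply/eqP; rewrite eqn_leq; apply/andP; split.
  rewrite -ltnS ltn_divLR // -(ltr_nat R) natrM natrX.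
  by apply: le_lt_trans b1 _; rewrite ltr_pM2r // -natr1.
rewrite leq_divRL // -ltnS -(ltr_nat R) natrM natrX -[ltRHS]natr1.
by apply: le_lt_trans b2; rewrite ler_pM2r.
Qed.

Lemma level0 t : 0 <= t < 1 -> level t 0 = 0%N.
Proof.
move=> /andP[t0 t1]; have /andP[a1 _] := level_itv 0 t0.
apply/eqP; rewrite -leqn0 -ltnS -(ltr_nat R); apply: le_lt_trans a1 _.
by rewrite /scale bin0n expr0 mulr1.
Qed.

(** The distance of two numbers is governed by their first distinct digits. *)
Lemma first_digit t u : 0 <= t < 1 -> 0 <= u < 1 -> t != u ->
  exists j, [/\ forall i, (i < j)%N -> digit t i = digit u i,
    digit t j != digit u j &
    `|t - u| * scale j.+1 <= 2 * `|(digit t j)%:R - (digit u j)%:R|].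
Proof.
move=> t01 u01 tu; have /andP[t0 _] := t01; have /andP[u0 _] := u01.
have E : exists k, level t k != level u k.
  apply: contrapT => no; have same k : level t k = level u k.
    by apply/eqP; apply: contrapT => /negP ne; apply: no; exists k.
  have d0 : 0 < `|t - u| by rewrite normr_gt0 subr_eq0.
  pose k := (Num.truncn (`|t - u|^-1)).+1.
  have kd : 1 < `|t - u| * scale k.
    apply: lt_le_trans (_ : `|t - u| * k%:R <= _).
      rewrite -(@ltr_pdivrMl R) // mulr1; exact: truncnS_gt.
    by rewrite ler_wpM2l // scale_ge.
  have /andP[a1 a2] := level_itv k t0; have /andP[b1 b2] := level_itv k u0.
  rewrite same in a1 a2.
  move: kd; apply/negP; rewrite -leNgt -[scale k]gtr0_norm ?scale_gt0 // -normrM.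
  by rewrite mulrBl ler_norml; apply/andP; split; lra.
case: (ex_minnP E) => -[|j]; first by rewrite !level0 ?eqxx.
move=> ne jmin; have same i : (i <= j)%N -> level t i = level u i.
  move=> ij; apply/eqP; apply: contrapT => /negP /jmin.
  by rewrite ltnNge ij.
exists j; split.
- by move=> i ij; rewrite /digit same.
- by move: ne; rewrite !levelS // same // eqn_add2l.
have /andP[a1 a2] := level_itv j.+1 t0; have /andP[b1 b2] := level_itv j.+1 u0.
have dE : (level t j.+1)%:R - (level u j.+1)%:R =
    (digit t j)%:R - (digit u j)%:R :> R.
  by rewrite !levelS // same // !natrD; ring.
have d1 : 1 <= `|(digit t j)%:R - (digit u j)%:R| :> R.
  rewrite -dE -[X in X - _]/(((level t j.+1)%:Z)%:~R).
  rewrite -[X in _ - X]/(((level u j.+1)%:Z)%:~R) -intrB.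
  by apply: norm_int_ge1; rewrite subr_eq0.
rewrite -[scale _]gtr0_norm ?scale_gt0 // -normrM mulrBl.
move: d1; rewrite -dE; move: (level t _)%:R (level u _)%:R a1 a2 b1 b2 => l l'.
move: (t * _) (u * _) => T U a1 a2 b1 b2.
rewrite mulr2n mulrDl !mul1r => d1.
apply: (@le_trans _ _ (`|l - l'| + 1)); last by rewrite lerD2l.
have := ler_norm (l - l'); have := ler_norm (- (l - l')); rewrite normrN.
by rewrite ler_norml => h1 h2; apply/andP; split; lra.
Qed.

End Digits.

(** A quadratic function dominates any linear one: constants raised to the
    power [j] are negligible with respect to powers of [scale j]. *)
Lemma quadratic_lower (R : realType) (al be : R) : 0 < al ->
  exists2 E : R, 0 <= E & forall j : nat,
    - E <= al * ('C(j, 2))%:R - be * j%:R.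
Proof.
move=> al0; pose g := al / 2 + be.
have binE (j : nat) : ('C(j, 2))%:R = j%:R * (j%:R - 1) / 2 :> R.
  elim: j => [|j IH]; first by rewrite bin0n !mul0r.
  by rewrite binS bin1 natrD IH -[j.+1%:R]natr1; field.
exists (g ^+ 2 / (2 * al)).
  by rewrite divr_ge0 ?sqr_ge0 // mulr_ge0 // ltW.
move=> j; rewrite binE lerNl -subr_ge0.
have -> : g ^+ 2 / (2 * al) - - (al * (j%:R * (j%:R - 1) / 2) - be * j%:R) =
    (al * j%:R - g) ^+ 2 / (2 * al).
  by rewrite /g; field; rewrite gt_eqF.
by rewrite divr_ge0 ?sqr_ge0 // mulr_ge0 // ltW.
Qed.

Section LowerBound.
Variables (R : realType) (P : pingpong R) (h p : disc R -> disc R).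
Hypothesis real_h : realizes (hy P) h.
Hypothesis real_p : realizes (par (pq P) 1) p.
Local Notation G := (generated [set h; p]).
Implicit Types (t u : R).

(** All the powers from [2 ^ i] to [2 ^ i.+1 - 1] have comparable weights and
    are allowed at rank [i], which gives full dimension [1 / 2]; their growth
    makes the points diverge on average. *)
Definition digit_letter t i : letter := ((2 ^ i + digit t i)%N%:Z, true).

Lemma digit_lt t i : (digit t i < 2 ^ i)%N.
Proof. by rewrite ltn_mod expn_gt0. Qed.

Lemma digit_letter_neq0 t i : (digit_letter t i).1 != 0.
Proof. by rewrite /= eqz_nat addn_eq0 expn_eq0. Qed.

Lemma weight_digitE t i :
  weight R (digit_letter t i) = 1 + (2 ^ i + digit t i)%:R.
Proof. by rewrite /weight /= ger0_norm // ler0z. Qed.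

Lemma weight_digit_le t i : weight R (digit_letter t i) <= 2 * 2 ^+ i.
Proof.
rewrite weight_digitE -natrX -natrM addrC natr1 ler_nat mul2n -addnn.
by rewrite -addnS leq_add2l digit_lt.
Qed.

Lemma weight_digit_ge t i : 2 ^+ i <= weight R (digit_letter t i).
Proof.
rewrite weight_digitE natrD natrX; have : 0 <= (digit t i)%:R :> R by [].
lra.
Qed.

Definition point_spec t (xi : circle R) := exists x,
  [/\ coding P (digit_letter t) x, x 0%N = \val xi,
      forall e i, escape P e (x i) & limit_set G xi].

Lemma growth_of_digits t x : coding P (digit_letter t) x ->
  forall M : R, exists C : R, forall k,
    M * k%:R - C <= code_time P (digit_letter t) x k.
Proof.
move=> cx M; have l2 : 0 < 2 * ln 2 :> R.
  by rewrite mulr_gt0 // ln_gt0 // ltr1n.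
have [E E0 EP] := quadratic_lower (M - 2 * ln (den_low P)) l2.
exists E => k.
suff h1 : 2 * ln 2 * ('C(k, 2))%:R + 2 * ln (den_low P) * k%:R <=
    code_time P (digit_letter t) x k.
  by apply: le_trans h1; have := EP k; lra.
elim: k => [|k IH].
  by rewrite bin0n !mulr0 addr0 code_time0.
rewrite (code_timeS cx) binS bin1 natrD.
have x1 := coding_le1 cx k.+1.
have c0 := den_low_gt0 P.
have step : ln (den_low P) + k%:R * ln 2 <=
    ln (den (block P (digit_letter t k)) (x k.+1)).
  have -> : ln (den_low P) + k%:R * ln 2 = ln (den_low P * 2 ^+ k).
    by rewrite lnM ?posrE ?exprn_gt0 // lnXn // mulr_natl.
  rewrite ler_ln ?posrE ?mulr_gt0 ?exprn_gt0 ?den_gt0 //.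
  apply: le_trans (block_den_ge x1 (coding_escape cx k)).
  by rewrite ler_wpM2l ?(ltW c0) // weight_digit_ge.
have -> : k.+1%:R = k%:R + 1 :> R by rewrite natr1.
move: (ln (den_low P)) (ln 2) (ln _) step IH => a b c step IH.
move: (code_time _ _ _ _) IH => T IH; nra.
Qed.

Lemma point_diverging t xi : point_spec t xi -> diverging_on_average G xi.
Proof.
move=> [x [cx x0 _ lx]].
exact: (diverging_of_growth real_h real_p cx x0 lx (growth_of_digits cx)).
Qed.

Lemma margin_le_half : margin P <= 2^-1.
Proof.
have [h1 h2] := strip_0 P.
have K0 : 0 < normc (kap (pq P) 0) ^+ 2.
  by rewrite exprn_gt0 //; apply: lt_le_trans h1; exact: k0_gt0.
have : 0 <= (2^-1 - margin P) * normc (kap (pq P) 0) ^+ 2.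
  exact: le_trans (normr_ge0 _) h2.
by rewrite pmulr_lge0 // subr_ge0.
Qed.

Lemma den_prefix_digit_le t j z : normc z <= 1 ->
  den (prefix P (digit_letter t) j) z <= (2 * den_up P) ^+ j * scale R j.
Proof.
elim: j z => [|j IH] z z1; first by rewrite den_one expr0 mul1r /scale bin0n expr0.
have u0 := den_up_gt0 P.
rewrite /= den_mul // scaleS exprS.
have -> : 2 * den_up P * (2 * den_up P) ^+ j * (scale R j * 2 ^+ j) =
  (2 * den_up P) ^+ j * scale R j * (den_up P * (2 * 2 ^+ j)) by ring.
rewrite ler_pM ?den_ge0 //; first by apply: IH; exact: act_le1.
apply: le_trans (block_den_le P _ z1) _.
by rewrite ler_wpM2l ?(ltW u0) // weight_digit_le.
Qed.

(** Points whose codings separate at the letter [j] are as far apart as the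
    distortion of the common prefix allows. *)
Lemma point_dist_ge : exists2 c : R, 0 < c & forall t u xi zeta j,
  point_spec t xi -> point_spec u zeta ->
  (forall i, (i < j)%N -> digit t i = digit u i) -> digit t j != digit u j ->
  c * (`|(digit t j)%:R - (digit u j)%:R| / 2 ^+ j) *
     ((8 * den_up P ^+ 2) ^- j * (scale R j) ^- 2) <= visual_dist xi zeta.
Proof.
have t0 := tau_gt0 (pq P); have u0 := den_up_gt0 P; have k00 := k0_gt0 P.
have m0 := margin_gt0 P.
pose L := 1 + 2 * `|tau (pq P)|; have L0 : 0 < L.
  by rewrite addr_gt0 // mulr_gt0.
pose c1 := margin P * k0 P ^+ 2 / (4 * L ^+ 2 * `|tau (pq P)|).
have c10 : 0 < c1.
  by rewrite divr_gt0 ?mulr_gt0 ?exprn_gt0.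
exists c1 => // t u xi zeta j [x [cx x0 ex _]] [y [cy y0 ey _]] same dj.
have eqpre : prefix P (digit_letter u) j = prefix P (digit_letter t) j.
  by apply: eq_prefix => i ij; rewrite /digit_letter same.
have x1 := coding_le1 cx; have y1 := coding_le1 cy.
rewrite visual_distE -x0 -y0 -(act_prefix cx j) -(act_prefix cy j) eqpre.
rewrite act_dist //; set D := den _ _; set D' := den _ (y j).
have D0 : 0 < D by exact: den_gt0.
have D'0 : 0 < D' by exact: den_gt0.
pose B := (2 * den_up P) ^+ j * scale R j.
have DB : D <= B by exact: den_prefix_digit_le.
have D'B : D' <= B by exact: den_prefix_digit_le.
set dl := `|_ - _|.
pose hx := act (signed (hy P) true) (x j.+1).
pose hy' := act (signed (hy P) true) (y j.+1).
have hx1 : normc hx <= 1 by exact: act_le1.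
have hy1 : normc hy' <= 1 by exact: act_le1.
have sx : strip (pq P) (margin P) (k0 P) hx.
  by apply: escape_strip => //; exact: ex.
have sy : strip (pq P) (margin P) (k0 P) hy'.
  by apply: escape_strip => //; exact: ey.
pose n := (2 ^ j + digit t j)%N; pose m := (2 ^ j + digit u j)%N.
have nm : n%:Z != m%:Z by rewrite eqz_nat eqn_add2l.
have xE : x j = act (par (pq P) n%:Z) hx by rewrite (coding_step cx) act_block.
have yE : y j = act (par (pq P) m%:Z) hy' by rewrite (coding_step cy) act_block.
have dlE : dl = `|(n%:Z)%:~R - (m%:Z)%:~R|.
  by rewrite /dl /n /m -!pmulrn !natrD opprD addrACA subrr add0r.
have kge z l : normc z <= 1 -> strip (pq P) (margin P) (k0 P) z ->
    weight R (l, true) <= 2 * 2 ^+ j ->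
    k0 P / (L * (2 * 2 ^+ j)) <= normc (kap (pq P) (act (par (pq P) l) z)).
  move=> z1 [zk _] wl; rewrite normc_kap_par //.
  have d0 := den_gt0 (par (pq P) l) z1.
  have dle : den (par (pq P) l) z <= L * (2 * 2 ^+ j).
    apply: le_trans (den_par_le _ _ z1) _; rewrite ler_wpM2l ?(ltW L0) //.
  rewrite ler_pM ?(ltW k00) ?invr_ge0 ?mulr_ge0 ?(ltW L0) ?exprn_ge0 //.
  by rewrite lef_pV2 ?posrE ?mulr_gt0 ?exprn_gt0.
have kx := kge _ _ hx1 sx (weight_digit_le t j).
have ky := kge _ _ hy1 sy (weight_digit_le u j).
have apart := par_strip_apart margin_le_half k00 nm hx1 hy1 sx sy.
rewrite -xE -yE -dlE in apart kx ky.
have pos : 0 <= k0 P / (L * (2 * 2 ^+ j)).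
  by rewrite divr_ge0 ?(ltW k00) ?mulr_ge0 ?(ltW L0) ?exprn_ge0.
have prod := ler_pM pos pos kx ky.
have dl0 : 0 <= dl by exact: normr_ge0.
have far : 2 * margin P * dl * (k0 P / (L * (2 * 2 ^+ j))) ^+ 2 <=
    `|tau (pq P)| * normc (x j - y j).
  have -> : `|tau (pq P)| * normc (x j - y j) =
      normc (kap (pq P) (x j) - kap (pq P) (y j)).
    rewrite !kapE -mulrBr normcM normc_conj normc_pb; congr (_ * normc _).
    by ring.
  apply: le_trans apart; rewrite expr2 ler_wpM2l //.
  by rewrite !mulr_ge0 // ltW.
have p0 : 0 < 2 ^+ j :> R by rewrite exprn_gt0.
have B0 : 0 < B.
  by apply: mulr_gt0; [apply: exprn_gt0; rewrite mulr_gt0|exact: scale_gt0].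
have far2 : 2 * c1 * dl / (2 ^+ j) ^+ 2 <= normc (x j - y j).
  rewrite -(ler_pM2l t0); apply: le_trans far.
  rewrite le_eqVlt; apply/orP; left; apply/eqP; rewrite /c1.
  by field; rewrite !gt_eqF.
rewrite ler_pdivlMr // ler_pdivlMr ?mulr_gt0 //.
have DD : D * D' <= B ^+ 2 by rewrite expr2 ler_pM // ltW.
apply: le_trans far2.
have BE : B ^+ 2 = (8 * den_up P ^+ 2) ^+ j * scale R j ^+ 2 / 2 ^+ j.
  rewrite /B exprMn -exprM mulnC exprM.
  have -> : (2 * den_up P) ^+ 2 = (8 * den_up P ^+ 2) / 2 by field.
  by rewrite expr_div_n; field; rewrite gt_eqF.
have F0 : 0 < (8 * den_up P ^+ 2) ^+ j.
  by rewrite exprn_gt0 // mulr_gt0 // exprn_gt0.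
have S0 := scale_gt0 R j.
apply: (@le_trans _ _ (c1 * (dl / 2 ^+ j) *
    ((8 * den_up P ^+ 2) ^- j * scale R j ^- 2) * 2 * B ^+ 2)).
  apply: ler_wpM2l DD; apply: mulr_ge0 => //; apply: mulr_ge0.
    by apply: mulr_ge0; [exact: ltW|rewrite divr_ge0 // ltW].
  by apply: mulr_ge0; rewrite invr_ge0 ltW // exprn_gt0.
rewrite BE le_eqVlt; apply/orP; left; apply/eqP.
move: ((8 * den_up P ^+ 2) ^+ j) F0 => F F0.
by field; rewrite !gt_eqF.
Qed.

(** The map from points to numbers is Hoelder of every exponent [s < 1 / 2]:
    numbers separating at rank [j] differ by at most about [(scale j)^-1], and
    the points by at least about [(scale j) ^- 2]. *)
Lemma diverging_dim_ge :
  ((2^-1)%:E <= hausdorff_dim (@visual_dist R) (diverging_on_average G))%E.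
Proof.
apply: le_ereal_inf_tmp => _ [s [s0 sA] <-]; rewrite lee_fin leNgt.
apply/negP => s2; move/eqP: sA; apply/negP.
have /choice[f fP] : forall t : R, exists xi, point_spec t xi.
  move=> t.
  have [xi [x [cx x0 ex lx]]] :=
    prescribed_point (digit_letter_neq0 t) real_h real_p.
  by exists xi, x.
have [c c0 cP] := point_dist_ge.
pose B := 8 * den_up P ^+ 2.
have B0 : 0 < B by rewrite mulr_gt0 // exprn_gt0 // den_up_gt0.
have al0 : 0 < (1 - 2 * s) * ln 2 :> R.
  by rewrite mulr_gt0 ?ln_gt0 ?ltr1n //; lra.
have [E E0 EP] := quadratic_lower (s * ln B) al0.
pose K := 2 * expR (E - s * ln c).
have K0 : 0 < K by rewrite mulr_gt0 // expR_gt0.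
apply: (@hausdorff_measure_holder _ _ (@visual_dist R) _ _ s K _ f) => //.
- by move=> xi; rewrite visual_distE subrr normc0 mul0r.
- by move=> xi zeta; rewrite visual_distE divr_ge0 // normc_ge0.
- by move=> t _; exact: point_diverging (fP t).
move=> t u t01 u01; have [->|tu] := eqVneq t u.
  by rewrite subrr normr0 mulr_ge0 ?powR_ge0 // ltW.
have [j [same dj tuj]] := first_digit t01 u01 tu.
have := cP _ _ _ _ _ (fP t) (fP u) same dj.
set dl : R := `|(digit t j)%:R - (digit u j)%:R| in tuj *; set dist := visual_dist _ _ => dge.
have p0 : 0 < 2 ^+ j :> R by rewrite exprn_gt0.
have S0 := scale_gt0 R j.
have dl0 : 0 < dl.
  by rewrite normr_gt0 subr_eq0 eqr_nat.
pose r := dl / 2 ^+ j; have r0 : 0 < r by rewrite divr_gt0.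
have r1 : r <= 1.
  rewrite ler_pdivrMr // mul1r ler_norml.
  have h1 : (digit t j)%:R < 2 ^+ j :> R by rewrite -natrX ltr_nat digit_lt.
  have h2 : (digit u j)%:R < 2 ^+ j :> R by rewrite -natrX ltr_nat digit_lt.
  have h3 : 0 <= (digit t j)%:R :> R by [].
  have h4 : 0 <= (digit u j)%:R :> R by [].
  by apply/andP; split; lra.
have tur : `|t - u| <= 2 * r / scale R j.
  rewrite ler_pdivlMr // -(ler_pM2r p0) -mulrA -scaleS; apply: le_trans tuj _.
  by rewrite /r mulrA divfK // gt_eqF.
apply: le_trans tur _.
have low : expR (ln c + ln r - j%:R * ln B - 2 * ln (scale R j)) <= dist.
  apply: le_trans dge; rewrite -/B -/r le_eqVlt; apply/orP; left; apply/eqP.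
  rewrite !expRD !expRN expR_2ln // !lnK ?posrE //.
  have -> : expR (j%:R * ln B) = B ^+ j.
    by rewrite mulr_natl -lnXn // lnK // posrE exprn_gt0.
  by rewrite -mulrA.
have dist0 : 0 < dist by apply: lt_le_trans low; exact: expR_gt0.
apply: (@le_trans _ _ (K * expR (s * (ln c + ln r - j%:R * ln B -
    2 * ln (scale R j))))); last first.
  rewrite ler_wpM2l ?(ltW K0) // /powR gt_eqF // ler_expR ler_wpM2l ?(ltW s0) //.
  by rewrite -[leLHS]expRK ler_ln ?posrE ?expR_gt0.
rewrite /K -[2 * r / _]mulrA -[2 * _ * _]mulrA -expRD ler_wpM2l //.
apply: (@le_trans _ _ (expR (ln r - ln (scale R j)))).
  by rewrite expRD expRN !lnK ?posrE.
rewrite ler_expR.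
have lr : ln r <= 0 by rewrite ln_le0.
have lS : ln (scale R j) = ('C(j, 2))%:R * ln 2.
  by rewrite /scale lnXn // mulr_natl.
have := EP j; rewrite lS; move: ('C(j, 2))%:R (j%:R) => b k.
have lr2 : ln r <= s * ln r.
  have : 0 <= (1 - s) * (- ln r) by rewrite mulr_ge0 //; lra.
  lra.
move: (ln r) (ln c) (ln B) (ln 2) lr2 => a c' b' l lr2 h'; nra.
Qed.

End LowerBound.

(** * The critical exponent of the parabolic subgroup *)

Section CriticalExponent.
Variables (R : realType) (q : parabolic_form R) (p : disc R -> disc R).
Hypothesis real_p : realizes (par q 1) p.
Local Notation H := (generated [set p]).
Local Notation d g := (hdist (disc0 R) (g (disc0 R))).
Implicit Types (g : disc R -> disc R) (n : int) (s : R).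

Lemma orbit_den m g : realizes m g ->
  1 - normc (\val (g (disc0 R))) ^+ 2 = (den m 0) ^- 2.
Proof.
by move=> ->; rewrite val_disc0 act_normB normc0 ?ler01 // expr0n subr0 mul1r.
Qed.

(** Since [1 - r ^ 2] is the inverse square of [den] at the centre, the
    distance is twice the logarithm of [(1 + r) * den]. *)
Lemma orbit_dist m g : realizes m g ->
  2 * ln (den m 0) <= d g <= 2 * ln (2 * den m 0).
Proof.
move=> rg; have := orbit_den rg; have := disc_lt1 (g (disc0 R)).
have := normc_ge0 (\val (g (disc0 R))); rewrite hdistC hdist0E.
have : 0 < den m 0 by rewrite den_gt0 // normc0 ler01.
move: (normc _) (den m 0) => r D D0 r0 r1 e.
have r2 : 0 < 1 + r by lra.
have rD : 0 < (1 + r) * D := mulr_gt0 r2 D0.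
have -> : (1 + r) / (1 - r) = ((1 + r) * D) ^+ 2.
  have e' : (1 - r ^+ 2) * D ^+ 2 = 1 by rewrite e mulVf // gt_eqF ?exprn_gt0.
  have r1' : 1 - r != 0 by rewrite gt_eqF // subr_gt0.
  apply: (mulIf r1'); rewrite divfK // exprMn.
  have -> : (1 + r) ^+ 2 * D ^+ 2 * (1 - r) =
    (1 + r) * ((1 - r ^+ 2) * D ^+ 2) by ring.
  by rewrite e' mulr1.
rewrite lnXn // -[ln _ *+ 2]mulr_natl !ler_pM2l // !ler_ln ?posrE ?mulr_gt0 //.
by apply/andP; split; nra.
Qed.

Lemma generated_par g : H g -> exists n, realizes (par q n) g.
Proof.
elim=> [|f ->|f _ [n rf]|f f' _ [n rf] _ [k rf']].
- by exists 0; rewrite par0; exact: realizes_id.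
- by exists 1.
- by exists (- n); rewrite -par_opp; exact: realizes_inv.
- by exists (n + k); rewrite -par_add; exact: realizes_comp.
Qed.

Lemma iter_par (n : nat) : H (iter n p) /\ realizes (par q n%:Z) (iter n p).
Proof.
elim: n => [|n [IH1 IH2]].
  by split; [exact: generated_id | rewrite par0; exact: realizes_id].
split; first exact: (generated_comp (generated_mem _) IH1).
have -> : n.+1%:Z = 1 + n%:Z by [].
by rewrite -par_add; exact: (realizes_comp real_p IH2).
Qed.

Lemma iter_par_inj : injective (fun n : nat => iter n p).
Proof.
move=> n k /(congr1 (fun g => (1 - normc (\val (g (disc0 R))) ^+ 2)^-1)).
rewrite (orbit_den (iter_par n).2) (orbit_den (iter_par k).2) !invrK.
have t0 : normc (kap q 0) ^+ 2 != 0.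
  by rewrite kap0 sqr_normcE /= oppr0 expr0n add0r sqrrN expf_eq0 tau_neq0.
have re0 : complex.Re (kap q 0) = 0 by rewrite kap0 /= oppr0.
rewrite !den_par_sqr re0 !mulr0 !addr0 => /addrI e.
have /eqP := mulIf t0 e; rewrite -!pmulrn eqrXn2 ?ler0n //.
by rewrite eqr_nat => /eqP.
Qed.

(** The distance grows like [2 * ln `|n|]: the Poincare series converges as
    the series of [(1 + `|n|) ^ (- 2 * s)] does. *)
Lemma par_dist_ge : exists a : R, forall n g, realizes (par q n) g ->
  2 * (a + ln (1 + `|n%:~R|)) <= d g.
Proof.
pose c := Num.min (`|tau q| / 4) 1.
have c0 : 0 < c by rewrite lt_min ltr01 divr_gt0 ?tau_gt0.
exists (ln c) => n g rg; have n0 : 0 < 1 + `|n%:~R| :> R by rewrite ltr_pwDl.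
have /andP[+ _] := orbit_dist rg; apply: le_trans.
rewrite ler_pM2l // -lnM ?posrE // ler_ln ?posrE ?mulr_gt0 //; last first.
  by rewrite den_gt0 // normc0 ler01.
apply: (@den_par_strip_ge _ _ 2^-1); rewrite ?normc0 ?ler01 ?invr_gt0 ?tau_gt0 //.
rewrite /strip kap0 /= oppr0 normr0 expr0n add0r sqrrN sqrtr_sqr.
by rewrite lexx subrr mul0r lexx.
Qed.

Lemma par_dist_le : exists a : R, forall n g, realizes (par q n) g ->
  d g <= 2 * (a + ln (1 + `|n%:~R|)).
Proof.
pose c := 2 * (1 + 2 * `|tau q|).
have t0 := tau_gt0 q; have c0 : 0 < c by rewrite /c; lra.
exists (ln c) => n g rg; have n0 : 0 < 1 + `|n%:~R| :> R by rewrite ltr_pwDl.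
have /andP[_ le] := orbit_dist rg; apply: le_trans le _.
have z1 : normc (0 : R[i]) <= 1 by rewrite normc0 ler01.
rewrite ler_pM2l // -lnM ?posrE // ler_ln ?posrE ?mulr_gt0 ?den_gt0 //.
by rewrite /c -mulrA ler_pM2l // den_par_le.
Qed.

Local Notation poincare s := (\esum_(g in H) (expR (- (s * d g)))%:E).

Lemma poincare_finite s : 2^-1 < s -> (poincare s < +oo)%E.
Proof.
move=> s12; have [a ha] := par_dist_ge.
have [n nP] : exists n : (disc R -> disc R) -> int,
    forall g, H g -> realizes (par q (n g)) g.
  have /choice[n nP] : forall g, exists n, H g -> realizes (par q n) g.
    move=> g; have [Hg|nHg] := pselect (H g); last by exists 0.
    by have [n rn] := generated_par Hg; exists n.
  by exists n.
pose b := 2 * s - 1; have b0 : 0 < b by rewrite /b; lra.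
apply: le_lt_trans (ltry (expR (- (2 * s) * a) * (2 * (1 + b^-1)))).
apply: ge_ereal_sup => _ [A [finA AH] <-].
rewrite fsbig_finite //= sumEFin lee_fin.
set r := finmap.enum_fset _.
have rH g : g \in r -> H g.
  by move=> gr; apply: AH; have := gr; rewrite /r in_fset_set // inE.
pose F g : R := expR (- (1 + b) * ln (1 + `|(n g)%:~R|)).
apply: (@le_trans _ _ (\sum_(g <- r) expR (- (2 * s) * a) * F g)).
  rewrite big_seq [leRHS]big_seq; apply: ler_sum => g gr.
  rewrite -expRD ler_expR /b; have := ha _ _ (nP g (rH g gr)).
  move: (ln _) (d g) => L D; have s0 : 0 < s by lra.
  by move=> h; rewrite -(ler_pM2l s0) in h; lra.
rewrite -mulr_sumr ler_wpM2l ?expR_ge0 //.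
rewrite -(big_map n xpredT (fun k => expR (- (1 + b) * ln (1 + `|k%:~R|)))).
apply: sum_pow_int => //; rewrite map_inj_in_uniq ?finmap.fset_uniq //.
move=> f g fr gr e; have rf := nP f (rH f fr); rewrite e in rf.
exact: realizes_ext rf (nP g (rH g gr)).
Qed.

(** The iterates alone dominate the harmonic series. *)
Lemma poincare_infinite s : 0 < s -> s < 2^-1 -> poincare s = +oo%E.
Proof.
move=> s0 s12; have [a ha] := par_dist_le.
apply/eqP; apply: contraPT (@dvg_harmonic R) => fin; apply.
pose K := expR (- (2 * s) * a); have K0 : 0 < K := expR_gt0 _.
have ge N : ((K * \sum_(0 <= i < N) (i.+1%:R)^-1)%:E <= poincare s)%E.
  pose A := [set iter n p | n in `I_N].
  have finA : finite_set A by apply: finite_image; exact: finite_II.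
  apply: esum_ge; exists A.
    by split=> // _ [n _ <-]; exact: (iter_par n).1.
  rewrite (_ : A = [set iter n p | n in `I_N]) //.
  rewrite fsbig_image; last by move=> n k _ _; exact: iter_par_inj.
  rewrite -fsbig_ord /= sumEFin lee_fin big_mkord mulr_sumr.
  apply: ler_sum => i _.
  have i0 : 0 < i.+1%:R :> R by [].
  rewrite -[X in K * X]lnK ?posrE ?invr_gt0 // -expRD ler_expR lnV ?posrE //.
  have := ha _ _ (iter_par i).2; rewrite -pmulrn normr_nat nat1r.
  have : 0 <= ln i.+1%:R :> R by rewrite ln_ge0 // ler1n.
  move: (ln _) (d _) => L D L0; rewrite -(ler_pM2l s0) => h.
  have : s * L <= 2^-1 * L by rewrite ler_wpM2r // ltW.
  by lra.
apply: nondecreasing_is_cvgn.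
  apply/nondecreasing_seqP => n; rewrite /series /= big_nat_recr //= lerDl.
  by rewrite /harmonic invr_ge0.
have fin0 : (0 <= poincare s)%E by apply: esum_ge0 => g _; rewrite lee_fin expR_ge0.
exists (K^-1 * fine (poincare s)) => _ [N _ <-].
rewrite ler_pdivlMl // -lee_fin fineK; first exact: ge.
by rewrite ge0_fin_numE // ltey.
Qed.

Lemma critical_exponent_par : critical_exponent H = (2^-1)%:E.
Proof.
apply/eqP; rewrite eq_le; apply/andP; split.
  apply/lee_addgt0Pr => e e0; apply: ge_ereal_inf.
  exists (2^-1 + e)%:E => //; exists (2^-1 + e) => //; split=> /=; first by lra.
  by apply: poincare_finite; rewrite ltrDl.
apply: le_ereal_inf_tmp => _ [s [/= s0 fin] <-]; rewrite lee_fin leNgt.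
by apply/negP => s12; move: fin; rewrite poincare_infinite.
Qed.

End CriticalExponent.

Theorem theorem2 (R : realType) (h p : disc R -> disc R) :
  schottky h p ->
  let Lambda_infty := diverging_on_average (generated [set h; p]) in
  hausdorff_dim (@visual_dist R) Lambda_infty =
    critical_exponent (generated [set p]) /\
  hausdorff_dim (@visual_dist R) Lambda_infty = (2^-1)%:E.
Proof.
move=> /schottky_pingpong [P [real_h real_p]] /=.
rewrite (critical_exponent_par real_p).
by split; apply/eqP; rewrite eq_le (diverging_dim_le real_h real_p);
  exact: (diverging_dim_ge real_h real_p).
Qed.
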